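(* Let $N=2^n$, let $0<\tau\le\epsilon\le\frac13\left(1-\frac1N\right)$, and let $\mathsf{RQC}(n,d)$ be the ensemble of $n$-qubit brickwork random quantum circuits of depth $d$, with $$\frac{\log_2(n)}{\log_2(5/4)}\le d\le\frac{n+\log_2(n)}{\log_2(5/4)} .$$ Assume there exists an algorithm that, with probability $\beta$ over $U\sim\mathsf{RQC}(n,d)$ and probability $\alpha$ over its internal randomness, produces a hypothesis $\hat{\mathcal{E}}$ such that $d_\diamond(\hat{\mathcal{E}},U(\cdot)U^\dagger)\le\epsilon$, using $q$ queries with tolerance $\tau$ to $\mathsf{QPStat}_U$. Then $$q+1\ge\Omega\!\left(\frac{(2\alpha-1)\beta}{n}\,\tau^2\left(\frac54\right)^d\right).$$
   Context: $\mathcal{S}_N$ is the set of density matrices on $\mathbb{C}^N$. For maps on $N\times N$ matrices, $\|\mathcal{E}\|_\diamond=\max_{\rho\in\mathcal{S}_{N^2}}\|(\mathcal{E}\otimes\mathcal{I})(\rho)\|_1$ ($\mathcal{I}$ the identity map, $\|\cdot\|_1$ the Schatten 1-norm) and $d_\diamond(\mathcal{E}_1,\mathcal{E}_2)=\frac12\|\mathcal{E}_1-\mathcal{E}_2\|_\diamond$. The hypothesis $\hat{\mathcal{E}}$ is a quantum channel (CPTP map) on $\mathcal{S}_N$. Oracle: $\mathsf{QPStat}_U$ is the oracle $\mathsf{QPStat}_{\mathcal{E}}$ for $\mathcal{E}=U(\cdot)U^\dagger$; $\mathsf{QPStat}_{\mathcal{E}}$ takes as input a Hermitian $N\times N$ observable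 $O$ with $\|O\|_\infty\le1$ (operator norm), a state $\rho\in\mathcal{S}_N$ and a tolerance $\tau>0$, and returns some $a\in\mathbb{R}$ satisfying $|a-\operatorname{Tr}(O\mathcal{E}(\rho))|\le\tau$ (any such value may be returned, and the algorithm must work for all valid responses). The ensemble $\mathsf{RQC}(n,d)$: the distribution of unitaries $$U=(I_2\otimes U^{(d)}_{2,3}\otimes U^{(d)}_{4,5}\otimes\cdots)(U^{(d-1)}_{1,2}\otimes U^{(d-1)}_{3,4}\otimes\cdots)\cdots(U^{(1)}_{1,2}\otimes U^{(1)}_{3,4}\otimes\cdots),$$ i.e. $d$ alternating layers, odd layers pairing qubits $(1,2),(3,4),\dots$ and even layers pairing $(2,3),(4,5),\dots$ (identity on unpaired end qubits), where the $U^{(l)}_{i,j}$ are independent two-qubit unitaries distributed according to the Haar measure on $U(4)$ and $I_2$ is the single-qubit identity. ''With probability $\beta$ over $U$ and probability $\alpha$ over its internal randomness'' means: with probability at least $\beta$ over the draw of $U$, the algorithm run on $U$ succeeds with probability at least $\alpha$ over its internal randomness. The $\Omega$ hides an absolute constant. *)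

(* Defs.v *)
From HB Require Import structures.
From mathcomp Require Import all_boot all_order all_algebra.
From mathcomp Require Import all_classical all_reals all_analysis.
From mathcomp Require Import complex.
From mathcomp Require mxtens.

Set Implicit Arguments.
Unset Strict Implicit.
Unset Printing Implicit Defensive.

Import Order.TTheory GRing.Theory Num.Theory.
Import numFieldNormedType.Exports.

Local Open Scope classical_set_scope.
Local Open Scope ring_scope.
Local Open Scope sesquilinear_scope.

Section QuantumMaps.
Context (R : realType).

Definition psd (N : nat) (A : 'M[R[i]]_N) : Prop :=
  A ^t* = A /\ forall v : 'cV[R[i]]_N, 0 <= (v ^t* *m A *m v) 0 0.

Definition density (N : nat) (rho : 'M[R[i]]_N) : Prop :=
  psd rho /\ \tr rho = 1.

Definition singular_value (N : nat) (A : 'M[R[i]]_N) (i : 'I_N) : R :=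
  Num.sqrt (complex.Re (spectral_diag (A ^t* *m A) 0 i)).

Definition trace_norm (N : nat) (A : 'M[R[i]]_N) : R :=
  \sum_(i < N) singular_value A i.

Definition vec_norm (N : nat) (v : 'cV[R[i]]_N) : R :=
  Num.sqrt (\sum_(i < N)
    (complex.Re (v i 0) ^+ 2 + complex.Im (v i 0) ^+ 2)).

Definition op_norm (N : nat) (A : 'M[R[i]]_N) : R :=
  sup [set vec_norm (A *m v) | v in [set v : 'cV[R[i]]_N | vec_norm v = 1]].

Definition observable (N : nat) (O : 'M[R[i]]_N) : Prop :=
  O ^t* = O /\ op_norm O <= 1.

(* E tensor the identity map on k x k matrices: writing
   X = \sum_(i, j) X_ij (x) |i><j|, apply E to each N x N block X_ij. *)
Definition ampliation (N k : nat) (E : 'M[R[i]]_N -> 'M[R[i]]_N)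
    (X : 'M[R[i]]_(N * k)) : 'M[R[i]]_(N * k) :=
  \sum_(i < k) \sum_(j < k)
    mxtens.tensmx
      (E (\matrix_(a, b)
            X (mxtens.mxtens_index (a, i)) (mxtens.mxtens_index (b, j))))
      (delta_mx i j).

Definition completely_positive (N : nat) (E : 'M[R[i]]_N -> 'M[R[i]]_N) :
    Prop :=
  forall (k : nat) (X : 'M[R[i]]_(N * k)), psd X -> psd (ampliation E X).

Definition channel (N : nat) (E : 'M[R[i]]_N -> 'M[R[i]]_N) : Prop :=
  [/\ linear E, completely_positive E & forall X, \tr (E X) = \tr X].

Definition unitary_channel (N : nat) (U : 'M[R[i]]_N) (X : 'M[R[i]]_N) :
    'M[R[i]]_N := U *m X *m U ^t*.

Definition diamond_norm (N : nat) (E : 'M[R[i]]_N -> 'M[R[i]]_N) : R :=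
  sup [set trace_norm (ampliation E rho) |
        rho in [set rho : 'M[R[i]]_(N * N) | density rho]].

Definition diamond_dist (N : nat) (E1 E2 : 'M[R[i]]_N -> 'M[R[i]]_N) : R :=
  diamond_norm (fun X => E1 X - E2 X) / 2.

(* Tr(O E(rho)), which is real for O Hermitian and E positive. *)
Definition expectation_value (N : nat) (E : 'M[R[i]]_N -> 'M[R[i]]_N)
    (O rho : 'M[R[i]]_N) : R := complex.Re (\tr (O *m E rho)).

End QuantumMaps.

(* The Borel sigma-algebra of the N x N complex matrices seen as R^(2 N^2),
   generated by the real and imaginary parts of the entries. *)
Definition mx_cylinder (R : realType) (N : nat) : set (set 'M[R[i]]_N) :=
  [set B | exists (i j : 'I_N) (Y : set R), measurable Y /\
     (B = [set X : 'M[R[i]]_N | Y (complex.Re (X i j))] \/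
      B = [set X : 'M[R[i]]_N | Y (complex.Im (X i j))])].

HB.instance Definition _ (R : realType) := isPointed.Build R[i] 0.

Definition mxspace (R : realType) (N : nat) :=
  g_sigma_algebraType (@mx_cylinder R N).

Section RandomCircuits.
Context (R : realType).

Definition haar_measure (m : nat) (mu : probability (mxspace R m) R) : Prop :=
  mu [set X : 'M[R[i]]_m | X \is unitarymx] = 1%E /\
  forall (V : 'M[R[i]]_m) (B : set (mxspace R m)),
    V \is unitarymx -> measurable B ->
    mu [set X : 'M[R[i]]_m | B (V *m X)] = mu B /\
    mu [set X : 'M[R[i]]_m | B (X *m V)] = mu B.

Definition mutually_independent (d d' : measure_display)
    (Omega : measurableType d) (T : measurableType d')
    (P : probability Omega R) (I : finType) (D : {set I})
    (X : I -> Omega -> T) : Prop :=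
  forall (J : {set I}) (B : I -> set T),
    J \subset D -> (forall i, measurable (B i)) ->
    P [set w | forall i, i \in J -> B i (X i w)] =
    (\prod_(i in J) P (X i @^-1` B i))%E.

(* Layers and qubits are numbered from 0, so that layer l carries a gate on the
   qubits i, i + 1 exactly when i + 1 < n and i has the parity of l. *)
Definition brick (n l i : nat) : bool := (i.+1 < n)%N && (odd i == odd l).

Definition covered (n l k : nat) : bool :=
  brick n l k || ((0 < k)%N && brick n l k.-1).

(* The k-th bit of the basis vector |x> of the n qubits, qubit 0 being the
   leftmost tensor factor (most significant bit). *)
Definition qubit (n x k : nat) : bool := odd (x %/ 2 ^ (n - k.+1)).

Definition qubit_pair (n x k : nat) : 'I_4 :=
  inord (2 * qubit n x k + qubit n x k.+1)%N.

(* The tensor product, entry by entry, of the gates g i on the qubits i, i + 1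
   carrying a brick and of I_2 on the remaining qubits. *)
Definition layer (n l : nat) (g : 'I_n -> 'M[R[i]]_4) : 'M[R[i]]_(2 ^ n) :=
  \matrix_(x, y)
    ((\prod_(i < n | brick n l i) g i (qubit_pair n x i) (qubit_pair n y i)) *
     (\prod_(k < n | ~~ covered n l k) (qubit n x k == qubit n y k)%:R)).

(* Layer 0 is applied first, i.e. is the rightmost factor. *)
Definition circuit (n d : nat) (g : 'I_d * 'I_n -> 'M[R[i]]_4) :
    'M[R[i]]_(2 ^ n) :=
  \prod_(l < d) layer (rev_ord l) (fun i => g (rev_ord l, i)).

Definition bricks (n d : nat) : {set 'I_d * 'I_n} :=
  [set p : 'I_d * 'I_n | brick n p.1 p.2]%SET.

(* g is a family of gates whose circuit is distributed as RQC(n, d); the values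
   of g outside of the bricks are irrelevant. *)
Definition RQC_gates (dO : measure_display) (Omega : measurableType dO)
    (P : probability Omega R) (haar : probability (mxspace R 4) R) (n d : nat)
    (g : 'I_d * 'I_n -> Omega -> mxspace R 4) : Prop :=
  [/\ forall p, p \in bricks n d -> measurable_fun [set: Omega] (g p),
      forall p w, p \in bricks n d -> (g p w : 'M[R[i]]_4) \is unitarymx,
      forall p B, p \in bricks n d -> measurable B ->
        P (g p @^-1` B) = haar B
    & mutually_independent P (bricks n d) g].

End RandomCircuits.

(* "E happens with probability at least a", for an event E that is not known
   to be measurable. *)
Definition prob_ge (R : realType) (d : measure_display) (T : measurableType d)
    (P : probability T R) (E : set T) (a : R) : Prop :=
  exists A : set T, [/\ measurable A, A `<=` E & (a%:E <= P A)%E].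

Section Learning.
Context (R : realType).

Definition query (N : nat) := (mxspace R N * mxspace R N)%type.

(* The response to a query (observable, state) may depend on the earlier
   queries; every valid response function is allowed. *)
Definition QPStat (N : nat) (E : 'M[R[i]]_N -> 'M[R[i]]_N) (tau : R)
    (orc : seq (query N) -> query N -> R) : Prop :=
  (forall h (O rho : 'M[R[i]]_N), observable O -> density rho ->
     `|orc h (O, rho) - expectation_value E O rho| <= tau) /\
  (forall k : nat, measurable_fun setT
     (fun p : k.-tuple (query N) * query N => orc p.1 p.2)).

(* A randomized adaptive algorithm making q queries, with random seed in S.
   ask s a is the query made after the answers a; guess s a is the output. *)
Record learner (dS : measure_display) (S : measurableType dS) (N q : nat) :=
  Learner {
    ask : S -> seq R -> query N ;
    guess : S -> seq R -> 'M[R[i]]_N -> 'M[R[i]]_N ;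
    ask_observable : forall s a, observable (ask s a).1 ;
    ask_density : forall s a, density (ask s a).2 ;
    guess_channel : forall s a, channel (guess s a) ;
    ask_measurable : forall k : nat,
      measurable_fun setT (fun p : S * k.-tuple R => ask p.1 p.2) ;
    guess_measurable : forall X : 'M[R[i]]_N,
      measurable_fun setT
        (fun p : S * q.-tuple R => guess p.1 p.2 X : mxspace R N)
  }.

Fixpoint transcript (N : nat) (ask : seq R -> query N)
    (orc : seq (query N) -> query N -> R) (k : nat) : seq (query N * R) :=
  if k is k'.+1 then
    let h := transcript ask orc k' in
    let x := ask (unzip2 h) in
    rcons h (x, orc (unzip1 h) x)
  else [::].

Definition output (dS : measure_display) (S : measurableType dS) (N q : nat)
    (A : learner S N q) (orc : seq (query N) -> query N -> R) (s : S) :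
    'M[R[i]]_N -> 'M[R[i]]_N :=
  guess A s (unzip2 (transcript (ask A s) orc q)).

Definition learns (dS : measure_display) (S : measurableType dS)
    (Q : probability S R) (N q : nat) (A : learner S N q)
    (tau eps alpha : R) (U : 'M[R[i]]_N) : Prop :=
  forall orc, QPStat (unitary_channel U) tau orc ->
    prob_ge Q
      [set s | diamond_dist (output A orc s) (unitary_channel U) <= eps] alpha.

Definition log2 (x : R) : R := ln x / ln 2.

End Learning.

(* Main.v *)
(* Answer the learner's queries by Tr(O) / 2^n whenever this is within tau of the
   truth. As long as it is, the queries do not depend on U. If the learner
   succeeds, then one of these queries deviates from Tr(O) / 2^n by at least tau,
   or the learned channel E does: the observable E(|0><0|) in the state |0><0|
   detects the difference from Tr(O) / 2^n since eps <= (1 - 2^-n) / 3. Hence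
   alpha * beta <= (q + 1) * max_(O, rho) Pr[deviation >= tau], which Chebyshev's
   inequality bounds by (q + 1) * Var / tau^2.

   In the Pauli basis the variance is the sum of o_P^2 E[Tr(P rho_U)^2] over P <> 1.
   A Haar random gate acts on the second moments of Pauli coefficients as its
   invariance under Clifford gates dictates, and on the purities F(B) of subsystems
   as follows: F(B) is unchanged unless the pair p of qubits is cut by B, in which
   case it becomes 2/5 (F(B u p) + F(B \ p)). The functions a 2^-|B| + b 2^(|B|-n)
   are stationary; the difference of F with the one that matches F at the empty and
   full sets shrinks by 4/5 in each layer, because every other B is cut by a
   gate of one of two consecutive layers. Inclusion-exclusion over the support of P
   turns this into E[Tr(P rho_U)^2] <= 2^-n + 2 (4/5)^(d-1), and the upper bound
   on d makes 2^-n at most n (4/5)^d. *)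

Require Import Defs.
From HB Require Import structures.
From mathcomp Require Import all_boot all_order all_algebra.
From mathcomp Require Import ring lra.
From mathcomp Require Import all_classical all_reals all_analysis.
From mathcomp Require Import measurable_realfun.
From mathcomp Require Import complex.

Set Implicit Arguments.
Unset Strict Implicit.
Unset Printing Implicit Defensive.

Import Order.TTheory GRing.Theory Num.Theory.
Import numFieldNormedType.Exports.

Local Open Scope ring_scope.
Local Open Scope sesquilinear_scope.

(** * Pauli matrices *)

(** Chebyshev's inequality needs a fixed observable and a fixed state, while the learner's queries
    and its hypothesis depend on its seed. Under the reference answers they depend on nothing else,
    so the bound is applied seed by seed and Fubini's theorem on circuits times seeds combines it
    with the success probabilities; this is where the measurability of the learner enters. The
    number 2/5 is D / (D^2 + 1) for D = 2, and the two terms of the purity rule then give the rate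
    4/5. A layer yields a single such factor, however many of its gates cut the set. Purities
    themselves do not tend to zero, hence the subtraction of a stationary function. A purity only
    sees the sum of the second moments over all Pauli strings supported in a set. Individual moments
    are recovered because, once every qubit has met a gate, a moment depends on the support alone.
    Each inclusion-exclusion step is a combination with coefficients 2/3 and -1/3, of total size
    one, so that the error does not grow with the support. *)

Lemma adjmxM (C : numClosedFieldType) m n p (A : 'M[C]_(m, n)) (B : 'M[C]_(n, p)) :
  (A *m B)^t* = B^t* *m A^t*.
Proof. by rewrite trmx_mul map_mxM. Qed.

Section BigopLemmas.
Context (C : comNzRingType).

Lemma prod_natb (I : finType) (P : pred I) (c : pred I) :
  \prod_(i | P i) ((c i)%:R : C) = [forall i, P i ==> c i]%:R.
Proof.
case: forallP => [H|/forallP].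
  by rewrite big1 // => i Pi; move: (H i); rewrite Pi /= => ->.
rewrite negb_forall => /fintype.existsP[k]; rewrite negb_imply => /andP[Pk /negbTE ck].
by rewrite (bigD1 k) //= ck mul0r.
Qed.

Lemma sumr_delta (I : finType) (i0 : I) (F : I -> C) :
  \sum_i (i == i0)%:R * F i = F i0.
Proof.
rewrite (bigD1 i0) //= eqxx mul1r big1 ?addr0 // => i /negbTE ->.
by rewrite mul0r.
Qed.

End BigopLemmas.

(* The last clause is completeness: the sum of the f j (x) f j is N times the
   swap operator. *)
Definition pauli_like (R : realType) (K : finType) (N : nat)
    (f : K -> 'M[R[i]]_N) : Prop :=
  [/\ forall j, (f j)^t* = f j,
      forall j k, \tr (f j *m f k) = N%:R * (j == k)%:R
    & forall p q r s, \sum_j f j p q * f j r s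
                      = N%:R * ((p == s)%:R * (q == r)%:R)].

Section PauliLike.
Context (R : realType) (K : finType) (N : nat) (f : K -> 'M[R[i]]_N).
Hypothesis N_gt0 : (0 < N)%N.
Hypothesis f_pauli : pauli_like f.
Local Notation C := R[i].

Lemma mxtrace_mulE (A B : 'M[C]_N) :
  \tr (A *m B) = \sum_p \sum_q A p q * B q p.
Proof. by apply: eq_bigr => p _; rewrite mxE. Qed.

Let NC : (N%:R : C) != 0.
Proof. by rewrite pnatr_eq0 -lt0n. Qed.

(** Completeness makes the sum of the [f j (x) f j] a multiple of the swap, and the partial trace of
    the swap against X is X. *)
Lemma pauli_expand (X : 'M[C]_N) :
  X = \sum_j (\tr (f j *m X) / N%:R) *: f j.
Proof.
case: f_pauli => _ _ fC; apply/matrixP => r s; rewrite summxE.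
under eq_bigr => j _ do rewrite mxE mxtrace_mulE mulrAC mulr_suml.
rewrite -mulr_suml exchange_big /=.
under eq_bigr => p _.
  under eq_bigr => j _ do rewrite mulr_suml.
  rewrite exchange_big /=.
  under eq_bigr => q _.
    under eq_bigr => j _ do rewrite mulrAC.
    rewrite -mulr_suml fC -!mulrA mulrCA.
    over.
  over.
rewrite (eq_bigr (fun p => (p == s)%:R * (N%:R * X r p))); last first.
  move=> p _; rewrite -mulr_sumr; congr (_ * _).
  rewrite (eq_bigr (fun q => (q == r)%:R * (N%:R * X q p))) ?sumr_delta //.
  by move=> q _; rewrite mulrCA.
by rewrite sumr_delta mulrAC mulfV // mul1r.
Qed.

Lemma pauli_parseval (X Y : 'M[C]_N) :
  \tr (X *m Y) = (\sum_j \tr (f j *m X) * \tr (f j *m Y)) / N%:R.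
Proof.
rewrite {1}(pauli_expand X) mulmx_suml raddf_sum /= mulr_suml.
by apply: eq_bigr => j _; rewrite -scalemxAl mxtraceZ mulrAC.
Qed.

Lemma trmx_conj_tr (A : 'M[C]_N) : \tr (A ^t*) = (\tr A)^*.
Proof. by rewrite -map_trmx mxtrace_tr trace_map_mx. Qed.

(** Pauli coefficients of Hermitian matrices are real, which lets all moments below live in [R]. *)
Lemma trmx_herm_real (A B : 'M[C]_N) : A ^t* = A -> B ^t* = B ->
  ((complex.Re (\tr (A *m B)))%:C)%C = \tr (A *m B).
Proof.
move=> hA hB; apply: RRe_real; rewrite CrealE -trmx_conj_tr.
by rewrite adjmxM hA hB mxtrace_mulC.
Qed.

End PauliLike.

Section Pauli.
Context (R : realType).
Local Notation C := R[i].

(* The Pauli matrix with label (z, x) is i^(z x) X^x Z^z. *)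
Definition sigma (j : bool * bool) (a b : bool) : C :=
  (a (+) b == j.2)%:R * (-1) ^+ (j.1 && b) * (if j.1 && j.2 then 'i else 1).

Lemma sigma_adj j a b : (sigma j a b)^* = sigma j b a.
Proof.
case: j => [[] []]; case: a; case: b;
  rewrite /sigma /= ?(expr0, expr1, mulr1, mul1r, mulr0, mul0r, rmorph0, rmorph1);
  by rewrite ?(rmorphN, mulN1r, opprK, oppr0) /= ?rmorph1 ?conjCi ?opprK.
Qed.

Lemma sigma_I a b : sigma (false, false) a b = (a == b)%:R.
Proof. by case: a; case: b; rewrite /sigma /= !mulr1. Qed.

Lemma big_pairbool (V : zmodType) (F : bool * bool -> V) :
  \sum_j F j = F (true, true) + F (true, false) + F (false, true) + F (false, false).
Proof.
rewrite (eq_bigr (fun p => F (p.1, p.2))); last by case.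
by rewrite -(pair_bigA _ (fun i j => F (i, j))) /= !big_bool /= addrA.
Qed.

Lemma sigma_complete a b c d :
  \sum_j sigma j a b * sigma j c d = 2 * ((a == d)%:R * (b == c)%:R).
Proof.
rewrite big_pairbool /sigma; case: a; case: b; case: c; case: d => /=;
  rewrite ?(expr0, expr1, mulr1, mul1r, mulr0, mul0r, add0r, addr0, mulN1r, mulrN1);
  rewrite ?(mulNr, mulrN, opprK, subrr, addNr, oppr0, addrN) -?expr2 ?sqrCi; ring.
Qed.

Lemma sigma_ortho j k :
  \sum_a \sum_b sigma j a b * sigma k b a = 2 * (j == k)%:R.
Proof.
rewrite !big_bool /sigma /=; case: j => [[] []]; case: k => [[] []] /=;
  rewrite ?(expr0, expr1, mulr1, mul1r, mulr0, mul0r, add0r, addr0, mulN1r, mulrN1);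
  rewrite ?(mulNr, mulrN, opprK, subrr, addNr, oppr0, addrN) -?expr2 ?sqrCi; ring.
Qed.

(** A basis index of two qubits is split into its two bits; [enc] is the encoding used by
    [qubit_pair], which [layerE] relies on. *)
Definition hi (p : 'I_4) : bool := (1 < p)%N.
Definition lo (p : 'I_4) : bool := odd p.
Definition enc (b : bool * bool) : 'I_4 := inord (2 * b.1 + b.2)%N.

Lemma enc_lt (b : bool * bool) : (2 * b.1 + b.2 < 4)%N.
Proof. by case: b => [[] []]. Qed.

Lemma hi_enc b : hi (enc b) = b.1.
Proof. by rewrite /hi inordK ?enc_lt //; case: b => [[] []]. Qed.

Lemma lo_enc b : lo (enc b) = b.2.
Proof. by rewrite /lo inordK ?enc_lt //; case: b => [[] []]. Qed.

Lemma enc_hilo p : enc (hi p, lo p) = p.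
Proof. by apply: val_inj; rewrite /= inordK ?enc_lt //; case: p => [[|[|[|[|]]]]]. Qed.

Lemma hilo_enc b : (hi (enc b), lo (enc b)) = b.
Proof. by rewrite hi_enc lo_enc; case: b. Qed.

Lemma eq_hilo p q : (p == q) = (hi p == hi q) && (lo p == lo q).
Proof.
apply/eqP/andP => [->//|[/eqP h /eqP l]].
by rewrite -[p]enc_hilo h l enc_hilo.
Qed.

Lemma big_ord4 (V : zmodType) (F : 'I_4 -> V) :
  \sum_p F p = \sum_a \sum_b F (enc (a, b)).
Proof.
rewrite (reindex enc) /=; last first.
  by exists (fun p => (hi p, lo p)) => p _; rewrite ?hilo_enc ?enc_hilo.
rewrite (eq_bigr (fun p => F (enc (p.1, p.2)))); last by case.
by rewrite -(pair_bigA _ (fun i j => F (enc (i, j)))).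
Qed.

Definition tau (j : (bool * bool) * (bool * bool)) : 'M[C]_4 :=
  \matrix_(p, q) (sigma j.1 (hi p) (hi q) * sigma j.2 (lo p) (lo q)).

Lemma tau_pauli : pauli_like tau.
Proof.
split.
- by move=> j; apply/matrixP => p q; rewrite !mxE rmorphM /= !sigma_adj.
- move=> [j1 j2] [k1 k2]; rewrite mxtrace_mulE.
  under eq_bigr => p _ do under eq_bigr => q _ do rewrite !mxE mulrACA /=.
  rewrite big_ord4 /=.
  transitivity ((\sum_a \sum_c sigma j1 a c * sigma k1 c a) *
     (\sum_b \sum_d sigma j2 b d * sigma k2 d b)).
    rewrite mulr_suml; apply: eq_bigr => a _; rewrite mulr_sumr.
    apply: eq_bigr => b _; rewrite big_ord4 mulr_suml; apply: eq_bigr => c _.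
    by rewrite mulr_sumr; apply: eq_bigr => d _; rewrite !hi_enc !lo_enc.
  by rewrite !sigma_ortho xpair_eqE -mulnb natrM; ring.
- move=> p q r s.
  under eq_bigr => j _ do rewrite !mxE mulrACA.
  rewrite -(pair_bigA _ (fun i j => sigma i (hi p) (hi q) * sigma i (hi r) (hi s) *
    (sigma j (lo p) (lo q) * sigma j (lo r) (lo s)))) /=.
  under eq_bigr => j _ do rewrite -mulr_sumr sigma_complete.
  rewrite -mulr_suml sigma_complete !(eq_hilo p) !(eq_hilo q) -!mulnb !natrM.
  ring.
Qed.

End Pauli.

Section Bits.
Context (n : nat).

Definition bits (x : nat) : {ffun 'I_n -> bool} := [ffun m : 'I_n => qubit n x m].

Lemma odd_div_inj m x y : (x < 2 ^ m)%N -> (y < 2 ^ m)%N ->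
  (forall k, (k < m)%N -> odd (x %/ 2 ^ k) = odd (y %/ 2 ^ k)) -> x = y.
Proof.
elim: m x y => [|m IH] x y; first by rewrite expn0 !ltnS !leqn0 => /eqP-> /eqP->.
rewrite expnS mulnC => xm ym H.
rewrite -(odd_double_half x) -(odd_double_half y).
have := H 0 isT; rewrite expn0 !divn1 => ->; congr (_ + _.*2)%N.
apply: IH; rewrite -?divn2 ?ltn_divLR // => k km.
by rewrite -!divnMA -expnS; apply: H.
Qed.

Lemma bits_inj : injective (fun x : 'I_(2 ^ n) => bits x).
Proof.
move=> x y /ffunP H; apply: val_inj; apply: (@odd_div_inj n); rewrite ?ltn_ord // => k kn.
have kn' : (n - k.+1 < n)%N by rewrite ltn_subrL /=; case: (n) kn.
by have := H (Ordinal kn'); rewrite !ffunE /qubit /= subnSK // subKn // ltnW.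
Qed.

Lemma bits_onto (b : {ffun 'I_n -> bool}) :
  b \in codom (fun x : 'I_(2 ^ n) => bits x).
Proof.
by apply: inj_card_onto; [exact: bits_inj | rewrite card_ffun card_bool !card_ord].
Qed.

Definition unbits (b : {ffun 'I_n -> bool}) : 'I_(2 ^ n) := iinv (bits_onto b).

Lemma unbitsK b : bits (unbits b) = b.
Proof. exact: (f_iinv (bits_onto b)). Qed.

Lemma bitsK (x : 'I_(2 ^ n)) : unbits (bits x) = x.
Proof. by apply: bits_inj; rewrite unbitsK. Qed.

Lemma big_bits (V : nmodType) (F : {ffun 'I_n -> bool} -> V) :
  \sum_(x < 2 ^ n) F (bits x) = \sum_b F b.
Proof.
rewrite (reindex (fun x : 'I_(2 ^ n) => bits x)) //.
by exists unbits => x _; rewrite ?bitsK ?unbitsK.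
Qed.

Lemma eq_bits (x y : 'I_(2 ^ n)) : [forall m, bits x m == bits y m] = (x == y).
Proof.
apply/forallP/eqP => [H|-> //]; apply: bits_inj; apply/ffunP => m.
exact/eqP.
Qed.

(** Also used with [i = j] and [a = b], as the update of a single position. *)
Definition set2 (T : Type) (f : {ffun 'I_n -> T}) (i j : 'I_n) (a b : T) :
    {ffun 'I_n -> T} :=
  [ffun m => if m == i then a else if m == j then b else f m].

Lemma set2l T f i j (a b : T) : set2 f i j a b i = a.
Proof. by rewrite ffunE eqxx. Qed.

Lemma set2r T f i j (a b : T) : i != j -> set2 f i j a b j = b.
Proof. by rewrite ffunE eq_sym => /negbTE ->; rewrite eqxx. Qed.

Lemma set2o T f i j (a b : T) m : m != i -> m != j -> set2 f i j a b m = f m.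
Proof. by rewrite ffunE => /negbTE -> /negbTE ->. Qed.

Lemma set2_id T (f : {ffun 'I_n -> T}) i j : set2 f i j (f i) (f j) = f.
Proof. by apply/ffunP => m; rewrite ffunE; do 2![case: eqP => [->//|_]]. Qed.

Lemma set2_set2 T (f : {ffun 'I_n -> T}) i j a b c d :
  set2 (set2 f i j a b) i j c d = set2 f i j c d.
Proof. by apply/ffunP => m; rewrite !ffunE; do 2![case: eqP => // _]. Qed.

End Bits.

Section Pauli_n.
Context (R : realType) (n : nat).
Local Notation C := R[i].
Local Notation pauliT := {ffun 'I_n -> bool * bool}.

Definition pauli (k : pauliT) : 'M[C]_(2 ^ n) :=
  \matrix_(x, y) \prod_(m < n) sigma R (k m) (bits n x m) (bits n y m).

Lemma pauli_pauli : pauli_like pauli.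
Proof.
have prod2 (F : 'I_n -> C) : \prod_m (2 * F m) = (2 ^ n)%:R * \prod_m F m.
  by rewrite big_split /= prodr_const card_ord natrX.
split.
- move=> k; apply/matrixP => x y; rewrite !mxE rmorph_prod.
  by apply: eq_bigr => m _; rewrite /= sigma_adj.
- move=> j k; rewrite mxtrace_mulE.
  under eq_bigr => x _.
    under eq_bigr => y _ do rewrite !mxE -big_split /=.
    rewrite (big_bits (fun b => \prod_m (sigma R (j m) (bits n x m) (b m) *
      sigma R (k m) (b m) (bits n x m)))).
    rewrite -(bigA_distr_bigA (fun m c => sigma R (j m) (bits n x m) c *
      sigma R (k m) c (bits n x m))) /=.
    over.
  rewrite (big_bits (fun b => \prod_m \sum_c (sigma R (j m) (b m) c *
      sigma R (k m) c (b m)))).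
  rewrite -(bigA_distr_bigA (fun m b => \sum_c (sigma R (j m) b c *
      sigma R (k m) c b))) /=.
  under eq_bigr => m _ do rewrite sigma_ortho.
  rewrite prod2 prod_natb; congr (_ * (nat_of_bool _)%:R).
  apply/forallP/eqP => [H|-> m]; last exact: eqxx.
  by apply/ffunP => m; apply/eqP/H.
- move=> p q r s.
  under eq_bigr => k _ do rewrite !mxE -big_split /=.
  rewrite -(bigA_distr_bigA (fun m c => sigma R c (bits n p m) (bits n q m) *
      sigma R c (bits n r m) (bits n s m))) /=.
  under eq_bigr => m _ do rewrite sigma_complete.
  rewrite prod2 big_split /= !prod_natb.
  by congr (_ * (_ * _)); rewrite -eq_bits.
Qed.

Lemma pauli0 : pauli [ffun => (false, false)] = 1%:M.
Proof.
apply/matrixP => x y; rewrite !mxE.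
under eq_bigr => m _ do rewrite ffunE sigma_I.
by rewrite prod_natb -eq_bits.
Qed.

(** The gate u on the qubits i and j, tensored with the identity; qubit i supplies the high bit of
    the index of u. *)
Definition embed (i j : 'I_n) (u : 'M[C]_4) : 'M[C]_(2 ^ n) :=
  \matrix_(x, y) (u (enc (bits n x i, bits n x j)) (enc (bits n y i, bits n y j)) *
    \prod_(m | (m != i) && (m != j)) (bits n x m == bits n y m)%:R).

Lemma embed_adj (i j : 'I_n) (u : 'M[C]_4) : (embed i j u)^t* = embed i j (u^t*).
Proof.
apply/matrixP => a b; rewrite !mxE rmorphM rmorph_prod; congr (_ * _).
by apply: eq_bigr => l _; rewrite /= rmorph_nat eq_sym.
Qed.

(** The Pauli transfer matrix of u. Both factors under the trace are Hermitian, so taking the real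
    part loses nothing. *)
Definition transfer (u : 'M[C]_4) (a b : (bool * bool) * (bool * bool)) : R :=
  complex.Re (\tr (tau R a *m (u *m tau R b *m u^t*))) / 4.

Lemma transferE u a :
  u^t* *m tau R a *m u = \sum_b ((transfer u a b)%:C)%C *: tau R b.
Proof.
have [hA _ _] := tau_pauli R.
rewrite [LHS](@pauli_expand _ _ _ _ _ (tau_pauli R)) //.
apply: eq_bigr => b _; congr (_ *: _); rewrite /transfer.
have herm : (u *m tau R b *m u^t*)^t* = u *m tau R b *m u^t*.
  by rewrite !adjmxM trmxCK hA mulmxA.
rewrite rmorphM /= (trmx_herm_real (hA a) herm) fmorphV /= rmorph_nat.
by congr (_ / _); rewrite !mulmxA -mxtrace_mulC !mulmxA mxtrace_mulC !mulmxA.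
Qed.

Context (i j : 'I_n) (neq_ij : i != j).

(** The delta factor leaves only the four indices that agree with y off i and j. *)
Lemma sum_off (y : 'I_(2 ^ n)) (F : 'I_(2 ^ n) -> C) :
  \sum_(x < 2 ^ n) (\prod_(m | (m != i) && (m != j)) (bits n x m == bits n y m)%:R) * F x =
  \sum_(c < 4) F (unbits (set2 (bits n y) i j (hi c) (lo c))).
Proof.
under eq_bigr => x _ do rewrite prod_natb.
pose h (c : 'I_4) := unbits (set2 (bits n y) i j (hi c) (lo c)).
pose h' (x : 'I_(2 ^ n)) := enc (bits n x i, bits n x j).
pose Q (x : 'I_(2 ^ n)) := [forall m, (m != i) && (m != j) ==> (bits n x m == bits n y m)].
rewrite (bigID Q) /= [X in _ + X]big1 ?addr0; last first.
  by move=> x /negbTE; rewrite /Q => ->; rewrite mul0r.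
rewrite (reindex_onto h h') /=.
  apply: eq_big => [c|c /andP[Qc _]]; last by rewrite [[forall _, _]]Qc mul1r.
  rewrite /h' /h unbitsK set2l set2r // enc_hilo eqxx andbT.
  by apply/forallP => m; apply/implyP => /andP[mi mj]; rewrite unbitsK set2o.
move=> x /forallP Qx; rewrite /h /h' hi_enc lo_enc -[RHS]bitsK; congr unbits.
apply/ffunP => m; case: (eqVneq m i) => [->|mi]; first by rewrite set2l.
case: (eqVneq m j) => [->|mj]; first by rewrite set2r.
by rewrite set2o //; have := Qx m; rewrite mi mj /= => /eqP.
Qed.

Lemma pauliE k x y : pauli k x y =
  tau R (k i, k j) (enc (bits n x i, bits n x j)) (enc (bits n y i, bits n y j)) *
  \prod_(m | (m != i) && (m != j)) sigma R (k m) (bits n x m) (bits n y m).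
Proof.
rewrite !mxE !hi_enc !lo_enc (bigD1 i) //= (bigD1 j) 1?eq_sym //= mulrA.
by [].
Qed.

Lemma mulmx_embed m (M : 'M[C]_(m, 2 ^ n)) u b a : (M *m embed i j u) b a =
  \sum_(c < 4) M b (unbits (set2 (bits n a) i j (hi c) (lo c))) *
               u c (enc (bits n a i, bits n a j)).
Proof.
rewrite mxE; pose F (x : 'I_(2 ^ n)) :=
  M b x * u (enc (bits n x i, bits n x j)) (enc (bits n a i, bits n a j)).
transitivity (\sum_(x < 2 ^ n)
    (\prod_(m | (m != i) && (m != j)) (bits n x m == bits n a m)%:R) * F x).
  by apply: eq_bigr => x _; rewrite mxE mulrCA mulrC -mulrA mulrCA /F mulrA mulrC.
rewrite sum_off; apply: eq_bigr => c _.
by rewrite /F unbitsK set2l set2r // enc_hilo.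
Qed.

Lemma adj_embed_mulmx m (M : 'M[C]_(2 ^ n, m)) u b a :
  ((embed i j u)^t* *m M) b a =
  \sum_(c < 4) (u c (enc (bits n b i, bits n b j)))^* *
               M (unbits (set2 (bits n b) i j (hi c) (lo c))) a.
Proof.
have -> : (embed i j u)^t* *m M = (M^t* *m embed i j u)^t*.
  by rewrite adjmxM trmxCK.
rewrite mxE mxE mulmx_embed rmorph_sum; apply: eq_bigr => c _.
by rewrite rmorphM /= mulrC !mxE conjCK.
Qed.

(** Heisenberg evolution by a two-qubit gate is local: entry by entry, the letters off i and j
    factor out of both sides, and [transferE] treats the remaining 4 x 4 matrices. *)
Lemma embed_pauli u k : (embed i j u)^t* *m pauli k *m embed i j u =
  \sum_b ((transfer u (k i, k j) b)%:C)%C *: pauli (set2 k i j b.1 b.2).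
Proof.
apply/matrixP => b a; rewrite summxE.
pose S := \prod_(m | (m != i) && (m != j)) sigma R (k m) (bits n b m) (bits n a m).
transitivity ((u^t* *m tau R (k i, k j) *m u)
   (enc (bits n b i, bits n b j)) (enc (bits n a i, bits n a j)) * S); last first.
  rewrite transferE summxE mulr_suml; apply: eq_bigr => c _.
  case: c => c1 c2; rewrite mxE [in RHS]mxE -mulrA pauliE set2l set2r //.
  by congr (_ * (_ * _)); apply: eq_bigr => m /andP[mi mj]; rewrite set2o.
rewrite mulmx_embed [in RHS]mxE mulr_suml; apply: eq_bigr => c _.
rewrite mulrAC; congr (_ * _).
rewrite adj_embed_mulmx [in RHS]mxE mulr_suml; apply: eq_bigr => d _.
rewrite pauliE !unbitsK !set2l !set2r // !enc_hilo mulrA; congr (_ * _).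
  by rewrite !mxE.
by apply: eq_bigr => m /andP[mi mj]; rewrite !set2o.
Qed.

End Pauli_n.

(** * Two-qubit Clifford gates and their action on Pauli labels *)

Section TwoQubit.
Context (R : realType).
Local Notation C := R[i].
Local Notation bool2 := (bool * bool)%type.

(** Single-qubit matrices are functions on [bool], so that identities between them are checked by
    cases. *)
Definition mul2 (A B : bool -> bool -> C) a c := \sum_b A a b * B b c.
Definition adj2 (A : bool -> bool -> C) a b := (A b a)^*.
Definition one2 (a b : bool) : C := (a == b)%:R.
Definition tens (A B : bool -> bool -> C) : 'M[C]_4 :=
  \matrix_(p, q) (A (hi p) (hi q) * B (lo p) (lo q)).

Lemma eq_tens A A' B B' : A =2 A' -> B =2 B' -> tens A B = tens A' B'.
Proof. by move=> hA hB; apply/matrixP => p q; rewrite !mxE hA hB. Qed.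

Lemma tensM A B A' B' : tens A B *m tens A' B' = tens (mul2 A A') (mul2 B B').
Proof.
apply/matrixP => p q; rewrite !mxE big_ord4 /mul2 mulr_suml.
apply: eq_bigr => a _; rewrite mulr_sumr; apply: eq_bigr => b _.
by rewrite !mxE hi_enc lo_enc mulrACA.
Qed.

Lemma tens_adj A B : (tens A B)^t* = tens (adj2 A) (adj2 B).
Proof. by apply/matrixP => p q; rewrite !mxE rmorphM. Qed.

Lemma tens1 : tens one2 one2 = 1%:M.
Proof. by apply/matrixP => p q; rewrite !mxE eq_hilo -natrM mulnb. Qed.

Lemma tau_tens j : tau R j = tens (sigma R j.1) (sigma R j.2).
Proof. by []. Qed.

Lemma conjcE (x : C) : x^* = conjc x.
Proof. by []. Qed.

(* 1/2 (1 - iX - iY - iZ), a rotation that maps X to Y, Y to Z and Z to X. *)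
Definition cliff (a b : bool) : C :=
  if a then Complex (2^-1) (if b then 2^-1 else - 2^-1)
  else Complex (if b then - 2^-1 else 2^-1) (- 2^-1).
Definition cyc (j : bool2) : bool2 := (j.2, j.1 (+) j.2).
(** The symplectic form on labels, true exactly when the two Pauli matrices anticommute. *)
Definition anti (m j : bool2) : bool := (m.1 && j.2) (+) (m.2 && j.1).

Lemma cliff_conj b x y :
  mul2 (mul2 cliff (sigma R b)) (adj2 cliff) x y = sigma R (cyc b) x y.
Proof.
rewrite /mul2 /adj2 !big_bool /= /sigma -complexiE !conjcE.
case: b => [[] []]; case: x; case: y; rewrite /= ?(expr0, expr1, mulr1, mul1r, mulr0, mul0r);
apply/eqP; rewrite eq_complex /=; apply/andP; split; apply/eqP; field; by rewrite ?pnatr_eq0.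
Qed.

Lemma cliff_unit x y : mul2 cliff (adj2 cliff) x y = one2 x y.
Proof.
rewrite /mul2 /adj2 !big_bool /= /one2 !conjcE.
case: x; case: y;
apply/eqP; rewrite eq_complex /=; apply/andP; split; apply/eqP; field; by rewrite ?pnatr_eq0.
Qed.

Lemma sigma_conj m b x y :
  mul2 (mul2 (sigma R m) (sigma R b)) (adj2 (sigma R m)) x y =
  (-1) ^+ anti m b * sigma R b x y.
Proof.
rewrite /mul2 /adj2 !big_bool /= !sigma_adj /sigma -complexiE.
by case: m => [[] []]; case: b => [[] []]; case: x; case: y;
  rewrite /= ?(expr0, expr1, mulr1, mul1r, mulr0, mul0r);
apply/eqP; rewrite eq_complex /=; apply/andP; split; apply/eqP; ring.
Qed.

Lemma sigma_unit m x y : mul2 (sigma R m) (adj2 (sigma R m)) x y = one2 x y.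
Proof.
rewrite /mul2 /adj2 !big_bool /= !sigma_adj /sigma -complexiE /one2.
by case: m => [[] []]; case: x; case: y;
  rewrite /= ?(expr0, expr1, mulr1, mul1r, mulr0, mul0r);
apply/eqP; rewrite eq_complex /=; apply/andP; split; apply/eqP; ring.
Qed.

Lemma one2_conj b x y : mul2 (mul2 one2 b) (adj2 one2) x y = b x y.
Proof.
rewrite /mul2 /adj2 !big_bool /= /one2.
by case: x; case: y; rewrite /= ?rmorph0 ?rmorph1 !(mulr1, mul1r, mulr0, mul0r, addr0, add0r).
Qed.

Lemma one2_unit x y : mul2 one2 (adj2 one2) x y = one2 x y.
Proof.
rewrite /mul2 /adj2 !big_bool /= /one2.
by case: x; case: y; rewrite /= ?rmorph0 ?rmorph1 !(mulr1, mul1r, mulr0, mul0r, addr0, add0r).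
Qed.

Definition cnot : 'M[C]_4 :=
  \matrix_(p, q) (q == enc (hi p, lo p (+) hi p))%:R.

Lemma cnot_conj (M : 'M[C]_4) : cnot *m M *m cnot^t* =
  \matrix_(p, q) M (enc (hi p, lo p (+) hi p)) (enc (hi q, lo q (+) hi q)).
Proof.
apply/matrixP => p q; rewrite !mxE.
under eq_bigr => r _ do rewrite !mxE rmorph_nat mulrC.
rewrite sumr_delta; under eq_bigr => r _ do rewrite !mxE.
by rewrite sumr_delta.
Qed.

Lemma cnot_unit : cnot \is unitarymx.
Proof.
apply/unitarymxP; rewrite -{1}[cnot]mulmx1 cnot_conj.
apply/matrixP => p q; rewrite !mxE !eq_hilo !hi_enc !lo_enc.
by case: (hi p); case: (hi q); case: (lo p); case: (lo q).
Qed.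

(** Together with [cnot_IZ], this connects the labels with one nontrivial letter, on either qubit,
    to those with two. *)
Lemma cnot_XI : cnot *m tau R ((false, true), (false, false)) *m cnot^t* =
  tau R ((false, true), (false, true)).
Proof.
rewrite cnot_conj; apply/matrixP => p q; rewrite !mxE !hi_enc !lo_enc /sigma /=.
by case: (hi p); case: (hi q); case: (lo p); case: (lo q); rewrite /= ?(mulr1, mulr0, mul0r).
Qed.

Lemma cnot_IZ : cnot *m tau R ((false, false), (true, false)) *m cnot^t* =
  tau R ((true, false), (true, false)).
Proof.
rewrite cnot_conj; apply/matrixP => p q; rewrite !mxE !hi_enc !lo_enc /sigma /=.
by case: (hi p); case: (hi q); case: (lo p); case: (lo q); rewrite /= ?(expr0, expr1); ring.
Qed.

End TwoQubit.

(** * Second moments of a Haar random gate *)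

Lemma Re_realM (R : realType) (s : R) (z : R[i]) :
  complex.Re ((s%:C)%C * z) = s * complex.Re z.
Proof. by case: z => x y /=; rewrite mul0r subr0. Qed.

Section TransferMoments.
Context (R : realType).
Local Notation C := R[i].
Local Notation bool2 := (bool * bool)%type.
Local Notation bool4 := ((bool * bool) * (bool * bool))%type.

Definition tau0 : bool4 := ((false, false), (false, false)).

Lemma tau0E : tau R tau0 = 1%:M.
Proof.
by rewrite tau_tens -tens1; apply: eq_tens => a b; rewrite sigma_I.
Qed.

(** A Clifford factor on the right only relabels the columns of the transfer matrix, up to a scalar;
    right invariance of the Haar measure turns this into symmetries of the moments. *)
Lemma transfer_mulr (u v : 'M[C]_4) a b c (s : R) :
  v *m tau R b *m v^t* = (s%:C)%C *: tau R c ->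
  transfer (u *m v) a b = s * transfer u a c.
Proof.
move=> H; rewrite /transfer adjmxM.
have -> : u *m v *m tau R b *m (v^t* *m u^t*) = u *m (v *m tau R b *m v^t*) *m u^t*.
  by rewrite !mulmxA.
rewrite H -!scalemxAr -!scalemxAl -scalemxAr mxtraceZ mulrA; congr (_ / _).
exact: Re_realM.
Qed.

Lemma transfer_id (u : 'M[C]_4) a : u \is unitarymx -> transfer u a tau0 = (a == tau0)%:R.
Proof.
move=> /unitarymxP uu; rewrite /transfer tau0E mulmx1 uu mulmx1.
have [_ tauO _] := tau_pauli R.
have := tauO a tau0; rewrite tau0E mulmx1 => ->.
by rewrite -natrM -[X in complex.Re X](rmorph_nat (real_complex R)) /= natrM mulrAC mulfV ?mul1r // pnatr_eq0.
Qed.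

(** Conjugation by u preserves the trace inner product, so the transfer matrix is orthogonal. *)
Lemma transfer_ortho (u : 'M[C]_4) a a' : u \is unitarymx ->
  \sum_b transfer u a b * transfer u a' b = (a == a')%:R.
Proof.
move=> Hu; have uu := unitarymxP Hu; apply: complexI.
have [_ tauO _] := tau_pauli R.
have : \tr ((u^t* *m tau R a *m u) *m (u^t* *m tau R a' *m u)) = 4 * (a == a')%:R.
  have -> : u^t* *m tau R a *m u *m (u^t* *m tau R a' *m u) =
      u^t* *m (tau R a *m (u *m u^t*) *m tau R a' *m u) by rewrite !mulmxA.
  by rewrite uu mulmx1 mxtrace_mulC -!mulmxA uu mulmx1 tauO.
rewrite !transferE mulmx_suml raddf_sum /=.
under eq_bigr => b _.
  rewrite mulmx_sumr raddf_sum /= (bigD1 b) //= big1 ?addr0; last first.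
    move=> c cb; rewrite -scalemxAl -scalemxAr !mxtraceZ tauO eq_sym (negbTE cb).
    by rewrite !mulr0.
  rewrite -scalemxAl -scalemxAr !mxtraceZ tauO eqxx mulr1 mulrA.
  over.
rewrite -mulr_suml mulrC => /mulfI H; rewrite rmorph_nat -H ?pnatr_eq0 //.
by rewrite rmorph_sum; apply: eq_bigr => b _; rewrite rmorphM.
Qed.

Lemma transfer_bound (u : 'M[C]_4) a b : u \is unitarymx -> `|transfer u a b| <= 1.
Proof.
move=> Hu; rewrite -(@expr_le1 _ 2) // real_normK ?num_real //.
have := transfer_ortho a a Hu; rewrite eqxx mulr1n (bigD1 b) //= => <-.
by rewrite expr2 lerDl sumr_ge0 // => c _; rewrite -expr2 sqr_ge0.
Qed.

(* Second moments invariant under conjugation by Clifford gates: Pauli gates kill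
   the off-diagonal ones, single-qubit rotations and CNOTs permute the nontrivial
   labels transitively. *)
Context (a a' : bool4) (Mom : bool4 -> bool4 -> R).
Hypothesis Mom_inv : forall (v : 'M[C]_4) (s s' : R) b b' c c',
  v \is unitarymx ->
  v *m tau R b *m v^t* = (s%:C)%C *: tau R c ->
  v *m tau R b' *m v^t* = (s'%:C)%C *: tau R c' ->
  Mom b b' = s * s' * Mom c c'.
Hypothesis Mom_sum : \sum_b Mom b b = (a == a')%:R.
Hypothesis Mom_id : Mom tau0 tau0 = ((a == tau0) && (a' == tau0))%:R.

Lemma tens_unitary (A B : bool -> bool -> C) :
  mul2 A (adj2 A) =2 @one2 R -> mul2 B (adj2 B) =2 @one2 R ->
  tens A B \is unitarymx.
Proof.
by move=> hA hB; apply/unitarymxP; rewrite tens_adj tensM (eq_tens hA hB) tens1.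
Qed.

Lemma tau_conj m b : tau R m *m tau R b *m (tau R m)^t* =
  (((-1) ^+ (anti m.1 b.1 (+) anti m.2 b.2))%:C)%C *: tau R b.
Proof.
rewrite !tau_tens tens_adj !tensM (eq_tens (sigma_conj _ _ _) (sigma_conj _ _ _)).
apply/matrixP => p q; rewrite !mxE mulrACA -signr_addb; congr (_ * _).
by rewrite rmorphXn rmorphN1.
Qed.

Lemma Mom_offdiag b b' : b != b' -> Mom b b' = 0.
Proof.
move=> neq; pose s m (c : bool4) := anti m.1 c.1 (+) anti m.2 c.2.
(* Distinct labels are separated by a Pauli matrix m that anticommutes with exactly one of them;
   conjugation by it flips the sign of the moment. *)
have [m sm] : exists m : bool4, s m b' = ~~ s m b.
  move: b b' neq => [[b1 b2] [b3 b4]] [[c1 c2] [c3 c4]] neq; rewrite /s /anti /=.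
  have [e1|n1] := eqVneq b1 c1; last first.
    exists ((false, true), (false, false)) => /=; move: n1.
    by case: b1 b2 b3 b4 c1 c2 c3 c4 {neq} => [] [] [] [] [] [] [] [].
  have [e2|n2] := eqVneq b2 c2; last first.
    exists ((true, false), (false, false)) => /=; move: n2; by case: b2 c2 {neq e1} => [] [].
  have [e3|n3] := eqVneq b3 c3; last first.
    exists ((false, false), (false, true)) => /=; move: n3; by case: b3 c3 {neq e1} => [] [].
  exists ((false, false), (true, false)); move: neq; rewrite e1 e2 e3 /=.
  by case: b4 c4 => [] [] //; rewrite eqxx.
have U : tau R m \is unitarymx.
  by rewrite tau_tens tens_unitary // => x y; rewrite sigma_unit.
have := Mom_inv U (tau_conj m b) (tau_conj m b').
rewrite -/(s m b) -/(s m b') sm -signr_addb addbN addbb expr1 mulN1r => /eqP.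
by rewrite -addr_eq0 -mulr2n mulrn_eq0 /= => /eqP.
Qed.

Lemma Mom_cyc1 b1 b2 : Mom (b1, b2) (b1, b2) = Mom (cyc b1, b2) (cyc b1, b2).
Proof.
have U : tens (@cliff R) (@one2 R) \is unitarymx.
  by apply: tens_unitary => x y; rewrite ?cliff_unit ?one2_unit.
have E : tens (@cliff R) (@one2 R) *m tau R (b1, b2) *m (tens (@cliff R) (@one2 R))^t* =
    (1%:C)%C *: tau R (cyc b1, b2).
  rewrite scale1r !tau_tens tens_adj !tensM; apply: eq_tens => x y.
    exact: cliff_conj.
  exact: one2_conj.
by rewrite (Mom_inv U E E) !mul1r.
Qed.

Lemma Mom_cyc2 b1 b2 : Mom (b1, b2) (b1, b2) = Mom (b1, cyc b2) (b1, cyc b2).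
Proof.
have U : tens (@one2 R) (@cliff R) \is unitarymx.
  by apply: tens_unitary => x y; rewrite ?cliff_unit ?one2_unit.
have E : tens (@one2 R) (@cliff R) *m tau R (b1, b2) *m (tens (@one2 R) (@cliff R))^t* =
    (1%:C)%C *: tau R (b1, cyc b2).
  rewrite scale1r !tau_tens tens_adj !tensM; apply: eq_tens => x y.
    exact: one2_conj.
  exact: cliff_conj.
by rewrite (Mom_inv U E E) !mul1r.
Qed.

Let XI : bool4 := ((false, true), (false, false)).

Lemma Mom_diag b : b != tau0 -> Mom b b = Mom XI XI.
Proof.
pose f b := Mom b b; rewrite -!/(f _).
have f1 b2 : f ((true, true), b2) = f ((false, true), b2) /\
             f ((true, false), b2) = f ((false, true), b2).
  by rewrite /f (Mom_cyc1 (false, true)) (Mom_cyc1 (true, true)).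
have f2 b1 : f (b1, (true, true)) = f (b1, (false, true)) /\
             f (b1, (true, false)) = f (b1, (false, true)).
  by rewrite /f (Mom_cyc2 _ (false, true)) (Mom_cyc2 _ (true, true)).
have fXX : f ((false, true), (false, true)) = f XI.
  have E := cnot_XI R; rewrite -[RHS]scale1r in E.
  by rewrite /f [RHS](Mom_inv (cnot_unit R) E E) !mul1r.
have fIX : f ((false, false), (false, true)) = f XI.
  have E := cnot_IZ R; rewrite -[RHS]scale1r in E.
  (* IX is rotated to IZ, which CNOT sends to ZZ, and this is rotated to XX. *)
  rewrite -(f2 _).2 /f (Mom_inv (cnot_unit R) E E) !mul1r -/(f _).
  by rewrite (f2 _).2 (f1 _).2.
have {}f1 b1 b2 : b1 != (false, false) -> f (b1, b2) = f ((false, true), b2).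
  by case: b1 => [[] []] // _; have [] := f1 b2.
have {}f2 b1 b2 : b2 != (false, false) -> f (b1, b2) = f (b1, (false, true)).
  by case: b2 => [[] []] // _; have [] := f2 b1.
case: b => b1 b2 nz.
have [e1|n1] := eqVneq b1 (false, false).
  by subst b1; rewrite f2 //; apply: contraNneq nz => ->.
rewrite f1 //; have [->//|n2] := eqVneq b2 (false, false).
by rewrite f2.
Qed.

(** Of the sixteen diagonal moments one is known and the other fifteen are equal, so their sum
    determines them. *)
Lemma MomE b b' : Mom b b' =
  ((a == a') && (b == b'))%:R *
  (if a == tau0 then (b == tau0)%:R else (b != tau0)%:R / 15).
Proof.
have [<-|/[dup] nb /Mom_offdiag ->] := eqVneq b b'; last by rewrite andbF mul0r.
rewrite andbT.
have S : Mom tau0 tau0 + 15 * Mom XI XI = (a == a')%:R.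
  rewrite -Mom_sum (bigD1 tau0) //=; congr (_ + _).
  rewrite (eq_bigr (fun=> Mom XI XI)); last by move=> c; exact: Mom_diag.
  rewrite sumr_const cardC1 !card_prod card_bool -[RHS]mulr_natl.
  by [].
move: S; rewrite Mom_id => S.
have [->|nb] := eqVneq b tau0; rewrite ?Mom_id ?(Mom_diag nb) /=.
  move: S; have [e1|n1] := eqVneq a tau0; rewrite ?mul0r ?mulr0 ?mulr1 //=.
  by rewrite e1 eq_sym.
have [e1|n1] := eqVneq a tau0.
  move: S; rewrite e1 eqxx /= mulr0 eq_sym => S; lra.
move: S; rewrite (negbTE n1) /= => S; lra.
Qed.

End TransferMoments.

(** * Purities of subsystems *)

Section PauliWeights.
Context (R : realType) (n : nat).
Local Notation bool2 := (bool * bool)%type.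
Local Notation pauliT := {ffun 'I_n -> bool * bool}.
Local Notation weights := (pauliT -> pauliT -> R).

Definition idp : bool2 := (false, false).

(* w k k' stands for the expectation of Tr(P_k rho) Tr(P_k' rho); the rule says
   how a Haar random gate on the qubits i and j transforms it. *)
Definition gate_rule (i j : 'I_n) (w w' : weights) : Prop :=
  forall k k', w' k k' =
    if (k i, k j) != (k' i, k' j) then 0
    else if (k i, k j) == tau0 then w k k'
    else (\sum_(b | b != tau0) w (set2 k i j b.1 b.2) (set2 k' i j b.1 b.2)) / 15.

(* The symmetry that a random gate on m enforces and later gates preserve. *)
Definition touched (w : weights) (m : 'I_n) : Prop :=
  (forall k k' : pauliT, k m != k' m -> w k k' = 0) /\
  (forall (k : pauliT) c, c != idp -> k m != idp ->
     w (set2 k m m c c) (set2 k m m c c) = w k k).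

Lemma set2_comm T (k : {ffun 'I_n -> T}) (i j m : 'I_n) (a b c : T) :
  m != i -> m != j ->
  set2 (set2 k m m c c) i j a b = set2 (set2 k i j a b) m m c c.
Proof.
move=> mi mj; apply/ffunP => l; rewrite !ffunE.
case: (eqVneq l i) => [->|li]; first by rewrite eq_sym (negbTE mi).
by case: (eqVneq l j) => [->|lj //]; rewrite eq_sym (negbTE mj).
Qed.

Section Gate.
Context (i j : 'I_n) (neq_ij : i != j) (w w' : weights).
Hypothesis Hw : gate_rule i j w w'.

(** The average over the fifteen nontrivial pairs has forgotten which of them stood at i and j. *)
Lemma gate_rule_pair (k k' : pauliT) (c1 c2 : bool2) : (c1, c2) != tau0 -> (k i, k j) != tau0 ->
  (k i, k j) = (k' i, k' j) ->
  w' (set2 k i j c1 c2) (set2 k' i j c1 c2) = w' k k'.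
Proof.
move=> cn kn e; rewrite !Hw e eqxx /= !set2l !set2r // eqxx /=.
rewrite (negbTE cn) -e (negbTE kn); congr (_ / _); apply: eq_bigr => b _.
by rewrite !set2_set2.
Qed.

Lemma set2_left T (k : {ffun 'I_n -> T}) c : set2 k i i c c = set2 k i j c (k j).
Proof.
apply/ffunP => l; rewrite !ffunE; case: eqP => // _.
by case: eqP => // ->.
Qed.

Lemma set2_right T (k : {ffun 'I_n -> T}) c : set2 k j j c c = set2 k i j (k i) c.
Proof.
apply/ffunP => l; rewrite !ffunE.
case: (eqVneq l j) => [->|lj]; first by rewrite eq_sym (negbTE neq_ij).
by case: eqP => // ->.
Qed.

(** At i and j the average creates the symmetry; at any other qubit the gate acts on different
    letters and commutes with the change of letter. *)
Lemma gate_touched m : m = i \/ m = j \/ touched w m -> touched w' m.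
Proof.
have pair_neq (a a' b b' : bool2) : (a != a') || (b != b') -> (a, b) != (a', b').
  by rewrite xpair_eqE negb_and.
have Ti : touched w' i.
  split=> [k k' ne|k c cn kn]; first by rewrite Hw pair_neq ?ne.
  by rewrite set2_left gate_rule_pair // pair_neq ?cn ?kn.
have Tj : touched w' j.
  split=> [k k' ne|k c cn kn]; first by rewrite Hw pair_neq ?ne ?orbT.
  by rewrite set2_right gate_rule_pair // pair_neq ?cn ?kn ?orbT.
case=> [->//|[->//|]].
have [->//|mi] := eqVneq m i; have [->//|mj] := eqVneq m j.
move=> [w0 wc]; split=> [k k' ne|k c cn kn].
  rewrite Hw w0 // big1 ?mul0r ?if_same // => b _.
  by rewrite w0 // !set2o.
rewrite !Hw !eqxx /= !(@set2o _ _ k m m) 1?eq_sym // wc //.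
case: ifP => // _; congr (_ / _); apply: eq_bigr => b _.
by rewrite set2_comm // wc // set2o.
Qed.

End Gate.

Definition insupp (k : pauliT) (B : {set 'I_n}) : bool :=
  [forall m, (k m != idp) ==> (m \in B)].

Lemma insuppP (k : pauliT) (B : {set 'I_n}) : reflect (forall m, m \notin B -> k m = idp) (insupp k B).
Proof.
apply: (iffP forallP) => [H m|H m]; first by have := H m; case: eqP => //= _ ->.
by case: (boolP (m \in B)) => [_|/H ->]; rewrite ?implybT ?eqxx.
Qed.

(* The expected purity of the reduced state on B. *)
Definition purity (w : weights) (B : {set 'I_n}) : R :=
  (\sum_(k | insupp k B) w k k) / 2 ^+ #|B|.

(** A string splits into its letters at i and j and a rest that is trivial there. *)
Lemma sum_insupp (i j : 'I_n) (B : {set 'I_n}) (f : pauliT -> R) : i != j ->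
  \sum_(k | insupp k B) f k =
  \sum_(m | insupp m (B :\ i :\ j))
     \sum_(b : bool2 * bool2 |
             ((b.1 != idp) ==> (i \in B)) && ((b.2 != idp) ==> (j \in B)))
        f (set2 m i j b.1 b.2).
Proof.
move=> ij; pose h (k : pauliT) := set2 k i j idp idp.
rewrite (partition_big h (fun m => insupp m (B :\ i :\ j))); last first.
  move=> k /insuppP kB; apply/insuppP => m; rewrite /h ffunE.
  case: (eqVneq m i) => // mi; case: (eqVneq m j) => // mj.
  by rewrite !inE mi mj /=; exact: kB.
apply: eq_bigr => m /insuppP Hm.
have mi : m i = idp by apply: Hm; rewrite !inE eqxx andbF.
have mj : m j = idp by apply: Hm; rewrite !inE eqxx.
rewrite (reindex_onto (fun b : bool2 * bool2 => set2 m i j b.1 b.2)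
  (fun k : pauliT => (k i, k j))) /=; last first.
  move=> k /andP[_ /eqP <-]; rewrite /h set2_set2.
  exact: set2_id.
apply: eq_bigl => -[b1 b2] /=.
rewrite set2l set2r // eqxx andbT /h set2_set2.
have -> : set2 m i j idp idp = m by rewrite -{1}mi -mj set2_id.
rewrite eqxx andbT; apply/insuppP/andP => [H|[/implyP H1 /implyP H2] l lB].
  split; apply/implyP; apply: contraR => /H.
    by rewrite set2l => ->.
  by rewrite set2r // => ->.
rewrite ffunE; case: eqP => [li|ni].
  by apply/eqP; rewrite -li in H1; apply: contraR lB => /H1.
case: eqP => [lj|nj]; first by apply/eqP; rewrite -lj in H2; apply: contraR lB => /H2.
by apply: Hm; rewrite !inE (negbTE lB) !andbF.
Qed.

Definition purity_rule (i j : 'I_n) (F F' : {set 'I_n} -> R) : Prop :=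
  forall B, F' B = if (i \in B) == (j \in B) then F B
                   else 2 / 5 * (F (i |: (j |: B)) + F (B :\ i :\ j)).

(** A set that contains both qubits, one or none of them admits 15, 3 or 0 nontrivial pairs of
    letters. *)
Lemma sum_pair_supp (x y : bool) (s0 s : R) :
  \sum_(b : bool2 * bool2 | ((b.1 != idp) ==> x) && ((b.2 != idp) ==> y))
    (if b == tau0 then s0 else s) =
  s0 + (if x then (if y then 15 else 3) else (if y then 3 else 0)) * s.
Proof.
rewrite big_mkcond /=.
rewrite -(pair_bigA _ (fun b1 b2 : bool2 => if ((b1 != idp) ==> x) && ((b2 != idp) ==> y)
  then (if (b1, b2) == tau0 then s0 else s) else 0)) /= !big_pairbool /=.
by case: x; case: y => /=; ring.
Qed.

Lemma card_wall (i j : 'I_n) (B : {set 'I_n}) : i != j ->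
  (i \in B) != (j \in B) ->
  #|B| = #|B :\ i :\ j|.+1 /\ #|i |: (j |: B)| = #|B :\ i :\ j|.+2.
Proof.
move=> ij ne; set Bo := B :\ i :\ j.
have cBo : #|B| = #|Bo|.+1.
  rewrite (cardsD1 i B) (cardsD1 j (B :\ i)) -/Bo !inE eq_sym ij /=.
  by move: ne; case: (i \in B); case: (j \in B).
split=> //; have <- : i |: (j |: Bo) = i |: (j |: B).
  by apply/setP => l; rewrite !inE; case: eqP => //; case: eqP.
by rewrite !cardsU1 !inE !eqxx (negbTE ij) /= ?andbF.
Qed.

(** Let P0 and P1 be the weights of the strings, supported in B off the pair, whose pair of letters
    is trivial or not. The gate spreads P1 evenly over 15 pairs, of which 3 fit into a set that cuts
    the pair. With b the size of B off the pair, the new purity is (P0 + P1 / 5) / 2^(b+1), a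
    combination of the old ones (P0 + P1) / 2^(b+2) and P0 / 2^b. *)
Lemma gate_purity (i j : 'I_n) w w' : i != j -> gate_rule i j w w' ->
  purity_rule i j (purity w) (purity w').
Proof.
move=> ij Hw B.
pose Bo := B :\ i :\ j.
pose g m (b : bool2 * bool2) := w (set2 m i j b.1 b.2) (set2 m i j b.1 b.2).
pose P0 := \sum_(m | insupp m Bo) g m tau0.
pose P1 := \sum_(m | insupp m Bo) \sum_(c | c != tau0) g m c.
have w'E : \sum_(k | insupp k B) w' k k =
    P0 + (if i \in B then (if j \in B then 15 else 3) else (if j \in B then 3 else 0)) * (P1 / 15).
  rewrite (sum_insupp _ _ ij) /P0 /P1 mulr_suml mulr_sumr -big_split /=.
  apply: eq_bigr => m _; rewrite -sum_pair_supp; apply: eq_bigr => -[b1 b2] _ /=.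
  rewrite Hw eqxx /= !set2l !set2r //; case: eqP => [[-> ->] //|_].
  by congr (_ / _); apply: eq_bigr => c _; rewrite !set2_set2.
have wE B' : Bo = B' :\ i :\ j -> (i \in B') == (j \in B') ->
    \sum_(k | insupp k B') w k k = P0 + (i \in B')%:R * P1.
  move=> BoE /eqP e; rewrite (sum_insupp _ _ ij) -BoE /P0 /P1 mulr_sumr -big_split /=.
  apply: eq_bigr => m _; rewrite (bigD1 tau0) //=; congr (_ + _); rewrite -e.
  case: (i \in B'); rewrite ?mul1r ?mul0r; first by apply: eq_bigl => b; rewrite !implybT.
  rewrite big_pred0 // => -[b1 b2] /=; rewrite !implybF !negbK.
  by case: eqP => [->|//]; case: eqP => [->|//]; rewrite eqxx.
rewrite /purity.
case: ifP => [e|/negbT ne].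
  rewrite w'E (wE B) //; congr (_ / _); congr (_ + _).
  by rewrite -(eqP e); case: (i \in B); rewrite ?mul0r // mulrC -mulrA mulVf ?pnatr_eq0 // mulr1 mul1r.
have BoU : Bo = (i |: (j |: B)) :\ i :\ j.
  by apply/setP => l; rewrite !inE; case: eqP => //; case: eqP.
have BoD : Bo = Bo :\ i :\ j.
  by apply/setP => l; rewrite !inE; case: eqP => //; case: eqP.
rewrite w'E (wE _ BoU) ?(wE _ BoD) ?inE ?eqxx ?andbF ?orbT //.
have [cBo cBu] := card_wall ij ne.
rewrite -/Bo cBo cBu /= mul0r addr0 mul1r.
have z2 : (2 : R) ^+ #|Bo| != 0 by rewrite expf_neq0 // pnatr_eq0.
rewrite !exprS.
by move: ne; case: (i \in B); case: (j \in B) => //= _; field.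
Qed.

End PauliWeights.

(** * Decay of the purities along the brickwork *)

Section Brickwork.
Context (R : realType) (n : nat).
Local Notation bool2 := (bool * bool)%type.
Local Notation pauliT := {ffun 'I_n -> bool * bool}.
Local Notation weights := (pauliT -> pauliT -> R).
Local Notation empty := (@finset.set0 'I_n).
Local Notation full := (@finset.setTfor 'I_n).
Local Notation setfun := ({set 'I_n} -> R).

(** At the last qubit this is the default value i, at which no brick starts. *)
Definition nxt (i : 'I_n) : 'I_n := insubd i i.+1.

Lemma val_nxt (i : 'I_n) : (i.+1 < n)%N -> nxt i = i.+1 :> nat.
Proof. by move=> h; rewrite val_insubd h. Qed.

Lemma brick_neq t (i : 'I_n) : brick n t i -> i != nxt i.
Proof. by case/andP => h _; rewrite -val_eqE /= val_nxt // ltn_eqF. Qed.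

(** Bricks of one layer start at positions of the same parity. *)
Lemma brick_disjoint t (i m : 'I_n) : brick n t i -> brick n t m -> i != m ->
  [/\ m != nxt i, nxt m != i & nxt m != nxt i].
Proof.
move=> /andP[hi /eqP oi] /andP[hm /eqP om] im.
rewrite -!val_eqE /= !val_nxt // eqSS.
split; last by rewrite eq_sym.
  by apply/eqP => e; move: om; rewrite e /= oi; case: (odd t).
by apply/eqP => e; move: oi; rewrite -e /= om; case: (odd t).
Qed.

Definition positions (t : nat) : seq 'I_n := [seq i : 'I_n <- enum 'I_n | brick n t i].

Lemma mem_positions t (i : 'I_n) : (i \in positions t) = brick n t i.
Proof. by rewrite mem_filter mem_enum andbT. Qed.

(** Stated with relations, so that one scheme serves weights and purities, whose rules fix the new
    state pointwise. The head of the list acts last. *)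
Fixpoint gates (T : Type) (rule : 'I_n -> 'I_n -> T -> T -> Prop)
    (s : seq 'I_n) (w w' : T) : Prop :=
  if s is i :: s' then exists2 w1, gates rule s' w w1 & rule i (nxt i) w1 w'
  else w' = w.

Fixpoint brickwork (T : Type) (rule : 'I_n -> 'I_n -> T -> T -> Prop)
    (t : nat) (w w' : T) : Prop :=
  if t is t'.+1 then
    exists2 w1, brickwork rule t' w w1 & gates rule (positions t') w1 w'
  else w' = w.

Lemma gates_map (T U : Type) (rT : 'I_n -> 'I_n -> T -> T -> Prop)
    (rU : 'I_n -> 'I_n -> U -> U -> Prop) (f : T -> U) t s w w' :
  (forall (i : 'I_n) w w', brick n t i -> rT i (nxt i) w w' -> rU i (nxt i) (f w) (f w')) ->
  {subset s <= positions t} -> gates rT s w w' -> gates rU s (f w) (f w').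
Proof.
move=> H; elim: s w' => [w' _ ->//|i s IH w' sub [w1 h1 h2]].
exists (f w1); first by apply: IH => // m ms; apply: sub; rewrite inE ms orbT.
by apply: H => //; rewrite -mem_positions sub // mem_head.
Qed.

Lemma brickwork_map (T U : Type) (rT : 'I_n -> 'I_n -> T -> T -> Prop)
    (rU : 'I_n -> 'I_n -> U -> U -> Prop) (f : T -> U) t w w' :
  (forall t (i : 'I_n) w w', brick n t i -> rT i (nxt i) w w' -> rU i (nxt i) (f w) (f w')) ->
  brickwork rT t w w' -> brickwork rU t (f w) (f w').
Proof.
move=> H; elim: t w' => [w' ->//|t IH w' [w1 h1 h2]].
by exists (f w1); [exact: IH | exact: (gates_map (H t)) h2].
Qed.

Definition wall (B : {set 'I_n}) (i : 'I_n) : bool := (i \in B) != (nxt i \in B).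

(** A gate cut by B replaces B by two sets that are no longer cut there and have the same walls at
    the other bricks, with coefficients of sum 4/5. Once all walls of the layer are resolved, only
    sets that the layer does not cut remain, so the bound M is assumed for these alone. After the
    first factor 4/5 the others are bounded by 1. *)
Lemma gates_decay t s (E E' : setfun) (M : R) : 0 <= M ->
  gates (@purity_rule R n) s E E' -> {subset s <= positions t} ->
  (forall B, (forall i : 'I_n, brick n t i -> ~~ wall B i) -> `|E B| <= M) ->
  forall B, (forall i : 'I_n, brick n t i -> i \notin s -> ~~ wall B i) ->
    `|E' B| <= if has (wall B) s then 4 / 5 * M else M.
Proof.
move=> M0; elim: s E' => [E' -> _ H B HB|i s IH E' [E1 h1 h2] sub H B HB] /=.
  by apply: H => i bi; apply: HB.
have bi : brick n t i by rewrite -mem_positions sub // mem_head.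
have {}sub : {subset s <= positions t}.
  by move=> m ms; apply: sub; rewrite inE ms orbT.
have {}IH := IH _ h1 sub H; rewrite h2 -[_ == _]negbK -/(wall B i).
case: (boolP (wall B i)) => /= [Wi|nWi]; last first.
  apply: IH => m bm ms; have [->//|mi] := eqVneq m i.
  by apply: HB; rewrite // inE negb_or mi.
have sm (X : {set 'I_n}) (m : 'I_n) : brick n t m -> m \notin s -> (i \in X) = (nxt i \in X) ->
    (forall l, l != i -> l != nxt i -> (l \in X) = (l \in B)) -> ~~ wall X m.
  move=> bm ms Xi XB; have [->|im] := eqVneq m i; first by rewrite /wall negbK Xi.
  have [d1 d2 d3] := brick_disjoint bi bm (contra_neq esym im).
  by rewrite /wall !XB //; apply: HB; rewrite // inE negb_or im.
have bound (X : {set 'I_n}) : (i \in X) = (nxt i \in X) ->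
    (forall l, l != i -> l != nxt i -> (l \in X) = (l \in B)) -> `|E1 X| <= M.
  move=> Xi XB; apply: le_trans (IH X (fun m bm ms => sm X m bm ms Xi XB)) _.
  by case: ifP => _; lra.
rewrite normrM ger0_norm; last lra.
have h : `|E1 (i |: (nxt i |: B)) + E1 (B :\ i :\ nxt i)| <= M + M.
  apply: le_trans (ler_normD _ _) _; apply: lerD; apply: bound.
  - by rewrite !inE !eqxx orbT.
  - by move=> l /negbTE l1 /negbTE l2; rewrite !inE l1 l2.
  - by rewrite !inE !eqxx andbF.
  - by move=> l l1 l2; rewrite !inE l1 l2.
lra.
Qed.

Lemma no_wall_trivial (B : {set 'I_n}) :
  (forall i : 'I_n, (i.+1 < n)%N -> ~~ wall B i) -> B = empty \/ B = full.
Proof.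
move=> H; have eqB m (hm : (m < n)%N) (h0 : (0 < n)%N) :
    (Ordinal hm \in B) = (Ordinal h0 \in B).
  elim: m hm => [|m IH] hm; first by congr (_ \in B); apply: val_inj.
  rewrite -(IH (ltnW hm)); have := H (Ordinal (ltnW hm)) hm.
  rewrite /wall negbK => /eqP ->; congr (_ \in B); apply: val_inj.
  by rewrite /= val_nxt.
have [->|/finset.set0Pn[x xB]] := eqVneq B empty; [by left | right].
apply/setP => y; rewrite inE.
have h0 : (0 < n)%N by exact: leq_ltn_trans (ltn_ord x).
by case: x xB => m hm; case: y => l hl; rewrite !(eqB _ _ h0).
Qed.

Lemma gates_const (s : seq 'I_n) (E E' : setfun) B :
  gates (@purity_rule R n) s E E' -> (B = empty \/ B = full) -> E' B = E B.
Proof.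
move=> + HB; elim: s E' => [E' ->//|i s IH E' [E1 h1 h2]].
by rewrite h2 -(IH _ h1); case: HB => ->; rewrite !inE eqxx.
Qed.

(** The invariant after t layers concerns the sets that the next layer, number t, does not cut: this
    is what [gates_decay] asks for. A nontrivial set that layer t.+1 does not cut is cut by layer t,
    since the two parities cover all neighbouring pairs; so each layer contributes its factor. *)
Lemma brickwork_decay t (E E' : setfun) (M : R) : 0 <= M ->
  brickwork (@purity_rule R n) t E E' ->
  (forall B, `|E B| <= M) -> (forall B, B = empty \/ B = full -> E B = 0) ->
  (forall B, B = empty \/ B = full -> E' B = 0) /\
  (forall B, (forall i : 'I_n, brick n t i -> ~~ wall B i) -> `|E' B| <= M * (4 / 5) ^+ t).
Proof.
move=> M0 + EM E0; elim: t E' => [E' ->|t IH E' [E1 /IH[z1 b1] h2]].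
  by split=> // B _; rewrite expr0 mulr1.
have z' B : B = empty \/ B = full -> E' B = 0.
  by move=> HB; rewrite (gates_const h2 HB) z1.
split=> // B HB; have [/z'-> |nt] := pselect (B = empty \/ B = full).
  by rewrite normr0 mulr_ge0 ?exprn_ge0 //; lra.
have Mt : 0 <= M * (4 / 5) ^+ t by rewrite mulr_ge0 ?exprn_ge0 //; lra.
have := gates_decay Mt h2 (fun m h => h) b1 (B := B).
have -> : has (wall B) (positions t).
  apply: contra_notT nt => /hasPn nW; apply: no_wall_trivial => i hi.
  have [e|ne] := eqVneq (odd i) (odd t.+1); first by apply: HB; rewrite /brick hi e /=.
  apply: nW; rewrite mem_positions /brick hi /=.
  by move: ne => /=; case: (odd i); case: (odd t).
move=> H; rewrite exprS mulrCA; apply: H => i bi.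
by rewrite mem_positions bi.
Qed.

(** The last layer need not cut an arbitrary set, so its factor is given up. *)
Lemma brickwork_decay_any t (E E' : setfun) (M : R) : 0 <= M ->
  brickwork (@purity_rule R n) t.+1 E E' ->
  (forall B, `|E B| <= M) -> (forall B, B = empty \/ B = full -> E B = 0) ->
  forall B, `|E' B| <= M * (4 / 5) ^+ t.
Proof.
move=> M0 [E1 h1 h2] EM E0 B; have [_ b1] := brickwork_decay M0 h1 EM E0.
have Mt : 0 <= M * (4 / 5) ^+ t by rewrite mulr_ge0 ?exprn_ge0 //; lra.
have := gates_decay Mt h2 (fun m h => h) b1 (B := B).
move=> H; apply: le_trans (H _) _; last by case: ifP => _; lra.
by move=> i bi; rewrite mem_positions bi.
Qed.

Lemma gates_touched t s w w' m : gates (@gate_rule R n) s w w' ->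
  {subset s <= positions t} ->
  touched w m \/ (exists2 i : 'I_n, i \in s & m = i \/ m = nxt i) -> touched w' m.
Proof.
elim: s w' => [w' -> _ [//|[]//]|i s IH w' [w1 h1 h2] sub H].
have bi : brick n t i by rewrite -mem_positions sub // mem_head.
have {}sub : {subset s <= positions t}.
  by move=> l ls; apply: sub; rewrite inE ls orbT.
apply: (gate_touched (brick_neq bi) h2).
have {}IH := IH _ h1 sub.
case: H => [tw|[l]]; first by right; right; apply: IH; left.
rewrite inE => /orP[/eqP -> [->|->]|ls ml]; [by left | by right; left |].
by right; right; apply: IH; right; exists l.
Qed.

(** Layer 0 reaches every qubit except the last one when its index is even; layer 1 then reaches
    that one, as its left neighbour exists for [1 < n]. *)
Lemma brickwork_touched t w w' m : (1 < n)%N ->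
  brickwork (@gate_rule R n) t.+2 w w' -> touched w' m.
Proof.
move=> n1; have step u (v v' : weights) : gates (@gate_rule R n) (positions u) v v' ->
    touched v m \/ (exists2 i : 'I_n, brick n u i & m = i \/ m = nxt i) -> touched v' m.
  move=> h H; apply: (gates_touched h (fun _ l => l)).
  by case: H => [?|[i bi mi]]; [left | right; exists i; rewrite ?mem_positions].
have main v v' : brickwork (@gate_rule R n) 2 v v' -> touched v' m.
  move=> [w1 [w0 _ h1] h2].
  have [om|em] := boolP (odd m).
    have hm : (m.-1 < n)%N by apply: leq_ltn_trans (leq_pred _) _.
    have m1 : m.-1.+1 = m by rewrite prednK //; case: (val m) om.
    apply: (step _ _ _ h2); left; apply: (step _ _ _ h1); right.
    exists (Ordinal hm); last by right; apply: val_inj; rewrite /= val_nxt /= m1.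
    by rewrite /brick /= m1 ltn_ord; move: om; rewrite -m1 /=; case: odd.
  have [mn|mn] := boolP (m.+1 < n)%N.
    apply: (step _ _ _ h2); left; apply: (step _ _ _ h1); right.
    by exists m; [rewrite /brick mn /=; case: odd em | left].
  have {mn}mn : m.+1 = n by apply/eqP; rewrite eqn_leq ltn_ord leqNgt.
  have m0 : (0 < m)%N by rewrite -ltnS mn.
  have hm : (m.-1 < n)%N by apply: leq_ltn_trans (leq_pred _) _.
  apply: (step _ _ _ h2); right; exists (Ordinal hm).
    by rewrite /brick /= prednK // ltn_ord /=; move: em; rewrite -{1}(prednK m0) /=; case: odd.
  by right; apply: val_inj; rewrite /= val_nxt /= prednK.
elim: t w' => [|t IH] w'; first exact: main.
by move=> [w1 /IH tw h]; apply: (step _ _ _ h); left.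
Qed.

End Brickwork.

(** * From purities to the second moments of single Pauli strings *)

Section WeightBound.
Context (R : realType) (n : nat).
Local Notation bool2 := (bool * bool)%type.
Local Notation pauliT := {ffun 'I_n -> bool * bool}.
Local Notation weights := (pauliT -> pauliT -> R).
Local Notation empty := (@finset.set0 'I_n).
Local Notation full := (@finset.setTfor 'I_n).

(** The purities of a combination of the identity (coefficient a) and the swap (coefficient b) on
    two copies of the system, the operators fixed by all [U (x) U]. *)
Definition stationary (a b : R) (B : {set 'I_n}) : R :=
  a / 2 ^+ #|B| + b * 2 ^+ #|B| / 2 ^+ n.

Lemma stationary_rule a b (i j : 'I_n) : i != j ->
  purity_rule i j (stationary a b) (stationary a b).
Proof.
move=> ij B; case: ifPn => // ne; have [cB cU] := card_wall ij ne.
rewrite /stationary cB cU !exprS.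
have z (m : nat) : (2 : R) ^+ m != 0 by rewrite expf_neq0 // pnatr_eq0.
by field; rewrite !z.
Qed.

(** Interpolates between the sum in a purity, for s empty, and the single string k, for B empty and
    s the support of k. *)
Definition paulis_on (k : pauliT) (s : seq 'I_n) (B : {set 'I_n}) (k' : pauliT) :=
  all (fun m => k' m == k m) s && insupp k' (B :|: [set m in s]).

(** Split by the letter at i: it is trivial, or one of three letters that carry the same total
    weight by the symmetry at i. *)
Lemma sum_paulis_on (w : weights) (k : pauliT) i s (B : {set 'I_n}) :
  touched w i -> k i != idp -> i \notin s -> i \notin B ->
  \sum_(k' | paulis_on k s (i |: B) k') w k' k' =
  \sum_(k' | paulis_on k s B k') w k' k' +
  3 * \sum_(k' | paulis_on k (i :: s) B k') w k' k'.
Proof.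
move=> [_ tw] ki is_ iB.
rewrite (partition_big (fun k' : pauliT => k' i) predT) //= big_pairbool.
have part c : c != idp ->
    \sum_(k' | paulis_on k s (i |: B) k' && (k' i == c)) w k' k' =
    \sum_(k' | paulis_on k (i :: s) B k') w k' k'.
  move=> c0; rewrite (reindex_onto (fun k' => set2 k' i i c c)
    (fun k' => set2 k' i i (k i) (k i))); last first.
    by move=> k' /andP[_ /eqP <-]; rewrite set2_set2 set2_id.
  apply: eq_big => [k'|k' /andP[_ /eqP e]]; last first.
    by rewrite tw // -e set2l.
  rewrite set2_set2 set2l eqxx andbT /paulis_on /=.
  have [e|ne] := eqVneq (k' i) (k i); last first.
    by apply/negbTE; apply: contra ne => /andP[_ /eqP <-]; rewrite set2l.
  rewrite -e set2_id eqxx andbT; congr (_ && _).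
    apply: eq_in_all => m ms; rewrite set2o //; by apply: contraNneq is_ => <-.
  apply/insuppP/insuppP => H m; rewrite !inE.
    rewrite !negb_or => /and3P[mB mi ms]; have := H m.
    by rewrite set2o //; apply; rewrite !inE !negb_or mi mB.
  rewrite !negb_or => /andP[/andP[mi mB] ms]; rewrite set2o //.
  by apply: H; rewrite !inE !negb_or mi mB.
rewrite (part (true, true)) // (part (true, false)) // (part (false, true)) // addrC.
congr (_ + _); last by ring.
apply: eq_bigl => k'; rewrite /paulis_on -andbA; congr (_ && _).
apply/andP/insuppP => [[/insuppP H /eqP k'i] m|H].
  rewrite !inE negb_or => /andP[mB ms]; have [->//|mi] := eqVneq m i.
  by apply: H; rewrite !inE !negb_or mi mB.
split; last by apply/eqP/H; rewrite !inE negb_or iB.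
by apply/insuppP => m; rewrite !inE !negb_or => /andP[/andP[_ mB] ms]; apply: H; rewrite !inE negb_or mB.
Qed.

(* With s empty this is the approximation of the purities; each further qubit of s
   is handled by sum_paulis_on, which kills the coefficient of a. *)
Lemma inclusion_exclusion (w : weights) (k : pauliT) (a b e : R) (s : seq 'I_n) (B : {set 'I_n}) :
  (forall m, m \in s -> touched w m) -> (forall m, m \in s -> k m != idp) ->
  uniq s -> (forall m, m \in s -> m \notin B) ->
  (forall B, `|purity w B - stationary a b B| <= e) ->
  `|(\sum_(k' | paulis_on k s B k') w k' k') / 2 ^+ #|B| -
    stationary (if s is [::] then a else 0) b B| <= e.
Proof.
move=> + + + + He; elim: s B => [|i s IH] B tw ks us sB.
  rewrite (eq_bigl (fun k' : pauliT => insupp k' B)); first exact: He.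
  move=> k'; rewrite /paulis_on /=; congr (insupp _ _).
  by apply/setP => m; rewrite !inE orbF.
have /andP[is_ {}us] : (i \notin s) && uniq s by [].
have iB : i \notin B by apply: sB; rewrite mem_head.
have sub m : m \in s -> m \in i :: s by rewrite inE => ->; rewrite orbT.
have := sum_paulis_on (tw i (mem_head _ _)) (ks i (mem_head _ _)) is_ iB.
have IH1 := IH B (fun m ms => tw m (sub m ms)) (fun m ms => ks m (sub m ms)) us
  (fun m ms => sB m (sub m ms)).
have iBs m : m \in s -> m \notin i |: B.
  move=> ms; rewrite !inE negb_or sB ?sub // andbT.
  by apply: contraNneq is_ => <-.
have IH2 := IH (i |: B) (fun m ms => tw m (sub m ms)) (fun m ms => ks m (sub m ms)) us iBs.
move: IH1 IH2; rewrite /stationary cardsU1 iB !exprS /=.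
set S1 := bigop _ _ _; set S2 := bigop _ _ _; set S3 := bigop _ _ _.
set a' := (if s is [::] then a else 0).
have z0 (m : nat) : 0 < (2 : R) ^+ m by rewrite exprn_gt0.
rewrite mul0r add0r => IH1 IH2 SE.
(* The recursion solved for the new sum. Doubling the estimate for i |: B halves nothing of a',
   which cancels, and gives 4 b - b = 3 b. The two errors enter with factors 2/3 and 1/3. *)
have -> : S3 / 2 ^+ #|B| - b * 2 ^+ #|B| / 2 ^+ n =
  (2 * (S2 / (2 * 2 ^+ #|B|) - (a' / (2 * 2 ^+ #|B|) + b * (2 * 2 ^+ #|B|) / 2 ^+ n)) -
   (S1 / 2 ^+ #|B| - (a' / 2 ^+ #|B| + b * 2 ^+ #|B| / 2 ^+ n))) / 3.
  have -> : S2 = S1 + 3 * S3 by [].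
  by field; rewrite !gt_eqF.
rewrite ler_norml; move: IH1 IH2; rewrite !ler_norml.
set X := _ - _; set Y := _ - _ => /andP[? ?] /andP[? ?]; lra.
Qed.

Lemma weight_bound t (w w' : weights) : (1 < n)%N ->
  brickwork (@gate_rule R n) t.+2 w w' ->
  (forall B, purity w B <= 1) -> (forall k, 0 <= w k k) ->
  w [ffun=> idp] [ffun=> idp] = 1 ->
  (forall k k', k != k' -> w' k k' = 0) /\
  (forall k, k != [ffun=> idp] -> w' k k <= (2 ^+ n)^-1 + 2 * (4 / 5) ^+ t.+1).
Proof.
move=> n1 Hw pur1 w0 w1.
have tw m := brickwork_touched m n1 Hw.
split=> [k k' /eqP ne|k kn].
  have [m km] : exists m, k m != k' m.
    apply/existsP; apply: contra_notT ne; rewrite negb_exists => /forallP H.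
    by apply/ffunP => m; apply/eqP; have := H m; rewrite negbK.
  exact: (tw m).1.
have z4 : (4 : R) <= 2 ^+ n.
  rewrite (_ : 4 = 2 ^+ 2); last by rewrite expr2 -natrM.
  by rewrite ler_eXn2l // ltr1n.
have z0 (m : nat) : 0 < (2 : R) ^+ m by rewrite exprn_gt0.
have sum_empty : \sum_(k | insupp k empty) w k k = 1.
  rewrite (big_pred1 [ffun=> idp]) // => k'; apply/insuppP/eqP => [H|-> m _]; last by rewrite ffunE.
  by apply/ffunP => m; rewrite ffunE H // inE.
set p := purity w full; set z := (2 ^+ n : R)^-1.
have p_ge : z <= p.
  rewrite /p /purity cardsT card_ord -[X in X <= _]mul1r ler_pM2r ?invr_gt0 // -w1.
  rewrite (bigD1 [ffun=> idp]) /=; last by apply/insuppP => m _; rewrite ffunE.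
  by rewrite lerDl sumr_ge0.
have z14 : z <= 1 / 4 by rewrite /z div1r lef_pV2 ?posrE.
have zp : 0 < z by rewrite invr_gt0.
have pl : p <= 1 by exact: pur1.
(* a and b solve a + b z = 1 and a z + b = p, which match the purities 1 and p at the empty and full
   sets; D is the determinant. *)
pose D := 1 - z ^+ 2.
have Dp : 0 < D by rewrite /D; nra.
pose a := (1 - p * z) / D; pose b := (p - z) / D.
have a0 : 0 <= a by rewrite divr_ge0 ?(ltW Dp) //; nra.
have a1 : a <= 1 by rewrite ler_pdivrMr // mul1r /D; nra.
have b0 : 0 <= b by rewrite divr_ge0 ?(ltW Dp) //; nra.
have b1 : b <= 1 by rewrite ler_pdivrMr // mul1r /D; nra.
pose E (v : weights) B := purity v B - stationary a b B.
have HE : brickwork (@purity_rule R n) t.+2 (E w) (E w').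
  apply: brickwork_map Hw => u i v v' bi /(gate_purity (brick_neq bi)) Hp B.
  rewrite /E Hp (stationary_rule a b (brick_neq bi) B).
  by case: ifP => // _; ring.
(* The purity lies in [0, 1] and the stationary function in [0, 2]. *)
have EM B : `|E w B| <= 2.
  have hp : 0 <= purity w B by rewrite divr_ge0 ?(ltW (z0 _)) // sumr_ge0.
  have := pur1 B; rewrite /E /stationary.
  have u0 : 0 < (2 ^+ #|B| : R)^-1 by rewrite invr_gt0.
  have u1 : (2 ^+ #|B| : R)^-1 <= 1 by rewrite invf_le1 // exprn_ege1 // ler1n.
  have v0 : 0 < 2 ^+ #|B| * z by rewrite mulr_gt0.
  have v1 : 2 ^+ #|B| * z <= 1.
    rewrite -[X in _ <= X](@mulfV _ (2 ^+ n : R)) ?gt_eqF // ler_pM2r // ler_eXn2l ?ltr1n //.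
    by rewrite -[X in (_ <= X)%N]card_ord max_card.
  rewrite -/z -mulrA ler_norml => ?; nra.
have E0 B : B = empty \/ B = full -> E w B = 0.
  rewrite /E /stationary; case=> ->.
    rewrite /purity cards0 expr0 sum_empty !divr1 mulr1 -/z /a /b.
    by rewrite /D; field; rewrite -/D gt_eqF.
  rewrite -/p cardsT card_ord -mulrA divff ?gt_eqF // -/z mulr1 /a /b.
  by rewrite /D; field; rewrite -/D gt_eqF.
have Edec := brickwork_decay_any (ler0n _ 2) HE EM E0.
pose s := [seq m <- enum 'I_n | k m != idp].
have mem_s m : (m \in s) = (k m != idp) by rewrite mem_filter mem_enum andbT.
have := @inclusion_exclusion w' k a b _ s empty (fun m _ => tw m) _ _ _ Edec.
rewrite cards0 /stationary cards0 !expr0 !divr1 mulr1 -/z.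
rewrite (big_pred1 k); last first.
  move=> k'; rewrite /paulis_on; apply/andP/eqP => [[/allP ks /insuppP kN]|->].
    apply/ffunP => m; case: (boolP (m \in s)) => ms; first exact/eqP/ks.
    by rewrite kN ?inE //; move: ms; rewrite mem_s negbK => /eqP.
  split; first by apply/allP => m _.
  by apply/insuppP => m; rewrite !inE mem_s negbK => /eqP.
(* k is not the identity string, so its support s is nonempty, and all that is left of the
   stationary part is b z, at most 2^-n. *)
have -> : (if s is [::] then a else 0) = 0.
  case Es : s => [|//]; case/eqP: kn; apply/ffunP => m; rewrite ffunE.
  by apply/eqP; have := mem_s m; rewrite Es in_nil => /esym /negbFE.
rewrite add0r => /(_ _ _ _)/wrap; case.
- by move=> m; rewrite mem_s.
- by rewrite filter_uniq // enum_uniq.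
- by move=> m _; rewrite inE.
rewrite ler_norml => /andP[_ h].
have : b * z <= z by rewrite ler_piMl // ltW.
lra.
Qed.

End WeightBound.

(** * Density matrices *)

Section Density.
Context (R : realType).
Local Notation C := R[i].

Lemma adjmxD m n (A B : 'M[C]_(m, n)) : (A + B)^t* = A^t* + B^t*.
Proof. by rewrite !linearD /= map_mxD. Qed.

Lemma adjmxZ m n (a : C) (A : 'M[C]_(m, n)) : (a *: A)^t* = a^* *: A^t*.
Proof. by rewrite linearZ /= map_mxZ. Qed.

Lemma quad_delta N (M : 'M[C]_N) a b :
  ((delta_mx a 0 : 'cV[C]_N)^t* *m M *m (delta_mx b 0 : 'cV[C]_N)) 0 0 = M a b.
Proof.
by rewrite trmx_delta map_delta_mx -mulmxA -colE -rowE !mxE.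
Qed.

(** The quadratic form at x e_a + y e_b, which reduces what follows to 2 x 2 principal
    submatrices. *)
Lemma psd_quad N (M : 'M[C]_N) a b (x y : C) : psd M ->
  0 <= x * x^* * M a a + y * x^* * M a b + (x * y^* * M b a + y * y^* * M b b).
Proof.
pose q (u v : 'cV[C]_N) : C := (u^t* *m M *m v) 0 0.
have qDl u u' v : q (u + u') v = q u v + q u' v.
  by rewrite /q adjmxD mulmxDl mulmxDl mxE.
have qDr u v v' : q u (v + v') = q u v + q u v' by rewrite /q mulmxDr mxE.
have qZl (c : C) u v : q (c *: u) v = c^* * q u v.
  by rewrite /q adjmxZ -scalemxAl -scalemxAl mxE.
have qZr (c : C) u v : q u (c *: v) = c * q u v by rewrite /q -scalemxAr mxE.
have qE (e f : 'I_N) : q (delta_mx e 0) (delta_mx f 0) = M e f by exact: quad_delta.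
move=> [_ H]; have := H (x *: delta_mx a 0 + y *: delta_mx b 0); rewrite -/(q _ _).
by rewrite qDl !qDr !qZl !qZr !qE; congr (0 <= _); ring.
Qed.

Lemma psd_herm N (M : 'M[C]_N) a b : psd M -> M b a = (M a b)^*.
Proof. by move=> [H _]; rewrite -{1}H !mxE. Qed.

Lemma psd_diag N (M : 'M[C]_N) a : psd M -> 0 <= M a a.
Proof.
move=> pM; have := psd_quad a a 1 0 pM.
by rewrite rmorph1 rmorph0 !(mul0r, mulr0, mul1r, addr0).
Qed.

(** The vector (- M a b, M a a) yields M a a times the minor, which settles M a a > 0, and similarly
    for M b b. If both vanish, the vector (- M a b, 1) forces M a b = 0. *)
Lemma psd_minor N (M : 'M[C]_N) a b : psd M -> `|M a b| ^+ 2 <= M a a * M b b.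
Proof.
move=> pM; rewrite normCK.
have a0 := psd_diag a pM; have b0 := psd_diag b pM.
set z := M a b; have ar : (M a a)^* = M a a by apply/CrealP; rewrite ger0_real.
have br : (M b b)^* = M b b by apply/CrealP; rewrite ger0_real.
have h1 : 0 <= M a a * (M a a * M b b - z * z^*).
  have := psd_quad a b (- z) (M a a) pM; rewrite (psd_herm a b pM) -/z ar !rmorphN /=.
  by congr (0 <= _); ring.
have h2 : 0 <= M b b * (M a a * M b b - z * z^*).
  have := psd_quad a b (M b b) (- z^*) pM; rewrite (psd_herm a b pM) -/z br rmorphN /= conjCK.
  by congr (0 <= _); ring.
move: a0; rewrite le_eqVlt => /predU1P[a0|a0]; last by move: h1; rewrite pmulr_rge0 // subr_ge0.
move: b0; rewrite le_eqVlt => /predU1P[b0|b0]; last by move: h2; rewrite pmulr_rge0 // subr_ge0.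
have : 0 <= - (2 * (z * z^*)).
  have := psd_quad a b (- z) 1 pM; rewrite (psd_herm a b pM) -/z -a0 -b0 rmorphN rmorph1 /=.
  by congr (0 <= _); ring.
by rewrite -a0 mul0r oppr_ge0 pmulr_rle0.
Qed.

Lemma density_frobenius N (M : 'M[C]_N) : density M ->
  \sum_a \sum_b `|M a b| ^+ 2 <= 1.
Proof.
move=> [pM tM]; apply: le_trans (_ : \sum_a \sum_b M a a * M b b <= _).
  by apply: ler_sum => a _; apply: ler_sum => b _; exact: psd_minor.
under eq_bigr => a _ do rewrite -mulr_sumr.
by rewrite -mulr_suml -/(\tr M) tM mulr1.
Qed.

Definition pauli_coef n (X : 'M[C]_(2 ^ n)) (k : {ffun 'I_n -> bool * bool}) : R :=
  complex.Re (\tr (pauli R k *m X)).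

(** The sum of [P (x) P] over the strings supported in B is 2^|B| times the swap of the qubits in B
    between two copies, and the identity on the others. *)
Lemma sum_insupp_pauli n (B : {set 'I_n}) (x y x' y' : 'I_(2 ^ n)) :
  \sum_(k | insupp k B) pauli R k x y * pauli R k x' y' =
  2 ^+ #|B| * [forall m, if m \in B
     then (bits n x m == bits n y' m) && (bits n y m == bits n x' m)
     else (bits n x m == bits n y m) && (bits n x' m == bits n y' m)]%:R.
Proof.
pose Q m := if m \in B
  then (bits n x m == bits n y' m) && (bits n y m == bits n x' m)
  else (bits n x m == bits n y m) && (bits n x' m == bits n y' m).
pose F m (c : bool * bool) : C := ((c != idp) ==> (m \in B))%:R *
  (sigma R c (bits n x m) (bits n y m) * sigma R c (bits n x' m) (bits n y' m)).
rewrite big_mkcond /= (eq_bigr (fun k : {ffun 'I_n -> bool * bool} => \prod_m F m (k m))); last first.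
  move=> k _; rewrite /F big_split /= (prod_natb _ predT) /insupp big_split /= !mxE.
  by case: ifP => _; rewrite ?mul1r ?mul0r.
rewrite -(bigA_distr_bigA F).
have -> : [forall m, Q m]%:R = \prod_m (Q m)%:R :> C.
  by rewrite (prod_natb _ predT).
rewrite -prodr_const [X in X * _]big_mkcond /= -big_split /=; apply: eq_bigr => m _.
rewrite /F /Q; case: (m \in B).
  under eq_bigr => c _ do rewrite implybT mul1r.
  by rewrite sigma_complete -natrM mulnb.
rewrite mul1r big_pairbool /= !mul0r !add0r mul1r.
by rewrite !sigma_I -natrM mulnb.
Qed.

Definition mix n (B : {set 'I_n}) (u v : 'I_(2 ^ n)) : 'I_(2 ^ n) :=
  unbits [ffun m => if m \in B then bits n u m else bits n v m].

Lemma bits_mix n (B : {set 'I_n}) (u v : 'I_(2 ^ n)) m :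
  bits n (mix B u v) m = if m \in B then bits n u m else bits n v m.
Proof. by rewrite /mix unbitsK ffunE. Qed.

Lemma mix_cond n (B : {set 'I_n}) (x y x' y' : 'I_(2 ^ n)) :
  [forall m, if m \in B
     then (bits n x m == bits n y' m) && (bits n y m == bits n x' m)
     else (bits n x m == bits n y m) && (bits n x' m == bits n y' m)] =
  (x == mix B y' y) && (x' == mix B y y').
Proof.
apply/forallP/andP => [H|[/eqP -> /eqP ->] m]; last first.
  by rewrite !bits_mix; case: (m \in B); rewrite !eqxx.
split; apply/eqP/bits_inj/ffunP => m; rewrite bits_mix; have := H m;
  by case: (m \in B) => /andP[/eqP e1 /eqP e2].
Qed.

(** The 2 x 2 minors bound the square by a product of four diagonal entries, to which the inequality
    of arithmetic and geometric means applies. *)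
Lemma psd_amgm N (M : 'M[C]_N) a b c d : psd M ->
  `|M a c * M b d| <= (M a a * M b b + M c c * M d d) / 2.
Proof.
move=> pM; have D e := psd_diag e pM.
have ab0 : 0 <= M a a * M b b by rewrite mulr_ge0.
have cd0 : 0 <= M c c * M d d by rewrite mulr_ge0.
rewrite ler_pdivlMr ?ltr0n //.
rewrite -(@ler_pXn2r _ 2) ?nnegrE ?mulr_ge0 ?addr_ge0 ?normr_ge0 //.
have := (real_leif_AGM2_scaled (ger0_real ab0) (ger0_real cd0)).1.
apply: le_trans; rewrite exprMn normrM exprMn -natrX mulr_natr lerMn2r /=.
have -> : M a a * M b b * (M c c * M d d) = M a a * M c c * (M b b * M d d) by ring.
by apply: ler_pM; rewrite ?exprn_ge0 //; exact: psd_minor.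
Qed.

(** By [sum_insupp_pauli] the purity is the trace of the partial swap against two copies of rho.
    [psd_amgm] bounds each term by diagonal entries, and both halves of the bound sum to the square
    of the trace. *)
Lemma purity_density n (rho : 'M[C]_(2 ^ n)) (B : {set 'I_n}) : density rho ->
  purity (fun k k' => pauli_coef rho k * pauli_coef rho k') B <= 1.
Proof.
move=> [pr tr1]; rewrite /purity ler_pdivrMr ?exprn_gt0 // mul1r -lecR.
set lhs := (X in X <= _).
have lhs_real : lhs \is Num.real by rewrite /lhs complex_real.
apply: le_trans (real_ler_norm lhs_real) _.
have -> : lhs = 2 ^+ #|B| * \sum_(p : 'I_(2 ^ n) * 'I_(2 ^ n))
    rho p.1 (mix B p.2 p.1) * rho p.2 (mix B p.1 p.2).
  have [pH _ _] := pauli_pauli R n.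
  have ct k : ((pauli_coef rho k)%:C)%C =
      \sum_y \sum_x pauli R k x y * rho y x.
    by rewrite /pauli_coef trmx_herm_real ?pr.1 // mxtrace_mulE exchange_big.
  rewrite /lhs rmorph_sum /=.
  transitivity (\sum_y \sum_y' \sum_x \sum_x'
      (\sum_(k | insupp k B) pauli R k x y * pauli R k x' y') * (rho y x * rho y' x')).
    under eq_bigr => k _.
      rewrite rmorphM /= !ct big_distrlr /=.
      under eq_bigr => y _ do under eq_bigr => y' _ do rewrite big_distrlr /=.
      over.
    rewrite exchange_big; apply: eq_bigr => y _.
    rewrite exchange_big; apply: eq_bigr => y' _.
    rewrite exchange_big; apply: eq_bigr => x _.
    rewrite exchange_big; apply: eq_bigr => x' _.
    by rewrite mulr_suml; apply: eq_bigr => k _; rewrite mulrACA.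
  rewrite pair_bigA mulr_sumr; apply: eq_bigr => -[y y'] _ /=.
  rewrite (bigD1 (mix B y' y)) //= [X in _ + X]big1 ?addr0; last first.
    move=> x /negbTE nx; rewrite big1 // => x' _.
    by rewrite sum_insupp_pauli mix_cond nx mulr0 mul0r.
  rewrite (bigD1 (mix B y y')) //= [X in _ + X]big1 ?addr0; last first.
    by move=> x /negbTE nx; rewrite sum_insupp_pauli mix_cond nx andbF mulr0 mul0r.
  by rewrite sum_insupp_pauli mix_cond !eqxx mulr1.
have -> : ((2 ^+ #|B| : R)%:C)%C = 2 ^+ #|B| by rewrite rmorphXn /= rmorph_nat.
rewrite normrM ger0_norm ?exprn_ge0 // -[X in _ <= X]mulr1 ler_pM2l ?exprn_gt0 //.
(* The partial swap permutes the pairs of basis indices, so reindexing by it turns the second half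
   of the bound into the first. *)
pose phi (p : 'I_(2 ^ n) * 'I_(2 ^ n)) := (mix B p.2 p.1, mix B p.1 p.2).
have phiK : involutive phi.
  move=> [y y']; rewrite /phi /=; congr pair; apply/bits_inj/ffunP => m;
  by rewrite !bits_mix; case: (m \in B).
have sum1 : \sum_(p : 'I_(2 ^ n) * 'I_(2 ^ n)) rho p.1 p.1 * rho p.2 p.2 = 1.
  rewrite -(pair_bigA _ (fun x y => rho x x * rho y y)) /=.
  under eq_bigr => y _ do rewrite -mulr_sumr.
  by rewrite -mulr_suml -/(\tr rho) tr1 mulr1.
apply: le_trans (ler_norm_sum _ _ _) _.
apply: le_trans (_ : \sum_(p : 'I_(2 ^ n) * 'I_(2 ^ n))
   (rho p.1 p.1 * rho p.2 p.2 + rho (phi p).1 (phi p).1 * rho (phi p).2 (phi p).2) / 2 <= _).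
  by apply: ler_sum => p _; exact: psd_amgm.
rewrite -mulr_suml big_split /= sum1.
have -> : \sum_(p : 'I_(2 ^ n) * 'I_(2 ^ n)) rho (phi p).1 (phi p).1 * rho (phi p).2 (phi p).2 = 1.
  by rewrite -sum1 [RHS](reindex_inj (inv_inj phiK)).
by rewrite -mulr2n mulfV ?pnatr_eq0.
Qed.

End Density.

(** * Heisenberg evolution of Pauli coefficients *)

Section CircuitAlgebra.
Context (R : realType) (n : nat).
Local Notation C := R[i].

Lemma embed_mulmx (i j : 'I_n) (u : 'M[C]_4) m (M : 'M[C]_(2 ^ n, m)) x y : i != j ->
  (embed i j u *m M) x y =
  \sum_(c < 4) u (enc (bits n x i, bits n x j)) c *
               M (unbits (set2 (bits n x) i j (hi c) (lo c))) y.
Proof.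
move=> ij; rewrite -[embed i j u]trmxCK.
rewrite embed_adj adj_embed_mulmx //; apply: eq_bigr => c _.
by rewrite !mxE conjCK.
Qed.

Definition embeds (h : 'I_n -> 'M[C]_4) (s : seq 'I_n) : 'M[C]_(2 ^ n) :=
  foldr (fun i M => embed i (nxt i) (h i) *m M) 1%:M s.

Definition uncovered (s : seq 'I_n) (k : 'I_n) : bool :=
  (k \notin s) && (k \notin map (@nxt n) s).

Lemma embedsE t (h : 'I_n -> 'M[C]_4) (s : seq 'I_n) x y :
  {subset s <= positions n t} -> uniq s ->
  embeds h s x y =
  (\prod_(i <- s) h i (enc (bits n x i, bits n x (nxt i))) (enc (bits n y i, bits n y (nxt i)))) *
  \prod_(k < n | uncovered s k) (bits n x k == bits n y k)%:R.
Proof.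
elim: s x => [|i s IH] x sub; rewrite ?big_nil ?big_cons => us.
  by rewrite mxE mul1r (prod_natb _ predT) -eq_bits.
have /andP[is_ {}us] : (i \notin s) && uniq s by [].
have bi : brick n t i by rewrite -mem_positions sub // mem_head.
have {}sub : {subset s <= positions n t}.
  by move=> l ls; apply: sub; rewrite inE ls orbT.
have disj m : m \in s -> [/\ m != i, m != nxt i, nxt m != i & nxt m != nxt i].
  move=> ms; have mi : m != i by apply: contraNneq is_ => <-.
  have bm : brick n t m by rewrite -mem_positions sub.
  by have [] := brick_disjoint bi bm (contra_neq esym mi).
have ij := brick_neq bi.
(* The other gates are the identity on [i] and [nxt i], so only the intermediate index with the bits
   of y there contributes. *)
rewrite /= embed_mulmx // (bigD1 (enc (bits n y i, bits n y (nxt i)))) //=.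
have ui : uncovered s i.
  rewrite /uncovered is_ /=; apply/mapP => -[m ms im].
  by have [_ _ /eqP + _] := disj m ms; rewrite -im.
have uj : uncovered s (nxt i).
  apply/andP; split; first by apply/negP => /disj[_ /eqP + _ _].
  by apply/mapP => -[m ms im]; have [_ _ _ /eqP] := disj m ms; rewrite -im.
have pairs m c : m \in s ->
    bits n (unbits (set2 (bits n x) i (nxt i) (hi c) (lo c))) m = bits n x m /\
    bits n (unbits (set2 (bits n x) i (nxt i) (hi c) (lo c))) (nxt m) = bits n x (nxt m).
  by move=> /disj[d1 d2 d3 d4]; rewrite unbitsK !set2o.
rewrite big1 ?addr0; last first.
  move=> c ne; rewrite IH // (bigD1 i) //= (bigD1 (nxt i)) /=; last by rewrite uj eq_sym.
  rewrite !unbitsK set2l set2r //.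
  have [e1|n1] := eqVneq (hi c) (bits n y i); last by rewrite mul0r !mulr0.
  have [e2|n2] := eqVneq (lo c) (bits n y (nxt i)); last by rewrite mul0r !mulr0.
  by case/eqP: ne; rewrite -e1 -e2 enc_hilo.
rewrite -mulrA; congr (_ * _); rewrite IH //; congr (_ * _).
  by apply: eq_big_seq => m /pairs-/(_ (enc (bits n y i, bits n y (nxt i))))[-> ->].
rewrite (bigD1 i) //= (bigD1 (nxt i)) /=; last by rewrite uj eq_sym.
rewrite !unbitsK set2l set2r // hi_enc lo_enc !eqxx !mul1r.
apply: eq_big => [k|k /andP[/andP[_ ki] kj]]; last by rewrite set2o.
rewrite /uncovered /= !inE !negb_or.
by case: (k == i); case: (k == nxt i); case: (k \in s); rewrite ?andbF ?andbT.
Qed.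

(** Links the entrywise definition of a layer to a product of gates, which the moments can follow
    one gate at a time. *)
Lemma layerE t (h : 'I_n -> 'M[C]_4) : layer t h = embeds h (positions n t).
Proof.
apply/matrixP => x y; rewrite (@embedsE t) //; last by rewrite filter_uniq // enum_uniq.
rewrite mxE big_filter big_enum_cond /=; congr (_ * _).
  apply: eq_big => [//|i /andP[hi_ _]].
  by rewrite /qubit_pair /enc !ffunE val_nxt.
apply: eq_big => [k|k _]; last by rewrite !ffunE.
rewrite /covered /uncovered mem_positions negb_or; congr (_ && _); congr (~~ _).
apply/andP/mapP => [[k0 bk]|[m]].
  have hk : (k.-1 < n)%N by apply: leq_ltn_trans (leq_pred _) _.
  exists (Ordinal hk); first by rewrite mem_positions.
  by apply: val_inj; rewrite /= val_nxt /= prednK.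
rewrite mem_positions => bm ->; case/andP: (bm) => hm _.
by rewrite val_nxt.
Qed.

End CircuitAlgebra.

Section Heisenberg.
Context (R : realType) (n d : nat) (Omega : Type).
Context (g : 'I_d.+1 * 'I_n -> Omega -> 'M[R[i]]_4).
Local Notation C := R[i].
Local Notation pauliT := {ffun 'I_n -> bool * bool}.

Definition gate_mx (p : 'I_d.+1 * 'I_n) (w : Omega) : 'M[C]_(2 ^ n) :=
  embed p.2 (nxt p.2) (g p w).

Definition unitary_of (s : seq ('I_d.+1 * 'I_n)) (w : Omega) : 'M[C]_(2 ^ n) :=
  foldr (fun p M => gate_mx p w *m M) 1%:M s.

(** Latest layer first, the order of the factors in the circuit. [inord] needs a nonempty range of
    layers, hence the depth [d.+1]. *)
Fixpoint gate_list (t : nat) : seq ('I_d.+1 * 'I_n) :=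
  if t is t'.+1 then [seq (inord t', i) | i <- positions n t'] ++ gate_list t'
  else [::].

Lemma mem_gate_list t p : (t <= d.+1)%N ->
  (p \in gate_list t) = (p.1 < t)%N && brick n p.1 p.2.
Proof.
elim: t => // t IH td; rewrite mem_cat IH ?(ltnW td) // [in RHS]ltnS [in RHS]leq_eqVlt andb_orl.
congr (_ || _); case: p {IH} => l i /=; apply/mapP/andP => [[k]|[/eqP lt bi]].
  by rewrite mem_positions => bk [-> ->]; rewrite inordK.
exists i; first by rewrite mem_positions -lt.
by congr pair; apply: val_inj; rewrite /= inordK.
Qed.

Lemma uniq_gate_list t : (t <= d.+1)%N -> uniq (gate_list t).
Proof.
elim: t => // t IH td; rewrite /= cat_uniq IH ?(ltnW td) // andbT.
rewrite map_inj_uniq; last by move=> i j [].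
rewrite filter_uniq ?enum_uniq //=; apply/hasPn => p.
rewrite mem_gate_list ?(ltnW td) // => /andP[pt _].
by apply/mapP => -[i _ pE]; move: pt; rewrite pE /= inordK // ltnn.
Qed.

Lemma unitary_of_cat s1 s2 w :
  unitary_of (s1 ++ s2) w = unitary_of s1 w *m unitary_of s2 w.
Proof. by elim: s1 => [|p s1 IH] /=; rewrite ?mul1mx // IH mulmxA. Qed.

Lemma circuit_gate_list w :
  circuit (fun p => g p w) = unitary_of (gate_list d.+1) w.
Proof.
pose F (l : nat) := embeds (fun i => g (inord l, i) w) (positions n l).
have main t : \prod_(l < t) F (t - l.+1)%N = unitary_of (gate_list t) w.
  elim: t => [|t IH]; first by rewrite big_ord0.
  rewrite big_ord_recl /= subn1 unitary_of_cat -IH -mulmxE; congr (_ *m _).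
  by rewrite /F /embeds /unitary_of foldr_map.
rewrite -main; apply: eq_bigr => l _; rewrite layerE /F.
congr (embeds _ _); apply/funext => i; congr (g (_, _) w); apply: val_inj.
by rewrite /= inordK // subSS ltnS leq_subr.
Qed.

Definition evolve (X : 'M[C]_(2 ^ n)) s w := unitary_of s w *m X *m (unitary_of s w)^t*.

(** Cyclicity of the trace moves the gate from X to the Pauli string. *)
Lemma pauli_coef_embed (i j : 'I_n) (u : 'M[C]_4) (X : 'M[C]_(2 ^ n)) (k : pauliT) : i != j ->
  pauli_coef (embed i j u *m X *m (embed i j u)^t*) k =
  \sum_b transfer u (k i, k j) b * pauli_coef X (set2 k i j b.1 b.2).
Proof.
move=> ij; rewrite /pauli_coef.
have -> : \tr (pauli R k *m (embed i j u *m X *m (embed i j u)^t*)) =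
    \tr ((embed i j u)^t* *m pauli R k *m embed i j u *m X).
  by rewrite !mulmxA mxtrace_mulC !mulmxA.
rewrite embed_pauli // mulmx_suml [\tr _]raddf_sum raddf_sum /=; apply: eq_bigr => b _.
by rewrite -scalemxAl mxtraceZ Re_realM.
Qed.

Lemma pauli_coef_evolve_cons X (p : 'I_d.+1 * 'I_n) s w (k : pauliT) : brick n p.1 p.2 ->
  pauli_coef (evolve X (p :: s) w) k =
  \sum_b transfer (g p w) (k p.2, k (nxt p.2)) b *
    pauli_coef (evolve X s w) (set2 k p.2 (nxt p.2) b.1 b.2).
Proof.
move=> bp; rewrite -pauli_coef_embed ?(brick_neq bp) //; congr (pauli_coef _ _).
by rewrite /evolve /= adjmxM !mulmxA.
Qed.

End Heisenberg.

Local Open Scope classical_set_scope.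

(** * Expectations and independence *)

Section Expectation.
Context (R : realType) (d : measure_display) (Omega : measurableType d).
Context (P : probability Omega R).

(** Bounded measurable functions are closed under sums and products and integrable for a probability
    measure, so no further integrability condition has to be tracked. *)
Definition bmf (f : Omega -> R) : Prop :=
  measurable_fun setT f /\ exists M : R, forall w, `|f w| <= M.

Definition mean (f : Omega -> R) : R := \int[P]_w f w.

Lemma bmf_integrable f : bmf f -> P.-integrable setT (EFin \o f).
Proof.
move=> [mf [M fM]]; apply: measurable_bounded_integrable => //.
  exact: le_lt_trans (probability_le1 P measurableT) (ltry _).
exists M; split; first exact: num_real.
by move=> x Mx w _; exact: le_trans (fM w) (ltW Mx).
Qed.

Lemma bmf_cst c : bmf (fun=> c).
Proof. by split; [exact: measurable_cst | exists `|c|]. Qed.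

Lemma bmfD f g : bmf f -> bmf g -> bmf (fun w => f w + g w).
Proof.
move=> [mf [M fM]] [mg [N gN]]; split; first exact: measurable_funD.
by exists (M + N) => w; rewrite (le_trans (ler_normD _ _)) // lerD.
Qed.

Lemma bmfM f g : bmf f -> bmf g -> bmf (fun w => f w * g w).
Proof.
move=> [mf [M fM]] [mg [N gN]]; split; first exact: measurable_funM.
by exists (M * N) => w; rewrite normrM ler_pM.
Qed.

Lemma bmfZ c f : bmf f -> bmf (fun w => c * f w).
Proof. by move=> bf; apply: bmfM => //; exact: bmf_cst. Qed.

Lemma bmfB f g : bmf f -> bmf g -> bmf (fun w => f w - g w).
Proof.
move=> bf bg; under eq_fun => w do rewrite -mulN1r.
by apply: bmfD => //; exact: bmfZ.
Qed.

Lemma bmf_sum I (r : seq I) (Q : pred I) (F : I -> Omega -> R) :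
  (forall k, Q k -> bmf (F k)) -> bmf (fun w => \sum_(k <- r | Q k) F k w).
Proof.
move=> H; elim: r => [|k r IH].
  by under eq_fun => w do rewrite big_nil; exact: bmf_cst.
under eq_fun => w do rewrite big_cons.
by case Qk : (Q k) => //; apply: bmfD => //; exact: H.
Qed.

Lemma bmf_prod I (r : seq I) (Q : pred I) (F : I -> Omega -> R) :
  (forall k, Q k -> bmf (F k)) -> bmf (fun w => \prod_(k <- r | Q k) F k w).
Proof.
move=> H; elim: r => [|k r IH].
  by under eq_fun => w do rewrite big_nil; exact: bmf_cst.
under eq_fun => w do rewrite big_cons.
by case Qk : (Q k) => //; apply: bmfM => //; exact: H.
Qed.

Lemma bmf_indic (A : set Omega) : measurable A -> bmf (\1_A).
Proof.
move=> mA; split; first exact: measurable_indic.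
by exists 1 => w; rewrite indicE; case: (_ \in _); rewrite ?normr1 ?normr0.
Qed.

Lemma eq_mean f g : f =1 g -> mean f = mean g.
Proof. by move=> /funext ->. Qed.

Lemma mean_cst c : mean (fun=> c) = c.
Proof. by rewrite /mean Rintegral_cst //= probability_setT mulr1. Qed.

Lemma meanD f g : bmf f -> bmf g -> mean (fun w => f w + g w) = mean f + mean g.
Proof. by move=> /bmf_integrable bf /bmf_integrable bg; exact: RintegralD. Qed.

Lemma meanZ c f : bmf f -> mean (fun w => c * f w) = c * mean f.
Proof. by move=> /bmf_integrable bf; exact: RintegralZl. Qed.

Lemma meanB f g : bmf f -> bmf g -> mean (fun w => f w - g w) = mean f - mean g.
Proof.
move=> bf bg; under [in LHS]eq_fun => w do rewrite -mulN1r.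
by rewrite meanD ?meanZ ?mulN1r //; exact: bmfZ.
Qed.

Lemma mean_sum I (r : seq I) (Q : pred I) (F : I -> Omega -> R) :
  (forall k, Q k -> bmf (F k)) ->
  mean (fun w => \sum_(k <- r | Q k) F k w) = \sum_(k <- r | Q k) mean (F k).
Proof.
move=> H; elim: r => [|k r IH].
  by under eq_fun => w do rewrite big_nil; rewrite mean_cst big_nil.
under eq_fun => w do rewrite big_cons.
rewrite big_cons; case Qk : (Q k) => //.
by rewrite meanD ?IH //; [exact: H | exact: bmf_sum].
Qed.

Lemma le_mean f g : bmf f -> bmf g -> (forall w, f w <= g w) -> mean f <= mean g.
Proof.
by move=> /bmf_integrable bf /bmf_integrable bg fg; apply: le_Rintegral.
Qed.

Lemma mean_indic (A : set Omega) : measurable A -> (mean (\1_A))%:E = P A.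
Proof.
move=> mA; rewrite /mean /Rintegral integral_indic // setIT fineK //.
exact: fin_num_measure.
Qed.

Lemma mean_le_abs f (M : R) : bmf f -> (forall w, `|f w| <= M) -> `|mean f| <= M.
Proof.
move=> bf fM; have M1 : mean (fun=> M) = M by rewrite mean_cst.
have M2 : mean (fun=> - M) = - M by rewrite mean_cst.
rewrite ler_norml -M2 -{2}M1; apply/andP; split; apply: le_mean => //;
  try exact: bmf_cst; by move=> w; have := fM w; rewrite ler_norml => /andP[].
Qed.

(* Discretise f with mesh 1/m. *)
Lemma mean_indepM d' (T : measurableType d') (X : Omega -> T) (Y : Omega -> R) (f : T -> R) :
  measurable_fun setT X -> bmf Y ->
  (forall B, measurable B -> mean (fun w => \1_B (X w) * Y w) = mean (\1_(X @^-1` B)) * mean Y) ->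
  measurable_fun setT f -> (exists M : R, forall w, `|f (X w)| <= M) ->
  mean (fun w => f (X w) * Y w) = mean (fun w => f (X w)) * mean Y.
Proof.
move=> mX bY ind mf [M fM].
have bfX : bmf (fun w => f (X w)).
  by split; [exact: measurableT_comp | exists M].
have [_ [C YC]] := bY.
have C0 : 0 <= C by apply: le_trans (YC point).
have mXB B : measurable B -> measurable (X @^-1` B).
  by move=> mB; rewrite -[X in measurable X]setTI; exact: mX.
apply/eqP; rewrite -subr_eq0 -normr_le0; apply/ler_addgt0Pr => e e0; rewrite add0r.
(* The two approximation errors below add up to at most 2 C / m, which is below e. *)
pose m : R := 2 * (C + 1) / e.
have m0 : 0 < m by rewrite divr_gt0 // mulr_gt0 // ltr_wpDl.
(* [f (X w) + M] lies in [0, 2 M], so the slices of index below L cover it. *)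
pose L := (Num.truncn (m * (M + M))).+1.
pose A (j : nat) : set T := f @^-1` [set` `[j%:R / m - M, j.+1%:R / m - M[%R].
have mA j : measurable (A j).
  by rewrite -[X in measurable X]setTI; apply: mf => //; exact: measurable_itv.
pose s (x : T) : R := \sum_(j < L) (j%:R / m - M) * \1_(A j) x.
have sf w : `|f (X w) - s (X w)| <= 1 / m.
  pose y := m * (f (X w) + M).
  have /andP[fl fu] : - M <= f (X w) <= M by rewrite -ler_norml.
  have y0 : 0 <= y by rewrite mulr_ge0 ?(ltW m0) //; lra.
  have jL : (Num.truncn y < L)%N.
    by rewrite ltnS le_truncn // ler_pM2l //; lra.
  have /andP[jl ju] := truncn_itv y0.
  have inA (j : 'I_L) : \1_(A j) (X w) = (val j == Num.truncn y)%:R :> R.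
    rewrite indicE; congr (_%:R); congr nat_of_bool; apply/idP/eqP.
      rewrite inE /A /= in_itv /= => /andP[h1 h2]; apply/esym/truncn_def.
      by rewrite /y mulrC -ler_pdivrMr // -ltr_pdivlMr //; lra.
    move=> jE; rewrite inE /A /= in_itv /= jE.
    move: jl ju; rewrite /y mulrC -ler_pdivrMr // -ltr_pdivlMr // => ? ?.
    by apply/andP; split; lra.
  rewrite /s (bigD1 (Ordinal jL)) //= big1 ?addr0; last first.
    by move=> j jn; rewrite inA (_ : _ == _ = false) ?mulr0 //; apply/negbTE.
  rewrite (inA (Ordinal jL)) eqxx mulr1.
  move: jl ju; rewrite /y mulrC -ler_pdivrMr // -ltr_pdivlMr // -[(Num.truncn _).+1]addn1 natrD mulrDl => ? ?.
  by rewrite ler_norml; apply/andP; split; lra.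
have bind j : bmf (fun w => \1_(A j) (X w)) by exact: (bmf_indic (mXB _ (mA j))).
have bs : bmf (fun w => s (X w)).
  by apply: bmf_sum => j _; apply: bmfM; [exact: bmf_cst | exact: bind].
have sE : mean (fun w => s (X w) * Y w) = mean (fun w => s (X w)) * mean Y.
  rewrite /s mean_sum; last by move=> j _; apply: bmfM; [exact: bmf_cst | exact: bind].
  under eq_mean => w do rewrite mulr_suml.
  rewrite mean_sum; last first.
    by move=> j _; apply: (bmfM _ bY); apply: bmfM; [exact: bmf_cst | exact: bind].
  rewrite mulr_suml; apply: eq_bigr => j _.
  under eq_mean => w do rewrite -mulrA.
  rewrite meanZ; last by apply: bmfM => //; exact: bind.
  rewrite ind // mulrA; congr (_ * _).
  by rewrite meanZ //; exact: bind.
have d1 : `|mean (fun w => f (X w) * Y w) - mean (fun w => s (X w) * Y w)| <= C / m.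
  have -> : mean (fun w => f (X w) * Y w) - mean (fun w => s (X w) * Y w) =
      mean (fun w => (f (X w) - s (X w)) * Y w).
    under [RHS]eq_mean => w do rewrite mulrBl.
    by rewrite meanB //; exact: bmfM.
  apply: mean_le_abs => [|w].
    by apply: bmfM => //; exact: bmfB.
  have -> : C / m = 1 / m * C by rewrite div1r mulrC.
  by rewrite normrM ler_pM.
have d2 : `|mean (fun w => f (X w)) - mean (fun w => s (X w))| <= 1 / m.
  have -> : mean (fun w => f (X w)) - mean (fun w => s (X w)) =
      mean (fun w => f (X w) - s (X w)).
    by rewrite meanB.
  by apply: mean_le_abs => //; exact: bmfB.
have d3 : `|mean Y| <= C by exact: mean_le_abs.
set a := mean _ in d1 *; set b := mean (fun w => s (X w) * Y w) in d1 sE.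
set a' := mean _ in d2 *; set b' := mean (fun w => s (X w)) in d2 sE.
have -> : a - a' * mean Y = (a - b) - (a' - b') * mean Y by rewrite sE; ring.
apply: le_trans (ler_normB _ _) _; rewrite normrM.
have : `|a' - b'| * `|mean Y| <= 1 / m * C by rewrite ler_pM.
have -> : e = 2 * (C + 1) / m.
  by rewrite /m; field; rewrite gt_eqF //= gt_eqF // ltr_wpDl.
have : 0 < m^-1 by rewrite invr_gt0.
move: d1; set u := `|a - b|; set v := _ * `|mean Y|; nra.
Qed.

End Expectation.

(** * Measurability of complex and matrix-valued functions *)

Section ComplexMeasurable.
Context (R : realType) (d : measure_display) (T : measurableType d).
Local Notation C := R[i].

Definition cmeas (F : T -> C) : Prop :=
  measurable_fun setT (fun x => complex.Re (F x)) /\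
  measurable_fun setT (fun x => complex.Im (F x)).

Lemma cmeas_cst c : cmeas (fun=> c).
Proof. by split; exact: measurable_cst. Qed.

Lemma cmeasD F G : cmeas F -> cmeas G -> cmeas (fun x => F x + G x).
Proof.
move=> [f1 f2] [g1 g2]; split.
  rewrite (_ : (fun _ => _) = (fun x => complex.Re (F x) + complex.Re (G x))).
    exact: measurable_funD.
  by apply/funext => x; case: (F x); case: (G x).
rewrite (_ : (fun _ => _) = (fun x => complex.Im (F x) + complex.Im (G x))).
  exact: measurable_funD.
by apply/funext => x; case: (F x); case: (G x).
Qed.

Lemma cmeasM F G : cmeas F -> cmeas G -> cmeas (fun x => F x * G x).
Proof.
move=> [f1 f2] [g1 g2]; split.
  rewrite (_ : (fun _ => _) = (fun x => complex.Re (F x) * complex.Re (G x) -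
    complex.Im (F x) * complex.Im (G x))).
    by apply: measurable_funB; exact: measurable_funM.
  by apply/funext => x; case: (F x); case: (G x).
rewrite (_ : (fun _ => _) = (fun x => complex.Re (F x) * complex.Im (G x) +
    complex.Im (F x) * complex.Re (G x))).
  by apply: measurable_funD; exact: measurable_funM.
by apply/funext => x; case: (F x); case: (G x).
Qed.

Lemma cmeas_conj F : cmeas F -> cmeas (fun x => (F x)^*).
Proof.
move=> [f1 f2]; split.
  by rewrite (_ : (fun _ => _) = (fun x => complex.Re (F x))) //;
    apply/funext => x; case: (F x).
rewrite (_ : (fun _ => _) = (fun x => - complex.Im (F x))).
  exact: measurable_funN.
by apply/funext => x; case: (F x).
Qed.

Lemma cmeas_sum I (r : seq I) (Q : pred I) (F : I -> T -> C) :
  (forall k, Q k -> cmeas (F k)) -> cmeas (fun x => \sum_(k <- r | Q k) F k x).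
Proof.
move=> H; elim: r => [|k r IH].
  by under eq_fun => w do rewrite big_nil; exact: cmeas_cst.
under eq_fun => w do rewrite big_cons.
by case Qk : (Q k) => //; apply: cmeasD => //; exact: H.
Qed.

(** Makes sense for every shape; for square matrices it is measurability into [mxspace], by
    [mxmeasP]. *)
Definition mxmeas m n (F : T -> 'M[C]_(m, n)) : Prop :=
  forall a b, cmeas (fun x => F x a b).

Lemma mxmeas_cst m n (A : 'M[C]_(m, n)) : mxmeas (fun=> A).
Proof. by move=> a b; exact: cmeas_cst. Qed.

Lemma mxmeasM m n p (F : T -> 'M[C]_(m, n)) (G : T -> 'M[C]_(n, p)) :
  mxmeas F -> mxmeas G -> mxmeas (fun x => F x *m G x).
Proof.
move=> mF mG a b; under eq_fun => x do rewrite mxE.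
by apply: cmeas_sum => k _; exact: cmeasM.
Qed.

Lemma mxmeas_adj m n (F : T -> 'M[C]_(m, n)) :
  mxmeas F -> mxmeas (fun x => (F x)^t*).
Proof.
move=> mF a b; under eq_fun => x do rewrite !mxE.
exact: cmeas_conj.
Qed.

Lemma cmeas_tr n (F : T -> 'M[C]_n) : mxmeas F -> cmeas (fun x => \tr (F x)).
Proof. by move=> mF; apply: cmeas_sum. Qed.

Lemma mxmeasP n (F : T -> mxspace R n) :
  measurable_fun setT F <-> mxmeas (F : T -> 'M[C]_n).
Proof.
split=> [mF a b|mF].
  split.
    move=> _ Y mY; rewrite setTI.
    rewrite (_ : _ @^-1` Y = F @^-1` [set X : 'M[C]_n | Y (complex.Re (X a b))]) //.
    rewrite -[X in measurable X]setTI; apply: mF => //.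
    by apply: sub_sigma_algebra; exists a, b, Y; split => //; left.
  move=> _ Y mY; rewrite setTI.
  rewrite (_ : _ @^-1` Y = F @^-1` [set X : 'M[C]_n | Y (complex.Im (X a b))]) //.
  rewrite -[X in measurable X]setTI; apply: mF => //.
  by apply: sub_sigma_algebra; exists a, b, Y; split => //; right.
apply: (@measurability _ _ _ (mxspace R n) setT F (@mx_cylinder R n)) => //.
move=> _ [_ [a [b [Y [mY [->|->]]]]] <-].
  by have [h _] := mF a b; exact: h.
by have [_ h] := mF a b; exact: h.
Qed.

End ComplexMeasurable.

Lemma mxmeas_id (R : realType) n : mxmeas (fun X : mxspace R n => X : 'M[R[i]]_n).
Proof. by apply/mxmeasP; exact: measurable_id. Qed.

Lemma cmeas_comp (R : realType) d d' (T : measurableType d) (T' : measurableType d')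
    (h : T' -> T) (F : T -> R[i]) :
  measurable_fun setT h -> cmeas F -> cmeas (fun x => F (h x)).
Proof.
move=> mh [f1 f2]; split.
  exact: (measurableT_comp f1 mh).
exact: (measurableT_comp f2 mh).
Qed.

Lemma measurable_transfer (R : realType) a b :
  measurable_fun setT (fun u : mxspace R 4 => transfer (u : 'M[R[i]]_4) a b).
Proof.
apply: measurable_funM => //.
have [+ _] : cmeas (fun u : mxspace R 4 =>
    \tr (tau R a *m ((u : 'M[R[i]]_4) *m tau R b *m (u : 'M[R[i]]_4)^t*))).
  apply: cmeas_tr; apply: mxmeasM; first exact: mxmeas_cst.
  apply: mxmeasM; last by apply: mxmeas_adj; exact: mxmeas_id.
  by apply: mxmeasM; [exact: mxmeas_id | exact: mxmeas_cst].
by [].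
Qed.

Section Independence.
Context (R : realType) (d d' : measure_display) (Omega : measurableType d).
Context (T : measurableType d') (P : probability Omega R).

Lemma mean_same_law (X1 X2 : Omega -> T) (f : T -> R) :
  measurable_fun setT X1 -> measurable_fun setT X2 ->
  (forall B, measurable B -> P (X1 @^-1` B) = P (X2 @^-1` B)) ->
  measurable_fun setT f -> bmf (fun w => f (X1 w)) -> bmf (fun w => f (X2 w)) ->
  mean P (fun w => f (X1 w)) = mean P (fun w => f (X2 w)).
Proof.
move=> m1 m2 e mf /(bmf_integrable P) b1 /(bmf_integrable P) b2; rewrite /mean /Rintegral; congr fine.
have mfE : measurable_fun setT (EFin \o f) by exact/measurable_EFinP.
have I1 := @integral_pushforward _ _ _ _ _ _ m1 P setT (EFin \o f) mfE.
have I2 := @integral_pushforward _ _ _ _ _ _ m2 P setT (EFin \o f) mfE.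
rewrite !preimage_setT in I1 I2.
rewrite -[LHS]I1 // -[RHS]I2 //.
by apply: eq_measure_integral => B mB _; exact: e.
Qed.

Context (I : finType) (D : {set I}) (X : I -> Omega -> T).

Lemma mutual_mean (f : I -> T -> R) :
  (forall p, p \in D -> measurable_fun setT (X p)) ->
  mutually_independent P D X ->
  (forall p, measurable_fun setT (f p)) ->
  (forall p, p \in D -> exists M : R, forall w, `|f p (X p w)| <= M) ->
  mean P (fun w => \prod_(p in D) f p (X p w)) =
  \prod_(p in D) mean P (fun w => f p (X p w)).
Proof.
move=> mX ind.
(* Independence is given for events, that is for indicators. K lists the indices whose function may
   be more general; they are treated one at a time. *)
suff main (K : seq I) (h : I -> T -> R) (B : I -> set T) :
    (forall p, measurable_fun setT (h p)) ->
    (forall p, p \in D -> exists M : R, forall w, `|h p (X p w)| <= M) ->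
    (forall p, measurable (B p)) ->
    (forall p, p \in D -> p \notin K -> h p = \1_(B p)) ->
    mean P (fun w => \prod_(p in D) h p (X p w)) =
    \prod_(p in D) mean P (fun w => h p (X p w)).
  move=> mf bf; apply: (main (enum I) f (fun=> setT)) => // p _.
  by rewrite mem_enum.
elim: K h B => [|p0 K IH] h B mh bh mB hB.
  have mXB p : p \in D -> measurable (X p @^-1` B p).
    by move=> pD; rewrite -[Y in measurable Y]setTI; exact: mX.
  pose S := [set w | forall p, p \in D -> B p (X p w)].
  have mS : measurable S.
    rewrite (_ : S = \bigcap_(p in [set p | p \in D]) (X p @^-1` B p)).
      by apply: fin_bigcap_measurable => //; exact: finite_finset.
    by apply/seteqP; split => w H p /= pD; exact: H.
  have -> : (fun w => \prod_(p in D) h p (X p w)) = \1_S.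
    apply/funext => w; rewrite indicE; case: (boolP (w \in S)) => [|nS].
      rewrite inE => Sw; rewrite big1 // => p pD.
      by rewrite hB // indicE mem_set //; exact: Sw.
    have [p pD nB] : exists2 p, p \in D & ~ B p (X p w).
      move: nS; rewrite notin_setE => /existsNP[p /not_implyP[pD nB]].
      by exists p.
    by rewrite (bigD1 p) //= hB // indicE memNset // mul0r.
  apply: EFin_inj; rewrite mean_indic // ind //.
  rewrite -[RHS]/(EFin _) (big_morph EFin EFinM erefl).
  apply: eq_bigr => p pD; rewrite -mean_indic; last exact: mXB.
  by congr EFin; apply: eq_mean => w; rewrite hB.
have [p0D|p0D] := boolP (p0 \in D); last first.
  apply: (IH h B) => // p pD pK; apply: hB => //; rewrite inE negb_or pK andbT.
  by apply: contraNneq p0D => <-.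
pose Y w := \prod_(p in D | p != p0) h p (X p w).
pose c := \prod_(p in D | p != p0) mean P (fun w => h p (X p w)).
have bh' p : p \in D -> bmf (fun w => h p (X p w)).
  by move=> pD; split; [apply: measurableT_comp => //; exact: mX | exact: bh].
have bY : bmf Y by apply: bmf_prod => p /andP[pD _]; exact: bh'.
(* With an indicator at p0 the induction hypothesis applies; [mean_indepM] then passes from
   indicators to the function at p0. *)
have key B0 : measurable B0 ->
    mean P (fun w => \1_B0 (X p0 w) * Y w) = mean P (fun w => \1_B0 (X p0 w)) * c.
  move=> mB0.
  pose h' p := if p == p0 then \1_B0 : T -> R else h p.
  have h'n p : p != p0 -> h' p = h p by rewrite /h' => /negbTE ->.
  have h'0 : h' p0 = \1_B0 by rewrite /h' eqxx.
  transitivity (mean P (fun w => \prod_(p in D) h' p (X p w))).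
    apply: eq_mean => w; rewrite (bigD1 p0) //= h'0; congr (_ * _).
    by apply: eq_bigr => p /andP[_ pp0]; rewrite h'n.
  rewrite (IH h' (fun p => if p == p0 then B0 else B p)).
  - rewrite (bigD1 p0) //= h'0; congr (_ * _).
    by apply: eq_bigr => p /andP[_ pp0]; rewrite h'n.
  - by move=> p; rewrite /h'; case: ifP => _ //; exact: measurable_indic.
  - move=> p pD; rewrite /h'; case: ifP => _; last exact: bh.
    by exists 1 => w; rewrite indicE; case: (_ \in _); rewrite ?normr1 ?normr0.
  - by move=> p; case: ifP.
  - move=> p pD pK; rewrite /h'; case: ifP => // /negbT pp0; apply: hB => //.
    by rewrite inE negb_or pp0.
have YE : mean P Y = c.
  have := key setT measurableT.
  under eq_mean => w do rewrite indicE in_setT mul1r.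
  under [X in _ = X * _ -> _]eq_mean => w do rewrite indicE in_setT.
  by rewrite mean_cst mul1r.
rewrite [RHS](bigD1 p0) //= -/c -YE -mean_indepM //.
- by apply: eq_mean => w; rewrite (bigD1 p0).
- exact: mX.
- by move=> B0 mB0; rewrite key // YE.
- exact: bh.
Qed.

End Independence.

(** * Moments of Pauli coefficients under a random circuit *)

Section SecondMoment.
Context (R : realType) (n d : nat) (dO : measure_display).
Context (Omega : measurableType dO) (P : probability Omega R).
Context (haar : probability (mxspace R 4) R).
Context (g : 'I_d.+1 * 'I_n -> Omega -> mxspace R 4).
Hypothesis haarP : haar_measure haar.
Hypothesis gP : RQC_gates P haar g.
Local Notation C := R[i].
Local Notation pauliT := {ffun 'I_n -> bool * bool}.
Local Notation gate := ('I_d.+1 * 'I_n)%type.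

Let g_unitary p w : p \in bricks n d.+1 -> (g p w : 'M[C]_4) \is unitarymx.
Proof. by case: gP => _ + _ _; apply. Qed.

Let g_measurable p : p \in bricks n d.+1 -> measurable_fun setT (g p).
Proof. by case: gP => + _ _ _; apply. Qed.

Lemma bricksE (p : gate) : (p \in bricks n d.+1) = brick n p.1 p.2.
Proof. by rewrite inE. Qed.

Lemma bmf_transfer p a b : p \in bricks n d.+1 ->
  bmf (fun w => transfer (g p w : 'M[C]_4) a b).
Proof.
move=> pb; split; last by exists 1 => w; apply: transfer_bound; exact: g_unitary.
apply: (@measurableT_comp _ _ _ _ _ _ (fun u : mxspace R 4 => transfer (u : 'M[C]_4) a b)).
  exact: measurable_transfer.
exact: g_measurable.
Qed.

(** f is bounded on unitary matrices only, since transfer matrices are not bounded elsewhere; the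
    gates take no other values. *)
Lemma haar_mulr p (v : 'M[C]_4) (f : mxspace R 4 -> R) : p \in bricks n d.+1 ->
  v \is unitarymx -> measurable_fun setT f ->
  (exists M : R, forall u : 'M[C]_4, u \is unitarymx -> `|f u| <= M) ->
  mean P (fun w => f ((g p w : 'M[C]_4) *m v)) = mean P (fun w => f (g p w)).
Proof.
move=> pb vU mf [M fM].
have mgv : measurable_fun setT (fun w => (g p w : 'M[C]_4) *m v : mxspace R 4).
  apply/mxmeasP; apply: mxmeasM; last exact: mxmeas_cst.
  by apply/mxmeasP; exact: g_measurable.
have mv : measurable_fun setT (fun u : mxspace R 4 => (u : 'M[C]_4) *m v : mxspace R 4).
  by apply/mxmeasP; apply: mxmeasM; [exact: mxmeas_id | exact: mxmeas_cst].
have [_ _ glaw _] := gP.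
apply: (@mean_same_law _ _ _ _ _ P (fun w => (g p w : 'M[C]_4) *m v : mxspace R 4) (g p) f) => //.
- exact: g_measurable.
- move=> B mB; rewrite glaw // -((haarP.2 v B vU mB).2) -(glaw p) //.
  by rewrite -[X in measurable X]setTI; exact: mv.
- split; first by apply: (@measurableT_comp _ _ _ _ _ _ f).
  by exists M => w; apply: fM; rewrite mul_unitarymx // g_unitary.
- split; first by apply: (@measurableT_comp _ _ _ _ _ _ f) => //; exact: g_measurable.
  by exists M => w; apply: fM; exact: g_unitary.
Qed.

Lemma mean_transfer p a a' b b' : p \in bricks n d.+1 ->
  mean P (fun w => transfer (g p w : 'M[C]_4) a b * transfer (g p w : 'M[C]_4) a' b') =
  ((a == a') && (b == b'))%:R *
  (if a == tau0 then (b == tau0)%:R else (b != tau0)%:R / 15).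
Proof.
move=> pb.
apply: (@MomE R a a' (fun b b' => mean P (fun w => transfer (g p w : 'M[C]_4) a b *
  transfer (g p w : 'M[C]_4) a' b'))).
- move=> v s s' c c' e e' vU H H'.
  pose f (u : mxspace R 4) := transfer (u : 'M[C]_4) a c * transfer (u : 'M[C]_4) a' c'.
  rewrite -(@haar_mulr p v f) //.
  + rewrite /f; under eq_mean => w do rewrite (transfer_mulr _ _ H) (transfer_mulr _ _ H') mulrACA.
    by rewrite meanZ //; apply: bmfM; exact: bmf_transfer.
  + by apply: measurable_funM; exact: measurable_transfer.
  + exists 1 => u uU; rewrite normrM -[1]mulr1.
    by apply: ler_pM => //; exact: transfer_bound.
- rewrite -mean_sum; last by move=> c _; apply: bmfM; exact: bmf_transfer.
  under eq_mean => w do rewrite transfer_ortho ?g_unitary //.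
  by rewrite mean_cst.
- under eq_mean => w do rewrite !transfer_id ?g_unitary // -natrM mulnb.
  by rewrite mean_cst.
Qed.

Context (X : 'M[C]_(2 ^ n)).
Let T (s : seq gate) (k : pauliT) (w : Omega) : R := pauli_coef (evolve g X s w) k.

Lemma bmf_evolved_coef s k : {subset s <= bricks n d.+1} -> bmf (T s k).
Proof.
elim: s k => [|p s IH] k sub.
  rewrite (_ : T [::] k = fun=> pauli_coef X k); first exact: bmf_cst.
  by apply/funext => w; rewrite /T /evolve /= trmx1 map_mx1 mul1mx mulmx1.
have pb : p \in bricks n d.+1 by apply: sub; rewrite mem_head.
rewrite (_ : T _ _ = (fun w => \sum_b transfer (g p w : 'M[C]_4) (k p.2, k (nxt p.2)) b *
  T s (set2 k p.2 (nxt p.2) b.1 b.2) w)).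
  apply: bmf_sum => b _; apply: bmfM; first exact: bmf_transfer.
  by apply: IH => q qs; apply: sub; rewrite inE qs orbT.
by apply/funext => w; rewrite /T pauli_coef_evolve_cons // -bricksE.
Qed.

(** The coefficients after the gates s are independent of the other gates. The form with a family F
    suits the induction on s: the transfer factor of the first gate p is absorbed in the family, as
    its function at p. *)
Lemma mean_evolved_coef_indep s k k' (F : gate -> mxspace R 4 -> R) :
  {subset s <= bricks n d.+1} -> uniq s ->
  (forall p, measurable_fun setT (F p)) ->
  (forall p, exists M : R, forall u : 'M[C]_4, u \is unitarymx -> `|F p u| <= M) ->
  mean P (fun w => T s k w * T s k' w * \prod_(p in bricks n d.+1 | p \notin s) F p (g p w)) =
  mean P (fun w => T s k w * T s k' w) *
  \prod_(p in bricks n d.+1 | p \notin s) mean P (fun w => F p (g p w)).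
Proof.
elim: s k k' F => [|p s IH] k k' F sub us mF bF.
  have T0 j : T [::] j = fun=> pauli_coef X j.
    by apply/funext => w; rewrite /T /evolve /= trmx1 map_mx1 mul1mx mulmx1.
  have bFg p : p \in bricks n d.+1 -> bmf (fun w => F p (g p w)).
    move=> pb; split; first by apply: measurableT_comp => //; exact: g_measurable.
    by have [M FM] := bF p; exists M => w; apply: FM; exact: g_unitary.
  rewrite !T0 meanZ ?mean_cst; last by apply: bmf_prod => p /andP[pb _]; exact: bFg.
  have nin (p : gate) : (p \in bricks n d.+1) && (p \notin [::]) = (p \in bricks n d.+1).
    by rewrite andbT.
  rewrite (eq_bigl _ _ nin); congr (_ * _).
  under eq_mean => w do rewrite (eq_bigl _ _ nin).
  have [_ _ _ ind] := gP.
  apply: mutual_mean => // p pb.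
  by have [_] := bFg p pb.
have pb : p \in bricks n d.+1 by apply: sub; rewrite mem_head.
have {}sub : {subset s <= bricks n d.+1}.
  by move=> q qs; apply: sub; rewrite inE qs orbT.
have /andP[ps {}us] : (p \notin s) && uniq s by [].
pose tr b b' (u : mxspace R 4) := transfer (u : 'M[C]_4) (k p.2, k (nxt p.2)) b *
  transfer (u : 'M[C]_4) (k' p.2, k' (nxt p.2)) b'.
pose kb b := set2 k p.2 (nxt p.2) b.1 b.2; pose kb' b := set2 k' p.2 (nxt p.2) b.1 b.2.
have mtr b b' : measurable_fun setT (tr b b').
  by apply: measurable_funM; exact: measurable_transfer.
have btr b b' : exists M : R, forall u : 'M[C]_4, u \is unitarymx -> `|tr b b' u| <= M.
  exists 1 => u uU; rewrite normrM -[1]mulr1.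
  by apply: ler_pM => //; exact: transfer_bound.
have TT w : T (p :: s) k w * T (p :: s) k' w =
    \sum_b \sum_b' tr b b' (g p w) * (T s (kb b) w * T s (kb' b') w).
  rewrite /T !pauli_coef_evolve_cons -?bricksE // big_distrlr /=.
  by apply: eq_bigr => b _; apply: eq_bigr => b' _; rewrite mulrACA.
have off q : (q \in bricks n d.+1) && (q \notin s) && (q != p) =
    (q \in bricks n d.+1) && (q \notin p :: s).
  by rewrite inE negb_or -andbA; congr (_ && _); rewrite andbC.
have split (G : gate -> R) : \prod_(q in bricks n d.+1 | q \notin s) G q =
    G p * \prod_(q in bricks n d.+1 | q \notin p :: s) G q.
  by rewrite (bigD1 p) /= ?pb //; congr (_ * _); apply: eq_bigl => q; exact: off.
have bTT (b b' : (bool * bool) * (bool * bool)) : bmf (fun w => T s (kb b) w * T s (kb' b') w).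
  by apply: bmfM; exact: bmf_evolved_coef.
have bF' (G : gate -> mxspace R 4 -> R) q : (forall p, measurable_fun setT (G p)) ->
    (forall p, exists M : R, forall u : 'M[C]_4, u \is unitarymx -> `|G p u| <= M) ->
    q \in bricks n d.+1 -> bmf (fun w => G q (g q w)).
  move=> mG bG qb; split; first by apply: measurableT_comp => //; exact: g_measurable.
  by have [M FM] := bG q; exists M => w; apply: FM; exact: g_unitary.
have btrg b b' : bmf (fun w => tr b b' (g p w)).
  by apply: (bF' (fun=> tr b b')).
have main (G : gate -> mxspace R 4 -> R) : (forall p, measurable_fun setT (G p)) ->
    (forall p, exists M : R, forall u : 'M[C]_4, u \is unitarymx -> `|G p u| <= M) ->
    mean P (fun w => T (p :: s) k w * T (p :: s) k' w *
      \prod_(q in bricks n d.+1 | q \notin p :: s) G q (g q w)) =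
    (\sum_b \sum_b' mean P (fun w => tr b b' (g p w)) *
       mean P (fun w => T s (kb b) w * T s (kb' b') w)) *
    \prod_(q in bricks n d.+1 | q \notin p :: s) mean P (fun w => G q (g q w)).
  move=> mG bG.
  have bprod : bmf (fun w => \prod_(q in bricks n d.+1 | q \notin p :: s) G q (g q w)).
    by apply: bmf_prod => q /andP[qb _]; exact: bF'.
  under eq_mean => w do rewrite TT mulr_suml.
  rewrite mean_sum; last first.
    move=> b _; apply: bmfM => //; apply: bmf_sum => b' _; exact: bmfM.
  rewrite mulr_suml; apply: eq_bigr => b _.
  under eq_mean => w do rewrite mulr_suml.
  rewrite mean_sum; last by move=> b' _; apply: bmfM => //; exact: bmfM.
  rewrite mulr_suml; apply: eq_bigr => b' _.
  pose G' q := if q == p then tr b b' else G q.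
  have G'p : G' p = tr b b' by rewrite /G' eqxx.
  have G'q q : q \notin p :: s -> G' q = G q.
    by rewrite /G' inE negb_or => /andP[/negbTE ->].
  have := IH (kb b) (kb' b') G' sub us.
  case/(_ _ _)/wrap.
  - by move=> q; rewrite /G'; case: ifP.
  - by move=> q; rewrite /G'; case: ifP.
  rewrite split G'p => E.
  rewrite [LHS](_ : _ = mean P (fun w => T s (kb b) w * T s (kb' b') w *
     \prod_(q in bricks n d.+1 | q \notin s) G' q (g q w))).
    rewrite E mulrA [_ * mean P (fun w => tr _ _ _)]mulrC; congr (_ * _).
    by apply: eq_bigr => q /andP[_ qs]; rewrite G'q.
  apply: eq_mean => w; rewrite split G'p [RHS]mulrCA -[LHS]mulrA; congr (_ * (_ * _)).
  by apply: eq_bigr => q /andP[_ qs]; rewrite G'q.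
rewrite main //; congr (_ * _).
(* With all other factors equal to 1, the same formula computes the mean of the coefficients
   alone. *)
have := main (fun _ _ => 1).
case/(_ _ _)/wrap.
- by move=> q; exact: measurable_cst.
- by move=> q; exists 1 => u _; rewrite normr1.
rewrite [X in _ * X]big1 ?mulr1; last by move=> q _; rewrite mean_cst.
move=> <-; apply: eq_mean => w.
by rewrite big1 ?mulr1.
Qed.

Definition weight s (k k' : pauliT) : R := mean P (fun w => T s k w * T s k' w).

(** The gate p does not occur in s, so its transfer moments factor out of the mean and take their
    Haar values. *)
Lemma weight_cons p s : {subset p :: s <= bricks n d.+1} -> uniq (p :: s) ->
  gate_rule p.2 (nxt p.2) (weight s) (weight (p :: s)).
Proof.
move=> sub us k k'.
have pb : p \in bricks n d.+1 by apply: sub; rewrite mem_head.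
have {}sub : {subset s <= bricks n d.+1}.
  by move=> q qs; apply: sub; rewrite inE qs orbT.
have /andP[ps {}us] : (p \notin s) && uniq s by [].
set a := (k p.2, k (nxt p.2)); set a' := (k' p.2, k' (nxt p.2)).
pose kb b := set2 k p.2 (nxt p.2) b.1 b.2; pose kb' b := set2 k' p.2 (nxt p.2) b.1 b.2.
pose tr b b' (u : mxspace R 4) := transfer (u : 'M[C]_4) a b * transfer (u : 'M[C]_4) a' b'.
have bTT (b b' : (bool * bool) * (bool * bool)) : bmf (fun w => T s (kb b) w * T s (kb' b') w).
  by apply: bmfM; exact: bmf_evolved_coef.
have btr b b' : bmf (fun w => tr b b' (g p w)) by apply: bmfM; exact: bmf_transfer.
have -> : weight (p :: s) k k' = \sum_b \sum_b'
    mean P (fun w => tr b b' (g p w)) * weight s (kb b) (kb' b').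
  rewrite /weight (@eq_mean _ _ _ P _ (fun w =>
    \sum_b \sum_b' tr b b' (g p w) * (T s (kb b) w * T s (kb' b') w))); last first.
    move=> w; rewrite /T !pauli_coef_evolve_cons -?bricksE // big_distrlr /=.
    by apply: eq_bigr => b _; apply: eq_bigr => b' _; rewrite mulrACA.
  rewrite mean_sum; last by move=> b _; apply: bmf_sum => b' _; exact: bmfM.
  apply: eq_bigr => b _.
  rewrite mean_sum; last by move=> b' _; exact: bmfM.
  apply: eq_bigr => b' _.
  have := mean_evolved_coef_indep (kb b) (kb' b') (F := fun q => if q == p then tr b b' else fun=> 1) sub us.
  case/(_ _ _)/wrap.
  - by move=> q; case: ifP => // _; apply: measurable_funM; exact: measurable_transfer.
  - move=> q; case: ifP => _; exists 1 => u uU; rewrite ?normr1 //.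
    rewrite normrM -[1]mulr1; apply: ler_pM => //; exact: transfer_bound.
  rewrite [in RHS](bigD1 p) ?pb //= eqxx [X in _ * (_ * X)]big1 ?mulr1; last first.
    by move=> q /andP[_ /negbTE ->]; rewrite mean_cst.
  move=> E; rewrite mulrC -E; apply: eq_mean => w.
  rewrite (bigD1 p) ?pb //= eqxx big1 ?mulr1; last by move=> q /andP[_ /negbTE ->].
  by rewrite mulrC.
under eq_bigr => b _ do under eq_bigr => b' _ do rewrite /tr mean_transfer //.
have [aa|//] := eqVneq a a'; last first.
  by rewrite /= => _; rewrite big1 // => b _; rewrite big1 // => b' _; rewrite !mul0r.
rewrite /=.
under eq_bigr => b _.
  rewrite (bigD1 b) //= eqxx mul1r big1 ?addr0; last first.
    by move=> b' /negbTE; rewrite eq_sym => ->; rewrite !mul0r.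
  over.
case: (eqVneq a tau0) => [a0|an].
  rewrite (bigD1 tau0) //= ?eqxx ?mulr1n mul1r big1 ?addr0; last first.
    by move=> b /negbTE ->; rewrite mul0r.
  have -> : kb tau0 = k by rewrite -a0 /kb /a /= set2_id.
  by have -> : kb' tau0 = k' by rewrite -a0 aa /kb' /a' /= set2_id.
rewrite (bigD1 tau0) //= ?eqxx ?mulr0n !mul0r add0r mulr_suml.
by apply: eq_bigr => b ->; rewrite mul1r mulrC.
Qed.

Lemma brickwork_weight t : (t <= d.+1)%N ->
  brickwork (@gate_rule R n) t (weight [::]) (weight (gate_list n d t)).
Proof.
elim: t => [//|t IH] td; exists (weight (gate_list n d t)); first exact: IH (ltnW td).
have : {subset gate_list n d t.+1 <= bricks n d.+1} /\ uniq (gate_list n d t.+1).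
  split; last exact: uniq_gate_list.
  by move=> p; rewrite mem_gate_list // bricksE => /andP[].
have pt : forall i, i \in positions n t -> brick n t i by move=> i; rewrite mem_positions.
rewrite /=; elim: (positions n t) pt => [//|i s IHs] pt [sub us].
exists (weight ([seq (inord t, j) | j <- s] ++ gate_list n d t)).
  apply: IHs; first by move=> j js; apply: pt; rewrite inE js orbT.
  split; last by case/andP: us.
  by move=> q qs; apply: sub; rewrite /= inE qs orbT.
exact: (@weight_cons (inord t, i)).
Qed.

End SecondMoment.

Section EmbedUnitary.
Context (R : realType) (n : nat) (i j : 'I_n).
Hypothesis neq_ij : i != j.
Local Notation C := R[i].

Lemma embedM (u v : 'M[C]_4) : embed i j u *m embed i j v = embed i j (u *m v).
Proof.
apply/matrixP => x y; rewrite embed_mulmx // !mxE mulr_suml; apply: eq_bigr => c _.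
rewrite mxE !unbitsK set2l set2r // enc_hilo mulrA; congr (_ * _).
by apply: eq_bigr => m /andP[mi mj]; rewrite set2o.
Qed.

Lemma embed1 : embed i j 1%:M = 1%:M :> 'M[C]_(2 ^ n).
Proof.
apply/matrixP => x y; rewrite !mxE eq_hilo !hi_enc !lo_enc -eq_bits.
rewrite prod_natb -natrM mulnb; congr (nat_of_bool _)%:R.
apply/andP/forallP => [[/andP[/= xi xj] /forallP H] m|H].
  have [->//|mi] := eqVneq m i; have [->//|mj] := eqVneq m j.
  by have := H m; rewrite mi mj.
by split; [rewrite /= !H | apply/forallP => m; rewrite H implybT].
Qed.

Lemma embed_unitary (u : 'M[C]_4) : u \is unitarymx -> embed i j u \is unitarymx.
Proof. by move=> /unitarymxP uu; apply/unitarymxP; rewrite embed_adj embedM uu embed1. Qed.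

End EmbedUnitary.

(** * Variance of an expectation value over the circuits *)

Section Variance.
Context (R : realType) (n d : nat) (dO : measure_display).
Context (Omega : measurableType dO) (P : probability Omega R).
Context (haar : probability (mxspace R 4) R).
Context (g : 'I_d.+2 * 'I_n -> Omega -> mxspace R 4).
Hypothesis n_gt1 : (1 < n)%N.
Hypothesis haarP : haar_measure haar.
Hypothesis gP : RQC_gates P haar g.
Local Notation C := R[i].
Local Notation pauliT := {ffun 'I_n -> bool * bool}.

Definition circuit_of (w : Omega) : 'M[C]_(2 ^ n) := circuit (fun p => g p w : 'M[C]_4).

Lemma circuit_unitary w : circuit_of w \is unitarymx.
Proof.
rewrite /circuit_of circuit_gate_list.
have : {subset gate_list n d.+1 d.+2 <= bricks n d.+2}.
  by move=> p; rewrite mem_gate_list // bricksE => /andP[].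
elim: (gate_list _ _ _) => [_|p s IH sub] /=.
  by apply/unitarymxP; rewrite trmx1 map_mx1 mulmx1.
rewrite mul_unitarymx //; last by apply: IH => q qs; apply: sub; rewrite inE qs orbT.
have pb : p \in bricks n d.+2 by rewrite sub // mem_head.
apply: embed_unitary; last by have [_ + _ _] := gP; apply.
by move: pb; rewrite bricksE => /brick_neq.
Qed.

Lemma mxmeas_circuit : mxmeas circuit_of.
Proof.
rewrite /circuit_of; under eq_fun => w do rewrite circuit_gate_list.
have : {subset gate_list n d.+1 d.+2 <= bricks n d.+2}.
  by move=> p; rewrite mem_gate_list // bricksE => /andP[].
elim: (gate_list _ _ _) => [_|p s IH sub] /=; first exact: mxmeas_cst.
apply: mxmeasM; last by apply: IH => q qs; apply: sub; rewrite inE qs orbT.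
have pb : p \in bricks n d.+2 by rewrite sub // mem_head.
have [mg _ _ _] := gP; have /mxmeasP mgp := mg p pb.
move=> x y; under eq_fun => w do rewrite mxE.
by apply: cmeasM; [exact: mgp | exact: cmeas_cst].
Qed.

Context (rho : 'M[C]_(2 ^ n)).
Hypothesis rho_density : density rho.

Lemma pauli_coef0 (X : 'M[C]_(2 ^ n)) : pauli_coef X [ffun=> idp] = complex.Re (\tr X).
Proof. by rewrite /pauli_coef /idp pauli0 mul1mx. Qed.

Let T (k : pauliT) (w : Omega) : R :=
  pauli_coef (circuit_of w *m rho *m (circuit_of w)^t*) k.

Let T_evolve k w : T k w = pauli_coef (evolve g rho (gate_list n d.+1 d.+2) w) k.
Proof. by rewrite /T /evolve /circuit_of circuit_gate_list. Qed.

Lemma T0 w : T [ffun=> idp] w = 1.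
Proof.
rewrite /T pauli_coef0 mxtrace_mulC mulmxA.
have -> : (circuit_of w)^t* *m circuit_of w = 1%:M.
  by have := circuit_unitary w; rewrite -trmxC_unitary => /unitarymxP; rewrite trmxCK.
by rewrite mul1mx rho_density.2.
Qed.

Lemma weight_circuit :
  (forall k k', k != k' -> mean P (fun w => T k w * T k' w) = 0) /\
  (forall k, k != [ffun=> idp] ->
     mean P (fun w => T k w * T k w) <= (2 ^+ n)^-1 + 2 * (4 / 5) ^+ d.+1).
Proof.
have wT k k' : mean P (fun w => T k w * T k' w) =
    weight P g rho (gate_list n d.+1 d.+2) k k'.
  by apply: eq_mean => w; rewrite !T_evolve.
have w0 : weight P g rho [::] = fun k k' => pauli_coef rho k * pauli_coef rho k'.
  apply/funext => k; apply/funext => k'; rewrite /weight /evolve /=.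
  by rewrite trmx1 map_mx1 mul1mx mulmx1 mean_cst.
have [h1 h2] : (forall k k', k != k' -> weight P g rho (gate_list n d.+1 d.+2) k k' = 0) /\
    (forall k, k != [ffun=> idp] -> weight P g rho (gate_list n d.+1 d.+2) k k <=
      (2 ^+ n)^-1 + 2 * (4 / 5) ^+ d.+1).
  apply: (weight_bound n_gt1 (brickwork_weight haarP gP rho (leqnn _))); rewrite w0.
  - by move=> B; exact: purity_density.
  - by move=> k; rewrite -expr2 sqr_ge0.
  - by rewrite pauli_coef0 rho_density.2 mulr1.
by split=> [k k' kk'|k kn]; rewrite wT; [exact: h1 | exact: h2].
Qed.

Lemma bmf_pauli_coef k : bmf (T k).
Proof.
rewrite (_ : T k = fun w => pauli_coef (evolve g rho (gate_list n d.+1 d.+2) w) k).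
  apply: (bmf_evolved_coef gP) => p; by rewrite mem_gate_list // bricksE => /andP[].
by apply/funext => w; rewrite T_evolve.
Qed.

Context (O : 'M[C]_(2 ^ n)).
Hypothesis O_herm : O^t* = O.
Hypothesis O_frobenius : \sum_a \sum_b `|O a b| ^+ 2 <= (2 ^ n)%:R.

Definition deviation (w : Omega) : R :=
  expectation_value (unitary_channel (circuit_of w)) O rho - complex.Re (\tr O) / 2 ^+ n.

Let N0 : (2 : R) ^+ n != 0.
Proof. by rewrite expf_neq0 // pnatr_eq0. Qed.

Let o k : R := pauli_coef O k / 2 ^+ n.

Lemma herm_coef k : \tr (pauli R k *m O) = ((pauli_coef O k)%:C)%C.
Proof.
have [pH _ _] := pauli_pauli R n.
by rewrite /pauli_coef trmx_herm_real.
Qed.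

(** Parseval's identity. Only the Frobenius norm of O enters, so the bound covers both the learner's
    observables and the output state of the hypothesis used as a test. *)
Lemma coef_frobenius : \sum_k o k ^+ 2 <= 1.
Proof.
have N1 : ((2 ^ n)%:R : C) != 0 by rewrite pnatr_eq0 expn_eq0.
have e : ((\sum_k o k ^+ 2)%:C)%C = (\sum_a \sum_b `|O a b| ^+ 2) / (2 ^ n)%:R.
  have -> : \sum_a \sum_b `|O a b| ^+ 2 = \tr (O *m O).
    rewrite mxtrace_mulE; apply: eq_bigr => a _; apply: eq_bigr => b _.
    by rewrite normCK -{2}O_herm !mxE conjCK.
  rewrite (pauli_parseval _ (pauli_pauli R n)) ?expn_gt0 // rmorph_sum -mulrA mulr_suml.
  apply: eq_bigr => k _; rewrite /= !herm_coef /o rmorphXn /= rmorphM fmorphV rmorphXn /= rmorph_nat.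
  by rewrite natrX; field; rewrite expf_neq0 // pnatr_eq0.
by rewrite -lecR e rmorph1 ler_pdivrMr ?mul1r // ltr0n expn_gt0.
Qed.

(** The evolved state has trace 1, so the term of the identity string is exactly the reference value
    Tr(O) / 2^n. *)
Lemma deviationE w : deviation w = \sum_(k | k != [ffun=> idp]) o k * T k w.
Proof.
rewrite /deviation /expectation_value /unitary_channel.
have -> : complex.Re (\tr (O *m (circuit_of w *m rho *m (circuit_of w)^t*))) =
    \sum_k o k * T k w.
  rewrite {1}(pauli_expand _ (pauli_pauli R n) O) ?expn_gt0 // mulmx_suml [\tr _]raddf_sum raddf_sum /=.
  apply: eq_bigr => k _; rewrite -scalemxAl mxtraceZ herm_coef.
  have -> : ((pauli_coef O k)%:C)%C / (2 ^ n)%:R = ((o k)%:C)%C.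
    by rewrite /o rmorphM fmorphV rmorphXn /= rmorph_nat natrX.
  by rewrite Re_realM.
rewrite (bigD1 [ffun=> idp]) //= T0 mulr1 /o pauli_coef0.
by rewrite addrC addrK.
Qed.

Lemma bmf_deviation : bmf deviation.
Proof.
rewrite (funext deviationE).
by apply: bmf_sum => k _; apply: bmfZ; exact: bmf_pauli_coef.
Qed.

(** Different strings are uncorrelated, so only second moments remain, with weights [o k ^+ 2] of
    total at most 1. *)
Lemma variance_bound : mean P (fun w => deviation w ^+ 2) <=
  (2 ^+ n)^-1 + 2 * (4 / 5) ^+ d.+1.
Proof.
have [h1 h2] := weight_circuit; set e := _ + _ in h2 *.
have bTT k k' : bmf (fun w => T k w * T k' w) by apply: bmfM; exact: bmf_pauli_coef.
have -> : mean P (fun w => deviation w ^+ 2) =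
    \sum_(k | k != [ffun=> idp]) o k ^+ 2 * mean P (fun w => T k w * T k w).
  rewrite (@eq_mean _ _ _ P _ (fun w => \sum_(k | k != [ffun=> idp])
    \sum_(k' | k' != [ffun=> idp]) o k * o k' * (T k w * T k' w))); last first.
    move=> w; rewrite deviationE expr2 big_distrlr /=.
    by apply: eq_bigr => k _; apply: eq_bigr => k' _; rewrite mulrACA.
  rewrite mean_sum; last by move=> k _; apply: bmf_sum => k' _; exact: bmfZ.
  apply: eq_bigr => k kn; rewrite mean_sum; last by move=> k' _; exact: bmfZ.
  rewrite (bigD1 k) //= meanZ // big1 ?addr0 // => k' /andP[_ kk'].
  by rewrite meanZ // h1 ?mulr0 // eq_sym.
apply: le_trans (_ : \sum_(k | k != [ffun=> idp]) o k ^+ 2 * e <= _).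
  by apply: ler_sum => k kn; rewrite ler_wpM2l ?sqr_ge0 // h2.
rewrite -mulr_suml -[X in _ <= X]mul1r ler_wpM2r //.
  by rewrite addr_ge0 ?invr_ge0 ?exprn_ge0 // mulr_ge0 ?exprn_ge0 // divr_ge0.
apply: le_trans coef_frobenius.
by rewrite [X in _ <= X](bigD1 [ffun=> idp]) //= lerDr sqr_ge0.
Qed.

Lemma measurable_deviation (tau : R) : measurable [set w | tau <= `|deviation w|].
Proof.
have [md _] := bmf_deviation.
rewrite (_ : [set w | _] = (fun w => `|deviation w|) @^-1` [set` `[tau, +oo[%R]).
  rewrite -[X in measurable X]setTI.
  have : measurable_fun setT (fun w => `|deviation w|) by exact: measurableT_comp.
  by apply => //; exact: measurable_itv.
by apply/seteqP; split => w /=; rewrite in_itv /= andbT.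
Qed.

Lemma deviation_prob (tau : R) : 0 < tau ->
  (P [set w | (tau <= `|deviation w|)%R] <=
   (((2 ^+ n)^-1 + 2 * (4 / 5) ^+ d.+1) / tau ^+ 2)%:E)%E.
Proof.
move=> t0; have mE := measurable_deviation tau.
rewrite -mean_indic // lee_fin ler_pdivlMr ?exprn_gt0 //.
apply: le_trans variance_bound; rewrite mulrC -meanZ; last exact: bmf_indic.
apply: le_mean.
- by apply: bmfZ; exact: bmf_indic.
- under eq_fun => w do rewrite expr2.
  by apply: bmfM; exact: bmf_deviation.
move=> w; rewrite indicE; case: (boolP (w \in _)) => [|_]; last by rewrite mulr0 sqr_ge0.
rewrite inE /= mulr1 => h; rewrite -[X in _ <= X]real_normK ?num_real //.
by rewrite ler_pXn2r ?nnegrE // ltW.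
Qed.

End Variance.

(** * Norms of matrices and channels *)

Section Norms.
Context (R : realType).
Local Notation C := R[i].

Lemma vec_normE N (v : 'cV[C]_N) : ((vec_norm v ^+ 2)%:C)%C = \sum_i `|v i 0| ^+ 2.
Proof.
rewrite sqr_sqrtr; last by apply: sumr_ge0 => i _; rewrite addr_ge0 ?sqr_ge0.
by rewrite rmorph_sum; apply: eq_bigr => i _; rewrite /= add_Re2_Im2.
Qed.

Lemma vec_norm_ge0 N (v : 'cV[C]_N) : 0 <= vec_norm v.
Proof. exact: sqrtr_ge0. Qed.

Lemma vec_norm_le N (v : 'cV[C]_N) (K : R) : 0 <= K ->
  \sum_i `|v i 0| ^+ 2 <= ((K ^+ 2)%:C)%C -> vec_norm v <= K.
Proof.
move=> K0; rewrite -vec_normE lecR => h.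
by rewrite -(@ler_pXn2r _ 2) ?nnegrE ?vec_norm_ge0.
Qed.

Lemma normc_real (z : C) : ((complex.Re `|z|)%:C)%C = `|z|.
Proof. by apply: RRe_real; rewrite normr_real. Qed.

Lemma vec_norm_entry N (v : 'cV[C]_N) k : vec_norm v = 1 -> `|v k 0| <= 1.
Proof.
move=> v1; rewrite -(@expr_le1 _ 2) //.
have := vec_normE v; rewrite v1 expr1n rmorph1 => ->.
by rewrite (bigD1 k) //= lerDl sumr_ge0 // => i _; rewrite exprn_ge0.
Qed.

(** [sup] has a default value on unbounded sets, so boundedness must be known before [op_norm]
    bounds anything. *)
Lemma op_norm_ubound N (A : 'M[C]_N) : has_ubound
  [set vec_norm (A *m v) | v in [set v : 'cV[C]_N | vec_norm v = 1]].
Proof.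
pose S i := \sum_j complex.Re `|A i j|.
have S0 i : 0 <= S i.
  by apply: sumr_ge0 => j _; rewrite -ler0c normc_real normr_ge0.
(* The entries of a unit vector have modulus at most 1, so the row sums S bound the image; the
   summand 1 ensures K <= K^2. *)
pose K := 1 + \sum_i S i ^+ 2.
have K1 : 1 <= K by rewrite lerDl sumr_ge0 // => i _; rewrite sqr_ge0.
exists K => _ [v v1 <-]; apply: vec_norm_le; first by rewrite (le_trans _ K1).
apply: le_trans (_ : ((\sum_i S i ^+ 2)%:C)%C <= _); last first.
  rewrite lecR; apply: le_trans (_ : K <= _); first by rewrite lerDr.
  by rewrite expr2 ler_peMl // (le_trans _ K1).
rewrite rmorph_sum; apply: ler_sum => i _; rewrite /= rmorphXn /=.
rewrite ler_pXn2r ?nnegrE ?normr_ge0 //; last by rewrite ler0c.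
rewrite mxE rmorph_sum; apply: le_trans (ler_norm_sum _ _ _) _.
apply: ler_sum => j _; rewrite /= normc_real normrM ler_piMr //.
exact: vec_norm_entry.
Qed.

(** Each column is the image of a unit vector, so its norm is at most 1. *)
Lemma observable_frobenius N (A : 'M[C]_N) : observable A ->
  \sum_a \sum_b `|A a b| ^+ 2 <= N%:R.
Proof.
move=> [_ A1]; rewrite exchange_big /=.
apply: le_trans (_ : \sum_(b < N) 1 <= _); last by rewrite sumr_const card_ord.
apply: ler_sum => b _.
have e1 : vec_norm (delta_mx b 0 : 'cV[C]_N) = 1.
  apply/eqP; rewrite -(@eqrXn2 _ 2) ?vec_norm_ge0 //; apply/eqP/complexI.
  rewrite vec_normE (bigD1 b) //= big1 ?addr0; last first.
    by move=> k kb; rewrite mxE (negbTE kb) normr0 expr0n.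
  by rewrite mxE !eqxx normr1 !expr1n.
have h : vec_norm (A *m delta_mx b 0) <= 1.
  apply: le_trans A1; apply: ub_le_sup; first exact: op_norm_ubound.
  by exists (delta_mx b 0).
have -> : \sum_a `|A a b| ^+ 2 = ((vec_norm (A *m delta_mx b 0) ^+ 2)%:C)%C.
  by rewrite vec_normE; apply: eq_bigr => a _; rewrite -colE mxE.
by rewrite -[1]/((1%:C)%C) lecR expr_le1 // vec_norm_ge0.
Qed.

Section TraceNorm.
Context (N : nat) (A : 'M[C]_N).
Let H := A^t* *m A.
Let Q := spectralmx H.

Let H_herm : H^t* = H.
Proof. by rewrite /H adjmxM trmxCK. Qed.

Let Q_unitary : Q \is unitarymx.
Proof. exact: spectral_unitarymx. Qed.

Let H_spectral : H = Q^t* *m diag_mx (spectral_diag H) *m Q.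
Proof.
have /orthomx_spectralP {1}-> : H \is normalmx by apply/normalmxP; rewrite H_herm.
by rewrite invmx_unitary.
Qed.

Let lam i := spectral_diag H 0 i.

Lemma dot_self m (v : 'cV[C]_m) : (v^t* *m v) 0 0 = \sum_i `|v i 0| ^+ 2.
Proof. by rewrite mxE; apply: eq_bigr => i _; rewrite !mxE normCK mulrC. Qed.

Lemma gram_quad (v : 'cV[C]_N) : (v^t* *m H *m v) 0 0 = \sum_i `|(A *m v) i 0| ^+ 2.
Proof. by rewrite -dot_self adjmxM !mulmxA. Qed.

Let lam_ge0 i : 0 <= lam i.
Proof.
pose e : 'cV[C]_N := delta_mx i 0.
have -> : lam i = ((Q^t* *m e)^t* *m H *m (Q^t* *m e)) 0 0.
  have QQ : Q *m Q^t* = 1%:M by exact/unitarymxP.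
  rewrite H_spectral adjmxM trmxCK !mulmxA -(mulmxA _ Q) QQ mulmx1.
  rewrite -(mulmxA _ Q) QQ mulmx1 quad_delta.
  by rewrite mxE eqxx mulr1n.
by rewrite gram_quad sumr_ge0 // => k _; rewrite exprn_ge0.
Qed.

Let s i := singular_value A i.

Let s_ge0 i : 0 <= s i.
Proof. exact: sqrtr_ge0. Qed.

Let lamE i : lam i = ((s i ^+ 2)%:C)%C.
Proof.
have h := lam_ge0 i; rewrite sqr_sqrtr; last by move: h; rewrite lecE => /andP[].
by rewrite [LHS]complexE -/(lam i) (ger0_Im h) rmorph0 mulr0 addr0.
Qed.

Lemma gram_diag (v : 'cV[C]_N) :
  (v^t* *m H *m v) 0 0 = \sum_i lam i * `|(Q *m v) i 0| ^+ 2.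
Proof.
have -> : v^t* *m H *m v = (Q *m v)^t* *m diag_mx (spectral_diag H) *m (Q *m v).
  by rewrite {1}H_spectral adjmxM !mulmxA.
set y := Q *m v; rewrite mxE; apply: eq_bigr => i _; rewrite mul_mx_diag !mxE.
by rewrite normCK -/(lam i) mulrC mulrA mulrC.
Qed.

(** By Cauchy-Schwarz the left side is at most the norm of A v, and no singular value exceeds their
    sum. *)
Lemma trace_norm_quad (v : 'cV[C]_N) : (v^t* *m v) 0 0 = 1 ->
  `|(v^t* *m A *m v) 0 0| <= ((trace_norm A)%:C)%C.
Proof.
move=> v1; have T0 : 0 <= trace_norm A by apply: sumr_ge0 => i _; exact: s_ge0.
rewrite -(@ler_pXn2r _ 2) ?nnegrE ?normr_ge0 ?ler0c //.
apply: le_trans (_ : (v^t* *m H *m v) 0 0 <= _).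
  have := (CauchySchwarz (@dotmx C N) (v^t*) ((A *m v)^t*)).1.
  by rewrite /= !dotmxE !trmxCK v1 mul1r adjmxM !mulmxA.
rewrite gram_diag; apply: le_trans (_ : \sum_i (((trace_norm A) ^+ 2)%:C)%C * `|(Q *m v) i 0| ^+ 2 <= _).
  apply: ler_sum => i _; apply: ler_wpM2r; first by rewrite exprn_ge0.
  rewrite lamE lecR ler_pXn2r ?nnegrE //.
  by rewrite /trace_norm (bigD1 i) //= lerDl sumr_ge0.
rewrite -mulr_sumr -dot_self adjmxM mulmxA -(mulmxA _ _ Q).
have -> : Q^t* *m Q = 1%:M.
  by move: Q_unitary; rewrite -trmxC_unitary => /unitarymxP; rewrite trmxCK.
by rewrite mulmx1 v1 mulr1 rmorphXn.
Qed.

(** A crude bound, from s <= 1 + s^2 for each singular value, that serves to show that the supremum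
    in the diamond norm is finite. *)
Lemma trace_norm_le : ((trace_norm A)%:C)%C <= N%:R + \sum_a \sum_b `|A a b| ^+ 2.
Proof.
have trH : \tr H = \sum_i lam i.
  rewrite H_spectral mxtrace_mulC mulmxA (unitarymxP Q_unitary) mul1mx.
  by rewrite mxtrace_diag.
have -> : \sum_a \sum_b `|A a b| ^+ 2 = \sum_i lam i.
  rewrite -trH mxtrace_mulE exchange_big /=; apply: eq_bigr => a _.
  by apply: eq_bigr => b _; rewrite !mxE normCK mulrC.
have -> : (N%:R : C) = \sum_(i < N) 1 by rewrite sumr_const card_ord.
rewrite -big_split /= rmorph_sum; apply: ler_sum => i _ /=.
rewrite lamE -[1]/((1%:C)%C) -rmorphD lecR -/(s i).
have := sqr_ge0 (s i - 1); nra.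
Qed.

End TraceNorm.
End Norms.

(** * Ampliations and the diamond distance *)

Section Ampliation.
Context (R : realType) (N : nat).
Local Notation C := R[i].

Lemma ampliationE k (E : 'M[C]_N -> 'M[C]_N) (X : 'M[C]_(N * k)) a b (i j : 'I_k) :
  ampliation E X (mxtens.mxtens_index (a, i)) (mxtens.mxtens_index (b, j)) =
  E (\matrix_(c, e) X (mxtens.mxtens_index (c, i)) (mxtens.mxtens_index (e, j))) a b.
Proof.
rewrite /ampliation summxE (bigD1 i) //= summxE (bigD1 j) //= mxtens.tensmxE mxE !eqxx mulr1.
rewrite big1 ?addr0; last first.
  by move=> j' jj'; rewrite mxtens.tensmxE mxE eqxx eq_sym (negbTE jj') mulr0.
rewrite big1 ?addr0 // => i' ii'; rewrite summxE big1 // => j' _.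
by rewrite mxtens.tensmxE mxE eq_sym (negbTE ii') mulr0.
Qed.

Lemma big_mxtens k (V : zmodType) (F : 'I_(N * k) -> V) :
  \sum_p F p = \sum_a \sum_i F (mxtens.mxtens_index (a, i)).
Proof.
rewrite pair_bigA /= (reindex (@mxtens.mxtens_index N k)) /=.
  by apply: eq_bigr => -[a i] _.
exists (@mxtens.mxtens_unindex N k) => p _.
  exact: mxtens.mxtens_indexK.
exact: mxtens.mxtens_unindexK.
Qed.

Context (x0 : 'I_N).

Definition pure0 : 'M[C]_N := delta_mx x0 x0.

Lemma density_pure m (y : 'I_m) : density (delta_mx y y : 'M[C]_m).
Proof.
split.
  split; first by rewrite trmx_delta map_delta_mx.
  move=> v; have -> : delta_mx y y = (delta_mx y 0 : 'cV[C]_m) *m (delta_mx y 0 : 'cV[C]_m)^t*.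
    by rewrite trmx_delta map_delta_mx mul_delta_mx.
  rewrite mulmxA -(mulmxA _ _ v).
  have -> : (delta_mx y 0 : 'cV[C]_m)^t* *m v = (v^t* *m (delta_mx y 0 : 'cV[C]_m))^t*.
    by rewrite adjmxM trmxCK.
  by rewrite mxE big_ord1 !mxE mul_conjC_ge0.
rewrite /mxtrace (bigD1 y) //= mxE !eqxx big1 ?addr0 // => k ky.
by rewrite mxE (negbTE ky).
Qed.

(** The ancilla starts in the basis state x0 too, so the ampliation returns [E pure0] tensored with
    a fixed pure state. *)
Let X0 : 'M[C]_(N * N) := delta_mx (mxtens.mxtens_index (x0, x0)) (mxtens.mxtens_index (x0, x0)).

Lemma mxtens_index_eq (a b : 'I_N) (i j : 'I_N) :
  (mxtens.mxtens_index (a, i) == mxtens.mxtens_index (b, j)) = (a == b) && (i == j).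
Proof.
by rewrite (can_eq (@mxtens.mxtens_indexK N N)) xpair_eqE.
Qed.

Lemma ampliation_pure (E : 'M[C]_N -> 'M[C]_N) a b i j : E 0 = 0 ->
  ampliation E X0 (mxtens.mxtens_index (a, i)) (mxtens.mxtens_index (b, j)) =
  E pure0 a b * ((i == x0) && (j == x0))%:R.
Proof.
move=> E0; rewrite ampliationE; case: (boolP (_ && _)) => [/andP[/eqP -> /eqP ->]|ne].
  rewrite mulr1; congr (E _ a b); apply/matrixP => c e.
  by rewrite !mxE !mxtens_index_eq !eqxx !andbT.
rewrite mulr0 (_ : \matrix_(_, _) _ = 0) ?E0 ?mxE //.
apply/matrixP => c e; rewrite !mxE !mxtens_index_eq.
by rewrite andbACA andbC (negbTE ne).
Qed.

(** The vector v tensored with the basis vector x0 of the ancilla. *)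
Definition lift0 (v : 'cV[C]_N) : 'cV[C]_(N * N) :=
  \col_p (v (mxtens.mxtens_unindex p).1 0 * ((mxtens.mxtens_unindex p).2 == x0)%:R).

Lemma lift0E v a i : lift0 v (mxtens.mxtens_index (a, i)) 0 = v a 0 * (i == x0)%:R.
Proof. by rewrite mxE mxtens.mxtens_indexK. Qed.

Lemma quadE m (A : 'M[C]_m) (v : 'cV[C]_m) :
  (v^t* *m A *m v) 0 0 = \sum_a \sum_b (v a 0)^* * A a b * v b 0.
Proof.
rewrite mxE exchange_big; apply: eq_bigr => b _; rewrite mxE mulr_suml.
by apply: eq_bigr => a _; rewrite !mxE.
Qed.

Lemma quad_lift0 (E : 'M[C]_N -> 'M[C]_N) v : E 0 = 0 ->
  ((lift0 v)^t* *m ampliation E X0 *m lift0 v) 0 0 = (v^t* *m E pure0 *m v) 0 0.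
Proof.
move=> E0; rewrite !quadE big_mxtens; apply: eq_bigr => a _.
rewrite (bigD1 x0) //= [X in _ + X]big1 ?addr0; last first.
  move=> i ix; rewrite big_mxtens big1 // => b _; rewrite big1 // => j _.
  by rewrite ampliation_pure // (negbTE ix) mulr0 mulr0 mul0r.
rewrite big_mxtens; apply: eq_bigr => b _.
rewrite (bigD1 x0) //= [X in _ + X]big1 ?addr0; last first.
  move=> j jx; by rewrite ampliation_pure // (negbTE jx) andbF mulr0 mulr0 mul0r.
by rewrite ampliation_pure // !lift0E !eqxx !mulr1.
Qed.

Lemma dot_lift0 v : ((lift0 v)^t* *m lift0 v) 0 0 = (v^t* *m v) 0 0.
Proof.
rewrite !dot_self big_mxtens; apply: eq_bigr => a _.
rewrite (bigD1 x0) //= lift0E eqxx mulr1 big1 ?addr0 // => i ix.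
by rewrite lift0E (negbTE ix) mulr0 normr0 expr0n.
Qed.

(** Complete positivity is applied to [X0], whose image has the quadratic form of [E pure0] on the
    vectors [lift0 v]. *)
Lemma channel_pure (E : 'M[C]_N -> 'M[C]_N) : channel E -> density (E pure0).
Proof.
move=> [lE cpE tE]; have E0 : E 0 = 0.
  by have := lE (-1) 0 0; rewrite scaler0 addr0 scaleN1r addNr.
have [psdX _] := density_pure (mxtens.mxtens_index (x0, x0)).
have [hE qE] := cpE N _ psdX.
split; last by rewrite tE; have [] := density_pure x0.
split; last by move=> v; rewrite -quad_lift0.
apply/matrixP => a b.
have /matrixP/(_ (mxtens.mxtens_index (a, x0)) (mxtens.mxtens_index (b, x0))) := hE.
by rewrite !mxE !ampliation_pure // !eqxx !mulr1.
Qed.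

Lemma density_entry m (X : 'M[C]_m) a b : density X -> `|X a b| <= 1.
Proof.
move=> /density_frobenius h; rewrite -(@expr_le1 _ 2) //; apply: le_trans h.
rewrite (bigD1 a) //= (bigD1 b) //= -addrA lerDl.
apply: addr_ge0; apply: sumr_ge0 => k _; first exact: exprn_ge0.
by apply: sumr_ge0 => l _; exact: exprn_ge0.
Qed.

(** Density matrices have entries of modulus at most 1, so by linearity the entries of the
    ampliation are bounded by K. *)
Lemma diamond_ubound (E : 'M[C]_N -> 'M[C]_N) : linear E ->
  has_ubound [set trace_norm (ampliation E rho) |
    rho in [set rho : 'M[C]_(N * N) | density rho]].
Proof.
move=> lE.
pose K : R := \sum_(c < N) \sum_(e < N) \sum_(a < N) \sum_(b < N)
  complex.Re `|E (delta_mx c e) a b|.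
have E0 : E 0 = 0.
  by have := lE (-1) 0 0; rewrite scaler0 addr0 scaleN1r addNr.
have EZ c Y : E (c *: Y) = c *: E Y by have := lE c Y 0; rewrite E0 !addr0.
have ED Y Z : E (Y + Z) = E Y + E Z by have := lE 1 Y Z; rewrite !scale1r.
have Esum (I : finType) (F : I -> 'M[C]_N) : E (\sum_k F k) = \sum_k E (F k).
  exact: (big_morph E ED E0).
have Re0 (z : C) : 0 <= complex.Re `|z| by rewrite -ler0c normc_real normr_ge0.
have bound (Y : 'M[C]_N) a b : (forall c e, `|Y c e| <= 1) -> `|E Y a b| <= (K%:C)%C.
  move=> Y1; rewrite {1}(matrix_sum_delta Y) Esum summxE.
  apply: le_trans (ler_norm_sum _ _ _) _; rewrite rmorph_sum; apply: ler_sum => c _.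
  rewrite Esum summxE; apply: le_trans (ler_norm_sum _ _ _) _.
  rewrite /= rmorph_sum; apply: ler_sum => e _; rewrite EZ mxE normrM /=.
  apply: le_trans (_ : `|E (delta_mx c e) a b| <= _).
    by rewrite ler_piMl // Y1.
  rewrite -normc_real lecR (bigD1 a) //= (bigD1 b) //= -addrA lerDl.
  apply: addr_ge0; apply: sumr_ge0 => k _; first exact: Re0.
  by apply: sumr_ge0 => l _; exact: Re0.
exists ((N * N)%:R + \sum_(p < N * N) \sum_(q < N * N) K ^+ 2) => _ [rho drho <-].
rewrite -lecR; apply: le_trans (trace_norm_le _) _.
rewrite rmorphD /= rmorph_nat lerD2l rmorph_sum; apply: ler_sum => p _.
rewrite /= rmorph_sum; apply: ler_sum => q _ /=.
rewrite rmorphXn /= ler_pXn2r ?nnegrE ?normr_ge0 //; last first.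
  by rewrite ler0c; do 4!(apply: sumr_ge0 => ? _).
rewrite -(mxtens.mxtens_unindexK p) -(mxtens.mxtens_unindexK q).
case: (mxtens.mxtens_unindex p) => a i'; case: (mxtens.mxtens_unindex q) => b j'.
rewrite ampliationE; apply: bound => c e; rewrite mxE; exact: density_entry.
Qed.

(** The diamond norm is bounded below by the input [X0] and the test vector [lift0 v]; the factor 2
    undoes the half in [diamond_dist]. *)
Lemma diamond_dist_quad (E1 E2 : 'M[C]_N -> 'M[C]_N) (eps : R) (v : 'cV[C]_N) :
  linear E1 -> linear E2 -> diamond_dist E1 E2 <= eps -> (v^t* *m v) 0 0 = 1 ->
  `|(v^t* *m (E1 pure0 - E2 pure0) *m v) 0 0| <= ((2 * eps)%:C)%C.
Proof.
move=> l1 l2; rewrite /diamond_dist ler_pdivrMr // => h v1.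
pose E X := E1 X - E2 X.
have lE : linear E.
  by move=> c Y Z; rewrite /E l1 l2 scalerBr opprD !addrA; congr (_ + _); rewrite addrAC.
have E0 : E 0 = 0.
  by have := lE (-1) 0 0; rewrite scaler0 addr0 scaleN1r addNr.
rewrite -/(E pure0) -quad_lift0 //.
have v1' : ((lift0 v)^t* *m lift0 v) 0 0 = 1 by rewrite dot_lift0.
apply: le_trans (trace_norm_quad _ v1') _; rewrite lecR mulrC.
apply: le_trans h; rewrite /diamond_norm; apply: ub_le_sup; first exact: diamond_ubound.
by exists X0 => //; exact: density_pure.
Qed.

End Ampliation.

Section CloseToUnitary.
Context (R : realType) (n : nat).
Local Notation C := R[i].
Local Notation N := (2 ^ n)%N.

(** For v = U e_0, the expectation value is the quadratic form of E(|0><0|) at v. The true output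
    |v><v| would give 1, so closeness leaves at least 1 - 2 eps, and E(|0><0|) has trace 1. *)
Lemma close_deviation (x0 : 'I_N) (E : 'M[C]_N -> 'M[C]_N) (U : 'M[C]_N) (eps : R) :
  channel E -> U \is unitarymx -> diamond_dist E (unitary_channel U) <= eps ->
  1 - 2 * eps - (2 ^+ n)^-1 <=
  expectation_value (unitary_channel U) (E (pure0 R x0)) (pure0 R x0) -
    complex.Re (\tr (E (pure0 R x0))) / 2 ^+ n.
Proof.
move=> chE Uu dE; have [lE _ tE] := chE.
have lU : linear (unitary_channel U).
  by move=> c Y Z; rewrite /unitary_channel mulmxDr mulmxDl -scalemxAr -scalemxAl.
have [v vE] : exists v : 'cV[C]_N, v = U *m delta_mx x0 0 by exists (U *m delta_mx x0 0).
have UU : U^t* *m U = 1%:M.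
  by move: Uu; rewrite -trmxC_unitary => /unitarymxP; rewrite trmxCK.
have v1 : (v^t* *m v) 0 0 = 1.
  rewrite vE adjmxM mulmxA -(mulmxA _ _ U) UU mulmx1 trmx_delta map_delta_mx mul_delta_mx.
  by rewrite mxE !eqxx.
have Uv : unitary_channel U (pure0 R x0) = v *m v^t*.
  rewrite /unitary_channel vE adjmxM trmx_delta map_delta_mx !mulmxA; congr (_ *m _).
  by rewrite -mulmxA mul_delta_mx.
have vv : v^t* *m v = 1%:M.
  by apply/matrixP => a b; rewrite !ord1 v1 mxE eqxx.
have trE : \tr (E (pure0 R x0)) = 1 by rewrite tE; have [] := density_pure R x0.
rewrite /expectation_value Uv trE mulmxA mxtrace_mulC mulmxA /mxtrace big_ord1 mul1r.
have := diamond_dist_quad x0 lE lU dE v1; rewrite Uv mulmxBr mulmxBl.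
rewrite mulmxA vv mul1mx vv; set q := _ *m v => h.
have : `|complex.Re (q 0 0 - 1)| <= 2 * eps.
  rewrite -lecR; apply: le_trans (normc_ge_Re _) _.
  by move: h; rewrite !mxE eqxx.
have -> : complex.Re (q 0 0 - 1) = complex.Re (q 0 0) - 1 by case: (q 0 0).
by rewrite ler_norml => /andP[h1 h2]; lra.
Qed.

End CloseToUnitary.

(** * Reduction of learning to the deviation of an observable *)

Section Deviation.
Context (R : realType) (n : nat).
Local Notation C := R[i].
Local Notation N := (2 ^ n)%N.

Definition ref_answer (x : query R N) : R := complex.Re (\tr (x.1 : 'M[C]_N)) / 2 ^+ n.

Definition true_answer (U : 'M[C]_N) (x : query R N) : R :=
  expectation_value (unitary_channel U) (x.1 : 'M[C]_N) (x.2 : 'M[C]_N).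

Definition revealing (tau : R) (U : 'M[C]_N) (x : query R N) : bool :=
  tau <= `|true_answer U x - ref_answer x|.

Definition lazy_oracle (tau : R) (U : 'M[C]_N) (h : seq (query R N)) (x : query R N) : R :=
  if revealing tau U x then true_answer U x else ref_answer x.

Lemma measurable_ref_answer : measurable_fun setT ref_answer.
Proof.
apply: measurable_funM => //.
have [+ _] : cmeas (fun x : query R N => \tr (x.1 : 'M[C]_N)).
  by apply: cmeas_tr; apply/mxmeasP; exact: measurable_fst.
by [].
Qed.

Lemma measurable_true_answer d (T : measurableType d) (U : T -> 'M[C]_N)
    (x : T -> query R N) : mxmeas U -> measurable_fun setT x ->
  measurable_fun setT (fun t => true_answer (U t) (x t)).
Proof.
move=> mU mx.
have m1 : mxmeas (fun t => (x t).1 : 'M[C]_N).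
  by apply/mxmeasP; exact: (measurableT_comp measurable_fst mx).
have m2 : mxmeas (fun t => (x t).2 : 'M[C]_N).
  by apply/mxmeasP; exact: (measurableT_comp measurable_snd mx).
have [+ _] : cmeas (fun t => \tr ((x t).1 *m (U t *m (x t).2 *m (U t)^t*))).
  by apply: cmeas_tr; do 3?[apply: mxmeasM => //]; exact: mxmeas_adj.
by [].
Qed.

Lemma measurable_revealing d (T : measurableType d) (tau : R) (U : T -> 'M[C]_N)
    (x : T -> query R N) : mxmeas U -> measurable_fun setT x ->
  measurable_fun setT (fun t => revealing tau (U t) (x t)).
Proof.
move=> mU mx; apply: measurable_fun_ler => //.
apply: (@measurableT_comp _ _ _ _ _ _ (fun r : R => `|r|)) => //.
apply: measurable_funB; first exact: measurable_true_answer.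
exact: (measurableT_comp measurable_ref_answer mx).
Qed.

Lemma lazy_oracle_valid (tau : R) (U : 'M[C]_N) : 0 < tau ->
  QPStat (unitary_channel U) tau (lazy_oracle tau U).
Proof.
move=> t0; split=> [h O rho _ _|k].
  rewrite /lazy_oracle /revealing; case: ifPn => [_|]; first by rewrite subrr normr0 ltW.
  by rewrite -ltNge distrC => /ltW.
have mx : measurable_fun setT (fun p : k.-tuple (query R N) * query R N => p.2).
  exact: measurable_snd.
apply: measurable_fun_ifT.
- by apply: measurable_revealing => //; exact: mxmeas_cst.
- by apply: measurable_true_answer => //; exact: mxmeas_cst.
- exact: (measurableT_comp measurable_ref_answer mx).
Qed.

End Deviation.

Section Reference.
Context (R : realType) (n q : nat) (dS : measure_display) (S : measurableType dS).
Context (A : learner R S (2 ^ n) q).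
Local Notation C := R[i].
Local Notation N := (2 ^ n)%N.

Definition ref_oracle (h : seq (query R N)) (x : query R N) : R := ref_answer x.

Definition ref_query (j : nat) (s : S) : query R N :=
  ask A s (unzip2 (transcript (ask A s) ref_oracle j)).

(** A tuple, since the measurability of the learner is stated on [k.-tuple R]. *)
Definition ref_tuple (k : nat) (s : S) : k.-tuple R :=
  [tuple ref_answer (ref_query i s) | i < k].

Lemma ref_transcript k s :
  unzip2 (transcript (ask A s) ref_oracle k) = ref_tuple k s.
Proof.
have -> : ref_tuple k s = [seq ref_answer (ref_query j s) | j <- iota 0 k] :> seq R.
  by rewrite -val_enum_ord -map_comp.
elim: k => [//|k IH].
have -> : iota 0 k.+1 = rcons (iota 0 k) k by rewrite -addn1 iotaD cats1.
by rewrite map_rcons -IH /unzip2 /= map_rcons.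
Qed.

Lemma ref_queryE j s : ref_query j s = ask A s (ref_tuple j s).
Proof. by rewrite /ref_query ref_transcript. Qed.

Lemma measurable_ref_tuple k :
  (forall i, (i < k)%N -> measurable_fun setT (ref_query i)) ->
  measurable_fun setT (ref_tuple k).
Proof.
move=> mq; apply/measurable_fun_tnthP => i.
rewrite (_ : _ \o _ = fun s => ref_answer (ref_query i s)).
  exact: (measurableT_comp (@measurable_ref_answer R n) (mq i (ltn_ord i))).
by apply/funext => s /=; rewrite tnth_mktuple.
Qed.

(** Strong induction: query j is a function of the seed and of the answers to the earlier
    queries. *)
Lemma measurable_ref_query j : measurable_fun setT (ref_query j).
Proof.
elim/ltn_ind: j => j IH; rewrite (funext (ref_queryE j)).
have mt := measurable_ref_tuple IH.
have mp : measurable_fun setT (fun s => (s, ref_tuple j s)).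
  exact: measurable_fun_pair.
apply: (@measurableT_comp _ _ _ _ _ _ (fun p : S * j.-tuple R => ask A p.1 p.2) _
  (fun s => (s, ref_tuple j s))) => //.
exact: ask_measurable.
Qed.

Definition ref_guess (s : S) : 'M[C]_N -> 'M[C]_N := guess A s (ref_tuple q s).

Lemma measurable_ref_guess X : measurable_fun setT (fun s => ref_guess s X : mxspace R N).
Proof.
have mt := measurable_ref_tuple (fun i (_ : (i < q)%N) => measurable_ref_query i).
have mp : measurable_fun setT (fun s => (s, ref_tuple q s)).
  exact: measurable_fun_pair.
apply: (@measurableT_comp _ _ _ _ _ _
  (fun p : S * q.-tuple R => guess A p.1 p.2 X : mxspace R N) _
  (fun s => (s, ref_tuple q s))) => //.
exact: guess_measurable.
Qed.

Lemma lazy_transcript tau U k s :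
  (forall j, (j < k)%N -> ~~ revealing tau U (ref_query j s)) ->
  transcript (ask A s) (lazy_oracle tau U) k = transcript (ask A s) ref_oracle k.
Proof.
elim: k => [//|k IH] H /=; rewrite IH; last by move=> j jk; apply: H; exact: ltnW.
by rewrite /lazy_oracle (negbTE (H k (ltnSn k))).
Qed.

(* Query number q tests the hypothesis itself on |0><0|, with the output state of
   the hypothesis as observable. *)
Definition test_query (x0 : 'I_N) (j : nat) (s : S) : query R N :=
  if (j < q)%N then ref_query j s else (ref_guess s (pure0 R x0), pure0 R x0).

Lemma measurable_test_query x0 j : measurable_fun setT (test_query x0 j).
Proof.
rewrite /test_query; case: (j < q)%N; first exact: measurable_ref_query.
by apply: measurable_fun_pair => //; exact: measurable_ref_guess.
Qed.

Lemma test_query_density x0 j s : density ((test_query x0 j s).2 : 'M[C]_N).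
Proof.
by rewrite /test_query; case: ifP => _; [exact: ask_density | exact: density_pure].
Qed.

Lemma test_query_herm x0 j s :
  ((test_query x0 j s).1 : 'M[C]_N)^t* = ((test_query x0 j s).1 : 'M[C]_N).
Proof.
rewrite /test_query; case: ifP => _.
  by case: (ask_observable A s (unzip2 (transcript (ask A s) ref_oracle j))).
by have [[h _] _] := channel_pure x0 (guess_channel A s (ref_tuple q s)).
Qed.

Lemma test_query_frobenius x0 j s :
  \sum_a \sum_b `|((test_query x0 j s).1 : 'M[C]_N) a b| ^+ 2 <= N%:R.
Proof.
rewrite /test_query; case: ifP => _.
  by apply: observable_frobenius; exact: ask_observable.
apply: le_trans (density_frobenius (channel_pure x0 (guess_channel A s (ref_tuple q s)))) _.
by rewrite ler1n expn_gt0.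
Qed.

Lemma lazy_success (x0 : 'I_N) tau eps (U : 'M[C]_N) s : 0 < tau -> tau <= eps ->
  eps <= 1 / 3 * (1 - (2 ^+ n)^-1) -> U \is unitarymx ->
  diamond_dist (output A (lazy_oracle tau U) s) (unitary_channel U) <= eps ->
  exists2 j, (j < q.+1)%N & revealing tau U (test_query x0 j s).
Proof.
move=> t0 te e3 Uu dist; apply: contrapT => nbad.
have ok j : (j < q)%N -> ~~ revealing tau U (ref_query j s).
  move=> jq; apply/negP => b; apply: nbad; exists j; first exact: ltnW.
  by rewrite /test_query jq.
move: dist; rewrite /output (lazy_transcript ok) ref_transcript => dist.
apply: nbad; exists q; first exact: ltnSn.
rewrite /test_query ltnn /revealing /true_answer /ref_answer /=.
(* The bound on eps gives 1 - 2^-n >= 3 eps, so the deviation is at least eps, hence at least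
   tau. *)
have := close_deviation x0 (guess_channel A s (ref_tuple q s)) Uu dist.
set x := _ - _ / _ => h; rewrite (le_trans _ (ler_norm x)) //.
lra.
Qed.

End Reference.

Section Learning.
Context (R : realType) (n d q : nat) (dO : measure_display).
Context (Omega : measurableType dO) (P : probability Omega R).
Context (haar : probability (mxspace R 4) R).
Context (g : 'I_d.+2 * 'I_n -> Omega -> mxspace R 4).
Context (dS : measure_display) (S : measurableType dS) (Q : probability S R).
Context (A : learner R S (2 ^ n) q).
Hypothesis n_gt1 : (1 < n)%N.
Hypothesis haarP : haar_measure haar.
Hypothesis gP : RQC_gates P haar g.
Local Notation C := R[i].
Local Notation N := (2 ^ n)%N.

Lemma learning_bound (tau eps alpha beta : R) : 0 < tau -> tau <= eps ->
  eps <= 1 / 3 * (1 - (2 ^+ n)^-1) -> 0 <= alpha -> 0 <= beta ->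
  prob_ge P [set w | learns Q A tau eps alpha (circuit_of g w)] beta ->
  alpha * beta <= q.+1%:R * (((2 ^+ n)^-1 + 2 * (4 / 5) ^+ d.+1) / tau ^+ 2).
Proof.
move=> t0 te e3 a0 b0 [G [mG GL bG]]; set p := _ / tau ^+ 2.
pose x0 : 'I_N := Ordinal (expn_gt0 2 n).
pose D (j : nat) : set (Omega * S) := [set z | revealing tau (circuit_of g z.1) (test_query A x0 j z.2)].
have mD j : measurable (D j).
  have mb : measurable_fun setT (fun z : Omega * S =>
      revealing tau (circuit_of g z.1) (test_query A x0 j z.2)).
    apply: measurable_revealing.
      move=> a b; apply: (@cmeas_comp R _ _ _ _ fst (fun w => circuit_of g w a b)).
        exact: measurable_fst.
      exact: (mxmeas_circuit gP).
    apply: (@measurableT_comp _ _ _ _ _ _ (test_query A x0 j)) => //.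
    exact: measurable_test_query.
  rewrite (_ : D j = (fun z => revealing tau (circuit_of g z.1) (test_query A x0 j z.2)) @^-1` [set true]) //.
  by rewrite -[X in measurable X]setTI; exact: mb.
(* The event, on pairs of a circuit and a seed, that some test query is revealing. Its product
   measure is estimated by its sections in both directions. *)
pose B : set (Omega * S) := \big[setU/set0]_(j < q.+1) D j.
have mB : measurable B by apply: bigsetU_measurable => j _; exact: mD.
have inB w s : (exists2 j, (j < q.+1)%N & revealing tau (circuit_of g w) (test_query A x0 j s)) -> B (w, s).
  by move=> [j jq bj]; rewrite /B -bigcup_mkord; exists j.
(* For a circuit in G, the section contains the seeds on which the learner succeeds against the lazy
   oracle, of probability at least alpha. *)
have lower : ((alpha * beta)%:E <= (P \x Q) B)%E.
  apply: le_trans (_ : (alpha%:E * P G <= _)%E).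
    by rewrite EFinM; apply: lee_wpmul2l; rewrite ?lee_fin.
  rewrite -integral_cst //; apply: le_trans (_ : (\int[P]_(w in G) Q (xsection B w) <= _)%E).
    apply: ge0_le_integral => //.
    - by apply: measurable_funTS; exact: measurable_fun_xsection.
    move=> w /GL /(_ _ (lazy_oracle_valid (circuit_of g w) t0)) [A' [mA' sA' aA']].
    apply: le_trans aA' _; apply: le_measure; rewrite ?inE //.
      exact: measurable_xsection.
    move=> s /sA' /= dist; rewrite /xsection /= inE; apply: inB.
    by apply: lazy_success dist => //; exact: (circuit_unitary gP).
  apply: ge0_subset_integral => //.
  exact: measurable_fun_xsection.
(* Fubini: for a fixed seed the test queries are fixed, so the section is a union of q + 1 deviation
   events over the circuits. *)
have upper : ((P \x Q) B <= (q.+1%:R * p)%:E)%E.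
  rewrite (product_measure_unique (m' := (P \x^ Q)%E)) //; last first.
    by move=> A1 A2 mA1 mA2; exact: product_measure2E.
  rewrite /product_measure2.
  apply: le_trans (_ : (\int[Q]_(s in setT) (q.+1%:R * p)%:E <= _)%E).
    apply: ge0_le_integral => //; first exact: measurable_fun_ysection.
    move=> s _ /=.
    have sec j : ysection (D j) s =
        [set w | tau <= `|deviation g (test_query A x0 j s).2 (test_query A x0 j s).1 w|].
      by apply/seteqP; split => w /=; rewrite /ysection /= inE.
    have bj j : (P (ysection (D j) s) <= p%:E)%E.
      rewrite sec; apply: (deviation_prob n_gt1 haarP gP) => //.
      - exact: test_query_density.
      - exact: test_query_herm.
      - exact: test_query_frobenius.
    have -> : ysection B s = \big[setU/set0]_(j < q.+1) ysection (D j) s.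
      have BE : B = \bigcup_(j in `I_q.+1) D j by rewrite bigcup_mkord.
      rewrite -(bigcup_mkord q.+1 (fun j => ysection (D j) s)); apply/seteqP; split => w.
        by rewrite /ysection /= inE BE => -[j jq bj']; exists j => //; rewrite /ysection /= inE.
      by move=> [j jq]; rewrite /ysection /= inE => bj'; rewrite inE BE; exists j.
    have mj j : (j < q.+1)%N -> measurable (ysection (D j) s).
      by move=> _; exact: measurable_ysection.
    apply: le_trans (Boole_inequality P mj) _.
    apply: le_trans (_ : (\sum_(j < q.+1) p%:E <= _)%E); first by apply: lee_sum => j _; exact: bj.
    by rewrite sumEFin sumr_const card_ord mulr_natl.
  by rewrite integral_cst //= probability_setT mule1.
by rewrite -lee_fin; exact: le_trans lower upper.
Qed.

End Learning.

(** * Arithmetic of the depth bound and of the small cases *)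

Section Arithmetic.
Context (R : realType).

(** The upper bound on d exponentiated; it is used to absorb 2^-n into n (4/5)^d. *)
Lemma depth_le (n d : nat) : (0 < n)%N ->
  d%:R <= ((n%:R : R) + log2 n%:R) / log2 (5 / 4) ->
  (5 / 4) ^+ d <= n%:R * 2 ^+ n :> R.
Proof.
move=> n0; have l2 : 0 < ln (2 : R) by rewrite ln_gt0 // ltr1n.
have l54 : 0 < ln (5 / 4 : R) by rewrite ln_gt0 //; lra.
rewrite /log2 ler_pdivlMr ?divr_gt0 // => h.
have p54 : 0 < (5 / 4 : R) by lra.
have np : 0 < (n%:R : R) by rewrite ltr0n.
rewrite -ler_ln ?posrE ?exprn_gt0 ?mulr_gt0 ?exprn_gt0 // lnM ?posrE ?exprn_gt0 //.
rewrite !lnXn // -(mulr_natl _ d) -[ln 2 *+ n]mulr_natl.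
have -> : d%:R * ln (5 / 4 : R) = d%:R * (ln (5 / 4) / ln 2) * ln 2.
  by field; rewrite gt_eqF.
have -> : ln n%:R + n%:R * ln 2 = (n%:R + ln n%:R / ln 2) * ln 2 :> R.
  by field; rewrite gt_eqF.
by rewrite ler_pM2r.
Qed.

(** With K = (5/4)^d at most 2, the lower bound to be proved is below 1. *)
Lemma trivial_range (alpha beta tau K : R) (n q : nat) : (0 < n)%N ->
  0 <= alpha <= 1 -> 0 <= beta <= 1 -> 0 < tau -> tau <= 1 / 3 -> 0 <= K -> K <= 2 ->
  1 / 4 * ((2 * alpha - 1) * beta / n%:R * tau ^+ 2 * K) <= q%:R + 1.
Proof.
move=> n0 /andP[a0 a1] /andP[b0 b1] t0 t1 K0 K2.
have u1 : (n%:R : R)^-1 <= 1 by rewrite invf_le1 ?ler1n ?ltr0n.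
have u0 : 0 <= (n%:R : R)^-1 by rewrite invr_ge0.
have ab : (2 * alpha - 1) * beta <= 1.
  by apply: le_trans (_ : 1 * beta <= _); [rewrite ler_wpM2r //; lra | rewrite mul1r].
have t21 : tau ^+ 2 <= 1 by rewrite expr_le1 ?ltW //; lra.
have tK : 0 <= tau ^+ 2 * K by rewrite mulr_ge0 // sqr_ge0.
have v0 : 0 <= (n%:R)^-1 * (tau ^+ 2 * K) by rewrite mulr_ge0.
have v2 : (n%:R)^-1 * (tau ^+ 2 * K) <= 2.
  apply: le_trans (_ : tau ^+ 2 * K <= _); first by rewrite ler_piMl.
  by apply: le_trans K2; rewrite ler_piMl.
have : (2 * alpha - 1) * beta * ((n%:R)^-1 * (tau ^+ 2 * K)) <= 2.
  by apply: le_trans v2; rewrite ler_piMl.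
rewrite !mulrA => h; have := ler0n R q; lra.
Qed.

End Arithmetic.

Theorem theorem4 (R : realType) :
  exists2 c : R, 0 < c &
  forall (n d q : nat) (tau eps alpha beta : R)
    (dO : measure_display) (Omega : measurableType dO)
    (P : probability Omega R)
    (haar : probability (mxspace R 4) R)
    (g : 'I_d * 'I_n -> Omega -> mxspace R 4)
    (dS : measure_display) (S : measurableType dS) (Q : probability S R)
    (A : learner R S (2 ^ n) q),
  0 < tau -> tau <= eps -> eps <= 1 / 3 * (1 - 1 / (2 ^ n)%:R) ->
  log2 (n%:R : R) / log2 (5 / 4) <= d%:R ->
  d%:R <= ((n%:R : R) + log2 n%:R) / log2 (5 / 4) ->
  0 <= alpha <= 1 -> 0 <= beta <= 1 ->
  haar_measure haar -> RQC_gates P haar g ->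
  prob_ge P
    [set w | learns Q A tau eps alpha (@circuit R n d (fun p => g p w))] beta ->
  c * ((2 * alpha - 1) * beta / n%:R * tau ^+ 2 * (5 / 4) ^+ d) <= q%:R + 1.
Proof.
(* The second moment 2^-n + 2 (4/5)^(d-1) is at most (1 + 5/2) n (4/5)^d, which is rounded up to 4 n
   (4/5)^d. *)
exists (1 / 4) => [|n d q tau eps alpha beta dO Omega P haar g dS S Q A]; first lra.
move=> t0 te e3 _ hd a01 b01 haarP gP learn.
(* For n = 0 the hypotheses give eps <= 0 < tau. *)
have [n0|n0] := posnP n.
  by exfalso; move: e3; rewrite n0 expn0 divr1 subrr mulr0; lra.
have zE : 1 / (2 ^ n)%:R = (2 ^+ n)^-1 :> R by rewrite div1r natrX.
have z0 : 0 < (2 ^+ n : R)^-1 by rewrite invr_gt0 exprn_gt0.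
rewrite zE in e3; have t13 : tau <= 1 / 3 by lra.
have dle := depth_le n0 hd.
have K0 m : 0 <= (5 / 4 : R) ^+ m by rewrite exprn_ge0 //; lra.
(* On a single qubit the depth bound reads (5/4)^d <= 2. *)
have [n1|n1] := leqP n 1.
  apply: trivial_range => //; apply: le_trans dle _.
  have -> : n = 1%N by apply/eqP; rewrite eqn_leq n1.
  by rewrite expr1 mul1r.
(* The variance bound takes at least two layers, to touch every qubit; for depth 0 or 1, (5/4)^d is
   at most 2. *)
case: d g gP learn hd dle => [|[|d]] g gP learn hd dle.
- by apply: trivial_range => //; rewrite expr0 ler1n.
- by apply: trivial_range => //; rewrite expr1; lra.
have /andP[a0 a1] := a01; have /andP[b0 b1] := b01.
have := learning_bound n1 haarP gP t0 te e3 a0 b0 learn.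
set w := (5 / 4 : R) ^+ d.+2 in dle *.
have w0 : 0 < w by rewrite exprn_gt0 //; lra.
have -> : (4 / 5 : R) ^+ d.+1 = 5 / 4 / w.
  have -> : 4 / 5 = (5 / 4 : R)^-1 by field.
  by rewrite exprVn /w [in RHS]exprS; field; rewrite expf_neq0 //; lra.
have np : 1 <= (n%:R : R) by rewrite ler1n.
have nz : (n%:R : R) != 0 by rewrite pnatr_eq0 -lt0n.
have wz : w != 0 by rewrite gt_eqF.
have zw : (2 ^+ n : R)^-1 <= n%:R / w.
  by rewrite ler_pdivlMr // mulrC ler_pdivrMr // exprn_gt0.
have t2 : 0 < tau ^+ 2 by rewrite exprn_gt0.
rewrite mulrA ler_pdivlMr // -natr1 => h.
rewrite -[X in X <= _]mulr1.
have -> : 1 / 4 * ((2 * alpha - 1) * beta / n%:R * tau ^+ 2 * w) * 1 =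
  ((2 * alpha - 1) * beta * tau ^+ 2 * w) / (4 * n%:R).
  by field.
rewrite ler_pdivrMr; last lra.
have q0 : 0 <= (q%:R : R) by [].
have h1 : (q%:R + 1) * ((2 ^+ n)^-1 + 2 * (5 / 4 / w)) <= (q%:R + 1) * (4 * n%:R / w).
  apply: ler_wpM2l; first lra.
  have -> : 4 * n%:R / w = n%:R / w + 3 * (n%:R / w) :> R by field.
  have iw : 0 < w^-1 by rewrite invr_gt0.
  have : 1 / w <= n%:R / w by rewrite ler_pM2r.
  lra.
(* The bound obtained has alpha where 2 alpha - 1 <= alpha is needed. *)
have h2 : (2 * alpha - 1) * beta * tau ^+ 2 <= (q%:R + 1) * (4 * n%:R / w).
  apply: le_trans h1; apply: le_trans h; rewrite ler_wpM2r ?sqr_ge0 // ler_wpM2r //; lra.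
by rewrite -ler_pdivlMr // (le_trans h2) // !mulrA.
Qed.
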